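(* Let $\Omega\subset\mathbb{R}^n$ be an open domain. Let $M:[0,\infty)\to[0,\infty)$ be an $N$-function of class $C^1((0,\infty))$ that satisfies the $\Delta_2$-condition and is such that $M'(\lambda)/\lambda$ is bounded for $\lambda$ near zero. Let $\mu(dx)=e^{-\varphi(x)}dx$ be a Radon measure on $\Omega$, where $\varphi:\Omega\to\mathbb{R}$ belongs to $W^{1,\infty}_{loc}(\Omega)$. Let $P,Q:[0,\infty)\to[0,\infty)$ be nondecreasing measurable functions with $P(0)=Q(0)=0$ such that for all $u,v,w>0$ $$\frac{M(u)}{u^2}\,vw\le M(u)+P(v)+Q(w).$$ Suppose that there are constants $K_1,K_2,A>0$ such that for every $u\in C_0^\infty(\Omega)$ $$\int_\Omega P(|\nabla\varphi|\,|u|)\,d\mu\le K_1\int_\Omega P(A|\nabla u|)\,d\mu+K_2\int_\Omega M(|u|)\,d\mu .$$ Then: 1) There exist constants $L,B>0$ such that for every $\theta\in(0,1]$ and every $u\in C_0^\infty(\Omega)$ $$\int_\Omega M(|\nabla u|)\,d\mu\le L\int_\Omega P(\theta|\nabla^{(2)}u|)\,d\mu+\int_\Omega Q\Big(\frac{B}{\theta}|u|\Big)\,d\mu .$$ 2) If $P$ and $Q$ are $N$-functions, then for every $u\in C_0^\infty(\Omega)$ $$\|\nabla u\|_{L^M(\Omega,\mu)}\le L_1\sqrt{\|\nabla^{(2)}u\|_{L^P(\Omega,\mu)}\,\|u\|_{L^Q(\Omega,\mu)}}+L_2\|u\|_{L^Q(\Omega,\mu)},$$ where $L_1=2(L+2)\sqrt{B}$,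 $L_2=2(L+2)B$ and $L,B$ are the same constants as in 1).
   Context: $C_0^\infty(\Omega)$ denotes the smooth real-valued functions compactly supported in $\Omega$; $\nabla^{(2)}u$ is the matrix of second-order partial derivatives of $u$ and $|\nabla^{(2)}u|$ its Euclidean (Hilbert–Schmidt) norm. An $N$-function is a continuous convex function $M:[0,\infty)\to[0,\infty)$ with $\lim_{\lambda\to0}M(\lambda)/\lambda=\lim_{\lambda\to\infty}\lambda/M(\lambda)=0$. $M$ satisfies the $\Delta_2$-condition if there is $c>0$ with $M(2\lambda)\le cM(\lambda)$ for all $\lambda>0$. For an $N$-function $R$ the Luxemburg norm is $\|f\|_{L^R(\Omega,\mu)}=\inf\{k>0:\int_\Omega R(|f(x)|/k)\,d\mu(x)\le1\}$; for vector- or matrix-valued $f$, $|f|$ denotes the Euclidean norm. *)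

(* Defs.v *)
From HB Require Import structures.
From mathcomp Require Import all_boot all_order all_algebra.
From mathcomp Require Import all_classical all_reals all_analysis.

Set Implicit Arguments.
Unset Strict Implicit.
Unset Printing Implicit Defensive.

Import Order.TTheory GRing.Theory Num.Theory.
Import numFieldNormedType.Exports.

Local Open Scope classical_set_scope.
Local Open Scope ring_scope.

(* 'rV[R]_n carries the sigma-algebra generated by the n coordinates, i.e. the
   product of the Borel sigma-algebras of R; it coincides with the Borel
   sigma-algebra of R^n since R is second countable. *)
Definition measure_row_display : measure_display -> measure_display.
Proof. exact. Qed.

Section measurable_row.
Context {d : measure_display} {T : sigmaRingType d}.
Variable n : nat.

Let coors : 'I_n -> 'rV[T]_n -> T := fun i x => x ord0 i.

Let row_set0 : g_sigma_preimage coors set0.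
Proof. exact: sigma_algebra0. Qed.

Let row_setC A : g_sigma_preimage coors A -> g_sigma_preimage coors (~` A).
Proof. exact: sigma_algebraC. Qed.

Let row_bigcup (F : (set 'rV[T]_n)^nat) :
  (forall i, g_sigma_preimage coors (F i)) ->
  g_sigma_preimage coors (\bigcup_i (F i)).
Proof. exact: sigma_algebra_bigcup. Qed.

HB.instance Definition _ := @isMeasurable.Build (measure_row_display d)
  'rV[T]_n (g_sigma_preimage coors) row_set0 row_setC row_bigcup.

End measurable_row.

Lemma measurable_coord (d : measure_display) (T : measurableType d) (n : nat)
    (i : 'I_n) : measurable_fun [set: 'rV[T]_n] (fun x : 'rV[T]_n => x ord0 i).
Proof.
move=> _ Y mY; rewrite setTI; apply: sub_sigma_algebra => /=.
rewrite -bigcup_seq/=; exists i => /=; first by rewrite mem_index_enum.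
by exists Y => //; rewrite setTI.
Qed.

Lemma measurable_fun_rowP (d d' : measure_display) (T : measurableType d)
    (X : measurableType d') (n : nat) (f : X -> 'rV[T]_n) :
  (forall i, measurable_fun [set: X] (fun x => f x ord0 i)) ->
  measurable_fun [set: X] f.
Proof.
move=> mf.
suff : g_sigma_preimage (fun i (x : 'rV[T]_n) => x ord0 i) `<=`
    [set B | measurable (f @^-1` B)].
  by move=> sub _ Y mY; rewrite setTI; exact: sub.
apply: smallest_sub.
  split=> /=.
  - by rewrite preimage_set0; exact: measurable0.
  - by move=> A mA; rewrite setTD preimage_setC; exact: measurableC.
  - by move=> F mF; rewrite preimage_bigcup; exact: bigcupT_measurable.
move=> A; rewrite -bigcup_seq/= => -[i _ [B mB <-]] /=.
by rewrite setTI; have := mf i measurableT B mB; rewrite setTI.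
Qed.

(* Lebesgue measure on R^n by recursion on n: the Dirac mass on the one-point
   space R^0, then the image of the product of the one-dimensional Lebesgue
   measure with the measure on R^n under the identification R x R^n = R^n.+1 *)
Section lebesgue_row.
Context {R : realType}.

Definition row_cons n (p : measurableTypeR R * 'rV[R]_n) : 'rV[R]_n.+1 :=
  \row_i oapp (fun j => p.2 ord0 j) (p.1 : R) (unlift ord0 i).

Definition row_uncons n (x : 'rV[R]_n.+1) : measurableTypeR R * 'rV[R]_n :=
  (x ord0 ord0, \row_j x ord0 (lift ord0 j)).

Lemma row_consK n : cancel (@row_cons n) (@row_uncons n).
Proof.
move=> [a v]; rewrite /row_uncons !mxE/= unlift_none; congr (_, _).
by apply/rowP => j; rewrite !mxE liftK.
Qed.

Lemma measurable_row_cons n : measurable_fun setT (@row_cons n).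
Proof.
apply: measurable_fun_rowP => i.
under eq_fun do rewrite mxE.
case: (unlift ord0 i) => [j|]/=; last exact: measurable_fst.
exact: (measurableT_comp (measurable_coord j) measurable_snd).
Qed.

Lemma measurable_row_uncons n : measurable_fun setT (@row_uncons n).
Proof.
apply: measurable_fun_pair => /=; first exact: measurable_coord.
apply: measurable_fun_rowP => i.
under eq_fun do rewrite mxE.
exact: measurable_coord.
Qed.

Section step.
Context {n : nat} (m : {sigma_finite_measure set 'rV[R]_n -> \bar R}).

Definition lebesgue_row_step : set 'rV[R]_n.+1 -> \bar R :=
  pushforward (lebesgue_measure \x m)%E (@row_cons n).

Let mpreimage (A : set 'rV[R]_n.+1) :
  measurable A -> measurable (@row_cons n @^-1` A).
Proof.
by move=> mA; rewrite -[X in measurable X]setTI; exact: measurable_row_cons.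
Qed.

Let step0 : lebesgue_row_step set0 = 0%E.
Proof. by rewrite /lebesgue_row_step /pushforward preimage_set0 measure0. Qed.

Let step_ge0 A : (0 <= lebesgue_row_step A)%E.
Proof. by rewrite /lebesgue_row_step /pushforward measure_ge0. Qed.

Let step_sigma_additive : semi_sigma_additive lebesgue_row_step.
Proof.
move=> F mF tF mUF; rewrite /lebesgue_row_step /pushforward preimage_bigcup.
apply: measure_semi_sigma_additive.
- by move=> k; exact: mpreimage.
- apply/trivIsetP => /= i j _ _ ij; rewrite -preimage_setI.
  by move/trivIsetP : tF => /(_ _ _ _ _ ij) ->//; rewrite preimage_set0.
- by rewrite -preimage_bigcup; exact: mpreimage.
Qed.

HB.instance Definition _ := isMeasure.Build _ _ _ lebesgue_row_step
  step0 step_ge0 step_sigma_additive.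

Let product_sigma_finite : sigma_finite setT (lebesgue_measure \x m)%E.
Proof.
have /sigma_finiteP[F [TF ndF Foo]] := sigma_finiteT (@lebesgue_measure R).
have /sigma_finiteP[G [TG ndG Goo]] := sigma_finiteT m.
exists (fun k => F k `*` G k).
  rewrite -setXTT TF TG predeqE => -[x y]; split.
    move=> [/= [i _ Fix] [k _ Gky]]; exists (maxn i k) => //; split.
    - by move: x Fix; exact/subsetPset/ndF/leq_maxl.
    - by move: y Gky; exact/subsetPset/ndG/leq_maxr.
  by move=> [i _ []/= ? ?]; split; exists i.
move=> k; have [? ?] := Foo k; have [? ?] := Goo k.
split; first exact: measurableX.
by rewrite product_measure1E// lte_mul_pinfty// ge0_fin_numE.
Qed.

Let step_sigma_finite : sigma_finite setT lebesgue_row_step.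
Proof.
have [F FT Foo] := product_sigma_finite.
exists (fun k => @row_uncons n @^-1` F k).
  by rewrite -preimage_bigcup -FT preimage_setT.
move=> k; have [mF Fk] := Foo k; split.
  by rewrite -[X in measurable X]setTI; exact: measurable_row_uncons.
rewrite /lebesgue_row_step /pushforward -comp_preimage.
suff -> : (@row_uncons n \o @row_cons n) = id by rewrite preimage_id.
by apply/funext => x /=; rewrite row_consK.
Qed.

HB.instance Definition _ := Measure_isSigmaFinite.Build _ _ _
  lebesgue_row_step step_sigma_finite.

End step.

Fixpoint lebesgue_row (n : nat) : {sigma_finite_measure set 'rV[R]_n -> \bar R} :=
  match n with
  | 0 => \d_(0 : 'rV[R]_0)
  | n'.+1 => lebesgue_row_step (lebesgue_row n')
  end.

End lebesgue_row.

Lemma measurable_box (R : realType) (n : nat) (A : 'I_n -> set R) :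
  (forall i, measurable (A i)) ->
  measurable [set x : 'rV[R]_n | forall i, A i (x ord0 i)].
Proof.
move=> mA.
rewrite (_ : mkset _ = \bigcap_(i in [set: 'I_n])
    ((fun x : 'rV[R]_n => x ord0 i) @^-1` A i)); last first.
  by apply/seteqP; split=> [x h i _|x h i]; exact: (h i).
apply: fin_bigcap_measurable => // i _; rewrite -[X in measurable X]setTI.
exact: measurable_coord.
Qed.

Lemma lebesgue_row_box (R : realType) (n : nat) (A : 'I_n -> set R) :
  (forall i, measurable (A i)) ->
  lebesgue_row n [set x : 'rV[R]_n | forall i, A i (x ord0 i)] =
  (\prod_(i < n) lebesgue_measure (A i : set (measurableTypeR R)))%E.
Proof.
elim: n A => [|n IH] A mA /=.
  rewrite big_ord0 diracE mem_set//=.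
  by case.
rewrite big_ord_recl -IH; last by move=> i; exact: mA.
have mbox := measurable_box (fun i => mA (lift ord0 i)).
rewrite -(@product_measure1E _ _ _ _ _ lebesgue_measure (lebesgue_row n)
  (A ord0) _ (mA ord0) mbox).
rewrite /lebesgue_row_step /pushforward; congr (product_measure1 _ _ _).
apply/seteqP; split=> -[a v] /=.
- move=> h; split=> [|i].
    by have := h ord0; rewrite mxE unlift_none.
  by have := h (lift ord0 i); rewrite mxE liftK.
- by move=> [ha hv] i; rewrite mxE; case: unliftP => [j ->|->]//=.
Qed.

Section calculus.
Context {R : realType}.

Definition evec n (i : 'I_n) : 'rV[R]_n := delta_mx ord0 i.

(* The library norm on matrices is the sup norm. *)
Definition eucl_norm m n (A : 'M[R]_(m, n)) : R :=
  Num.sqrt (\sum_i \sum_j A i j ^+ 2).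

Definition grad n (u : 'rV[R]_n -> R) (x : 'rV[R]_n) : 'rV[R]_n :=
  \row_i 'D_(evec i) u x.

Definition hess n (u : 'rV[R]_n -> R) (x : 'rV[R]_n) : 'M[R]_n :=
  \matrix_(i, j) 'D_(evec i) (fun y => 'D_(evec j) u y) x.

Fixpoint Ck n (k : nat) (u : 'rV[R]_n -> R) : Prop :=
  match k with
  | 0 => continuous u
  | k'.+1 => continuous u /\ forall i : 'I_n,
      (forall x, derivable u x (evec i)) /\ Ck k' (fun x => 'D_(evec i) u x)
  end.

(* An element of C_0^oo(Omega) is identified with its extension by zero to
   R^n, which is smooth on R^n. *)
Definition test_function n (Omega : set 'rV[R]_n) (u : 'rV[R]_n -> R) : Prop :=
  [/\ forall k, Ck k u,
      compact (closure [set x | u x != 0]) &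
      closure [set x | u x != 0] `<=` Omega].

Definition Linfty_loc n (Omega : set 'rV[R]_n) (f : 'rV[R]_n -> R) : Prop :=
  measurable_fun Omega f /\
  forall K : set 'rV[R]_n, compact K -> K `<=` Omega ->
    exists C : R, {ae lebesgue_row n, forall x, K x -> `|f x| <= C}.

Definition weak_gradient n (Omega : set 'rV[R]_n) (f : 'rV[R]_n -> R)
    (g : 'rV[R]_n -> 'rV[R]_n) : Prop :=
  forall (i : 'I_n) (psi : 'rV[R]_n -> R), test_function Omega psi ->
    (\int[lebesgue_row n]_(x in Omega) (f x * 'D_(evec i) psi x)%:E =
     - \int[lebesgue_row n]_(x in Omega) (g x ord0 i * psi x)%:E)%E.

(* f belongs to W^{1,oo}_loc(Omega) and g is its weak gradient. *)
Definition W1oo_loc n (Omega : set 'rV[R]_n) (f : 'rV[R]_n -> R)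
    (g : 'rV[R]_n -> 'rV[R]_n) : Prop :=
  [/\ Linfty_loc Omega f,
      forall i, Linfty_loc Omega (fun x => g x ord0 i) &
      weak_gradient Omega f g].

Definition radon_on n (Omega : set 'rV[R]_n)
    (mu : {measure set 'rV[R]_n -> \bar R}) : Prop :=
  (forall K : set 'rV[R]_n, compact K -> K `<=` Omega -> (mu K < +oo)%E) /\
  (forall A : set 'rV[R]_n, measurable A -> A `<=` Omega ->
    mu A = ereal_sup [set mu K | K in [set K | compact K /\ K `<=` A]]).

(* The function is only considered on [0, +oo[.  The limit of x / N x at +oo
   presupposes that N x does not vanish for large x; as _ / 0 = 0 here, this
   has to be stated. *)
Definition N_function (N : R -> R) : Prop :=
  [/\ forall x : R, 0 <= x -> 0 <= N x,
      {within `[0, +oo[, continuous N},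
      @convex_function R R^o `[0, +oo[ N,
      N x / x @[x --> 0^'+] --> (0 : R) &
      (\forall x \near +oo, 0 < N x) /\ x / N x @[x --> +oo] --> (0 : R)].

Definition Delta2 (N : R -> R) : Prop :=
  exists2 c : R, 0 < c & forall x : R, 0 < x -> N (2 * x) <= c * N x.

Definition C1_pos (N : R -> R) : Prop :=
  forall x : R, 0 < x -> derivable N x 1 /\ {for x, continuous (derive1 N)}.

Definition luxemburg_norm n (mu : {measure set 'rV[R]_n -> \bar R})
    (Omega : set 'rV[R]_n) (N : R -> R) (f : 'rV[R]_n -> R) : \bar R :=
  ereal_inf [set k%:E | k in [set k : R | 0 < k /\
    (\int[mu]_(x in Omega) (N (`|f x| / k))%:E <= 1)%E]].

End calculus.

(* Main.v *)
(* Write |H| for the norm of the Hessian, g(s) = M(sqrt s) / s and let q_k be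
   polynomials such that q_k(s) and s q_k'(s) converge boundedly on bounded intervals
   to g(s) and s g'(s).  The functions u * (q_k(|Du|^2) * D_i u) are products of test
   functions, and the weak chain rule allows one to integrate their divergence by parts
   against exp(-phi).  In the limit, as s |g'(s)| <= const * g(s) by Delta_2,
     \int M(|Du|) dmu <= C \int g(|Du|^2) |u| (|H| + |Du| |Dphi|) dmu.
   The hypothesis on M, P and Q, used with the pairs (theta |H|, c |u| / theta) and
   (delta |Du| |Dphi|, c |u| / delta), then bounds the right-hand side by integrals of
   M(|Du|) with a small factor, of P(theta |H|), of Q(B |u| / theta) and of
   P(delta |Du| |Dphi|); the last one is controlled by the hypothesis on P applied to
   multiples of the partial derivatives D_i u.  The terms in M(|Du|) are absorbed, their
   integral being finite.  The second part follows by applying the first one to u / k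
   with a suitable k, and optimizing in theta.

   The weak chain rule for exp(-phi) with phi locally W^{1,oo} is obtained from the
   convexity of exp: difference quotients of phi converge weakly to the weak derivative,
   first against smooth functions and then, being bounded by the norm of the derivative,
   against L^1 limits of those. *)
Require Import Defs.
From HB Require Import structures.
From mathcomp Require Import all_boot all_order all_algebra.
From mathcomp Require Import all_classical all_reals all_analysis.
From mathcomp Require Import measurable_realfun ring lra.
Import Order.TTheory GRing.Theory Num.Theory.
Import numFieldNormedType.Exports.

Set Implicit Arguments.
Unset Strict Implicit.
Unset Printing Implicit Defensive.

Local Open Scope classical_set_scope.
Local Open Scope ring_scope.

(** * Polynomial approximation *)

(** Why polynomials: the weak gradient is tested against smooth functions only, whereas g(|Du|^2)
    D_i u need not be smooth, [M] being merely C^1 away from 0. Moreover g need not have a limit at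
    0, so that bounded pointwise convergence is the most that can be expected there. The variable is
    |Du|^2 because |Du| itself is not smooth. Differentiating q(|Du|^2) brings q'(s) together with
    the quadratic form of the Hessian at Du, which is of size s |H|; hence a bound on s q'(s)
    suffices and none on q'(s) is asked for.

    No doubling is assumed for [P] and [Q], so a constant cannot be pulled out of their arguments.
    This dictates delta: the multiples of D_i u fed to the hypothesis on [P] are so small that A
    times their gradient is at most theta |H|, and monotonicity does the rest. The derivatives D_i u
    stand in for |Du|, which is not a test function; some entry of Du is always comparable to
    |Du|. *)

Fixpoint bernstein {R : comNzRingType} (N : nat) (f : nat -> R) : {poly R} :=
  if N is N'.+1 then
    (1 - 'X) * bernstein N' f + 'X * bernstein N' (fun k => f k.+1)
  else (f 0%N)%:P.

(** For x in [0, 1] the value at x is the mean of f(S), where S counts the successes in N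
    independent trials of probability x. The recursion conditions on one trial, as in de Casteljau's
    algorithm. *)
Lemma bernsteinS {R : comNzRingType} (N : nat) (f : nat -> R) (x : R) :
  (bernstein N.+1 f).[x] =
  (1 - x) * (bernstein N f).[x] + x * (bernstein N (fun k => f k.+1)).[x].
Proof. by rewrite /= !hornerE. Qed.

Lemma bernstein_affine {R : comNzRingType} (N : nat) (f g : nat -> R) (a b x : R) :
  (bernstein N (fun k => a * f k + b * g k)).[x] =
  a * (bernstein N f).[x] + b * (bernstein N g).[x].
Proof.
elim: N f g => [|N IH] f g; first by rewrite /= !hornerE.
by rewrite !bernsteinS !IH; ring.
Qed.

Lemma bernstein_cst {R : comNzRingType} (N : nat) (c x : R) :
  (bernstein N (fun=> c)).[x] = c.
Proof. by elim: N => [|N IH]; rewrite ?bernsteinS ?IH ?hornerE//; ring. Qed.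

(** Second moment of the binomial law about [a]: the variance plus the squared distance of the mean
    from [a]. *)
Lemma bernstein_sqr {R : comNzRingType} (N : nat) (a x : R) :
  (bernstein N (fun k => (k%:R - a) ^+ 2)).[x] =
  N%:R * (x * (1 - x)) + (N%:R * x - a) ^+ 2.
Proof.
elim: N a => [|N IH] a; first by rewrite /= !hornerE.
rewrite bernsteinS IH.
rewrite (_ : (fun k => _) = (fun k => (k%:R - (a - 1)) ^+ 2)); last first.
  by apply/funext => k; rewrite -natr1; ring.
by rewrite IH -natr1; ring.
Qed.

Lemma ler_bernstein {R : realDomainType} (N : nat) (f g : nat -> R) (x : R) :
  0 <= x <= 1 -> (forall k, f k <= g k) ->
  (bernstein N f).[x] <= (bernstein N g).[x].
Proof.
move=> /andP[x0 x1]; elim: N f g => [|N IH] f g fg; first by rewrite /= !hornerE.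
rewrite !bernsteinS lerD// ler_wpM2l ?subr_ge0//; exact: IH.
Qed.

Lemma continuous_compact_unif {R : realType} (f : R -> R) (K : set R) (e : R) :
  continuous f -> compact K -> 0 < e ->
  exists2 d : R, 0 < d & forall x y, K x -> `|x - y| < d -> `|f x - f y| < e.
Proof.
move=> cf /compact_near_coveringP cK e0.
have /= := cK R^o (0^'+) (fun d x => 0 < d -> forall y, `|x - y| < d -> `|f x - f y| < e) _ _.
case=> [x Kx|d /= d0 Hd].
  have /cvgrPdist_lt/(_ _ (divr_gt0 e0 (ltr0n R 2)))[d /= d0 Hd] := cf x.
  exists (ball x (d / 2), [set t | t < d / 2]) => /=.
    split; first by apply: nbhsx_ballx; rewrite divr_gt0.
    by apply: nbhs_right_lt; rewrite divr_gt0.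
  move=> [x' t] /= [xx' td] t0 y x'y.
  have h1 : `|f x - f x'| < e / 2 by apply: Hd; rewrite /ball/= (lt_le_trans xx')//; lra.
  have h2 : `|f x - f y| < e / 2.
    apply: Hd; rewrite /ball/= (splitr d) -(subrKA x') (le_lt_trans (ler_normD _ _))// ltrD//.
    by rewrite (lt_trans x'y).
  by rewrite (splitr e) -(subrKA (f x)) (le_lt_trans (ler_normD _ _))// ltrD// distrC.
exists (d / 2); first by rewrite divr_gt0.
move=> x y Kx; apply: (Hd (d / 2)) => //=; last by rewrite divr_gt0.
  by rewrite sub0r normrN gtr0_norm ?divr_gt0//; lra.
by rewrite divr_gt0.
Qed.

(** Chebyshev's argument: nodes within d of x are handled by uniform continuity, the others by the
    quadratic penalty (2 C / d^2) (x - k/N)^2, whose binomial mean is at most 2 C / (d^2 N). *)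
Lemma weierstrass01 {R : realType} (f : R -> R) (e : R) : continuous f -> 0 < e ->
  exists p : {poly R}, forall x : R, 0 <= x <= 1 -> `|f x - p.[x]| <= e.
Proof.
move=> cf e0.
have e20 : 0 < e / 2 by rewrite divr_gt0.
(* [ler_bernstein] compares node values for every natural number k, including those with k / N > 1;
   such nodes are folded back into [0, 1]. *)
pose clamp (x : R) : R := Num.max 0 (Num.min 1 x).
have clamp01 (x : R) : 0 <= clamp x <= 1.
  by rewrite le_max lexx/= ge_max ler01 ge_min lexx.
have clampE (x : R) : 0 <= x <= 1 -> clamp x = x.
  by move=> /andP[x0 x1]; rewrite /clamp min_r// max_r.
have clampd (x y : R) : `|clamp x - clamp y| <= `|x - y|.
  have := ler_norm (x - y); have := ler_norm (y - x); rewrite [`|y - x|]distrC.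
  rewrite /clamp ler_norml.
  by case: (lerP 1 x) => ?; case: (lerP 1 y) => ?; rewrite ?(max_r (@ler01 R));
    case: (lerP 0 x) => ?; case: (lerP 0 y) => ?; lra.
have compact_I : compact (`[0, 1] : set R) by apply: (@segment_compact R).
have wcf : {within (`[0, 1] : set R), continuous f} by apply: continuous_subspaceT.
have [C C0 fC] : exists2 C : R, 0 < C & forall x, `|f (clamp x)| <= C.
  have := continuous_compact wcf compact_I.
  move=> /compact_bounded[C [Cr HC]].
  exists (`|C| + 1); first by rewrite ltr_wpDl.
  move=> x; apply: (HC (`|C| + 1)); first by rewrite (le_lt_trans (ler_norm _))// ltrDl.
  by exists (clamp x) => //=; rewrite in_itv/= clamp01.
have [d d0 fd] := continuous_compact_unif cf compact_I e20.
(* Large enough for D / N <= e / 2, with D = 2 C / d^2. *)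
pose N := (Num.truncn (2 * (2 * C / d ^+ 2) / e)).+1.
have N0 : 0 < N%:R :> R by rewrite ltr0n.
exists (bernstein N (fun k => f (clamp (k%:R / N%:R)))) => x x01.
pose D := 2 * C / d ^+ 2.
have D0 : 0 < D by rewrite !mulr_gt0// invr_gt0 exprn_gt0.
have key k : `|f x - f (clamp (k%:R / N%:R))| <= e / 2 + D / N%:R ^+ 2 * (k%:R - N%:R * x) ^+ 2.
  have -> : D / N%:R ^+ 2 * (k%:R - N%:R * x) ^+ 2 = D * (x - k%:R / N%:R) ^+ 2.
    by field; rewrite lt0r_neq0.
  have [xd|xd] := ltP `|x - k%:R / N%:R| d.
    have : `|f x - f (clamp (k%:R / N%:R))| < e / 2.
      apply: fd; first by rewrite /= in_itv/=.
      by rewrite -[X in X - _]clampE// (le_lt_trans (clampd _ _)).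
    by move/ltW/le_trans; apply; rewrite lerDl mulr_ge0 ?sqr_ge0// ltW.
  have h1 : `|f x - f (clamp (k%:R / N%:R))| <= 2 * C.
    by rewrite (le_trans (ler_normB _ _))// mulr2n mulrDl mul1r lerD// -(clampE x).
  apply: (le_trans h1); apply: (@le_trans _ _ (D * (x - k%:R / N%:R) ^+ 2)); last by rewrite lerDr ltW.
  rewrite /D -mulrA ler_peMr ?mulr_ge0 ?(ltW C0)//.
  rewrite mulrC ler_pdivlMr ?exprn_gt0// mul1r -[leRHS]real_normK ?num_real//.
  by rewrite lerXn2r ?nnegrE ?(ltW d0).
have up := ler_bernstein N x01 (fun k => le_trans (ler_norm _) (key k)).
have lo := ler_bernstein N x01 (fun k => le_trans (ler_norm _) (eq_ind _ (fun z => z <= _) (key k) _ (distrC _ _))).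
move: up lo; set E1 := bernstein N (fun k => f (clamp (k%:R / N%:R))).
rewrite (_ : (fun k => e / 2 + _ * _) = (fun k => (e / 2) * 1 + D / N%:R ^+ 2 * (k%:R - N%:R * x) ^+ 2)); last first.
  by apply/funext => k; rewrite mulr1.
rewrite (_ : (fun k => f x - _) = (fun k => f x * 1 + (-1) * f (clamp (k%:R / N%:R)))); last first.
  by apply/funext => k; ring.
rewrite (_ : (fun k => _ - f x) = (fun k => (- f x) * 1 + 1 * f (clamp (k%:R / N%:R)))); last first.
  by apply/funext => k; ring.
rewrite !bernstein_affine !bernstein_cst bernstein_sqr -/E1 subrr expr0n/= addr0.
have bnd : D / N%:R ^+ 2 * (N%:R * (x * (1 - x))) <= e / 2.
  rewrite (_ : _ * _ = D * (x * (1 - x)) / N%:R); last by field; rewrite lt0r_neq0.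
  rewrite ler_pdivrMr// (@le_trans _ _ D)//.
    rewrite ler_piMr ?(ltW D0)//; case/andP: x01 => x0 x1.
    by rewrite mulr_ile1 ?subr_ge0// lerBlDr lerDl.
  rewrite mulrAC ler_pdivlMr// -ler_pdivrMl// mulrC mulrC.
  have : 2 * (2 * C / d ^+ 2) / e < N%:R by rewrite truncnS_gt.
  by rewrite -/D => /ltW; rewrite mulrC [D * 2]mulrC.
by move=> up lo; rewrite ler_norml; lra.
Qed.

Lemma weierstrass {R : realType} (f : R -> R) (a b e : R) : a < b ->
  continuous f -> 0 < e ->
  exists p : {poly R}, forall x : R, a <= x <= b -> `|f x - p.[x]| <= e.
Proof.
move=> ab cf e0; have ba0 : 0 < b - a by rewrite subr_gt0.
have [|p pE] := @weierstrass01 R (fun y => f ((b - a) * y + a)) e _ e0.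
  move=> x; apply: continuous_comp; last exact: cf.
  by apply: cvgD; [apply: cvgM; [exact: cvg_cst|exact: cvg_id]|exact: cvg_cst].
exists (p \Po ((b - a)^-1 *: ('X - a%:P))) => x /andP[ax xb].
rewrite horner_comp !hornerE.
have := pE ((b - a)^-1 * (x - a)); rewrite mulVKf ?gt_eqF// subrK; apply.
by rewrite mulrC ler_pdivlMr// ler_pdivrMr// mul0r mul1r subr_ge0 ax/= lerB.
Qed.

(** * N-functions *)

Section N_function_theory.
Context {R : realType} {N : R -> R} (NN : N_function N).

Let N_ge0 (x : R) : 0 <= x -> 0 <= N x. Proof. by case: NN => + _ _ _ _; apply. Qed.

(** N x is the product of N x / x and x, both tending to 0, and N is right-continuous at 0. *)
Lemma N_function0 : N 0 = 0.
Proof.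
case: NN => _ cN _ Nx0 _.
have N0' : N x @[x --> 0^'+] --> N 0.
  by move/continuous_within_itvcyP: cN => [].
have : N x / x * x @[x --> 0^'+] --> (0 * 0 : R).
  apply: cvgM => //; apply: cvg_within_filter; exact: cvg_id.
rewrite mul0r => H.
apply: (cvg_unique _ N0').
- exact: (@norm_hausdorff _ R^o).
- apply: cvg_trans H; apply: near_eq_cvg; near=> x.
  by rewrite divfK//.
Unshelve. all: end_near. Qed.

Lemma N_function_convex (x y t : R) : 0 <= x -> 0 <= y -> 0 <= t <= 1 ->
  N (t * x + (1 - t) * y) <= t * N x + (1 - t) * N y.
Proof.
case: NN => _ _ cv _ _ x0 y0 t01.
have := cv (Itv01 (proj1 (andP t01)) (proj2 (andP t01))) x y.
rewrite !inE/= !in_itv/= !andbT => /(_ x0 y0).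
by rewrite !convRE/=.
Qed.

Lemma N_function_scale (x t : R) : 0 <= x -> 0 <= t <= 1 -> N (t * x) <= t * N x.
Proof.
move=> x0 t01; have := N_function_convex x0 (lexx 0) t01.
by rewrite N_function0 !mulr0 !addr0.
Qed.

(** Monotonicity is derived rather than assumed: convexity and [N 0 = 0] give N x <= (x / y) N y. *)
Lemma N_function_le (x y : R) : 0 <= x -> x <= y -> N x <= N y.
Proof.
move=> x0; rewrite le_eqVlt => /predU1P[->//|xy].
have y0 : 0 < y by exact: le_lt_trans xy.
have t01 : 0 <= x / y <= 1.
  by rewrite divr_ge0 ?(ltW y0)//= ler_pdivrMr// mul1r ltW.
have := N_function_scale (ltW y0) t01; rewrite divfK ?gt_eqF// => /le_trans; apply.
by rewrite ler_piMl ?N_ge0 ?(ltW y0)//; case/andP: t01.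
Qed.

Let derive1_cvg (x : R) : derivable N x 1 ->
  h^-1 * (N (h + x) - N x) @[h --> 0^'] --> derive1 N x.
Proof.
by rewrite /derivable; under eq_fun do rewrite scaler1.
Qed.

(** By convexity the tangent at x lies below the graph at 0, where N vanishes. *)
Lemma N_function_le_derive (x : R) : 0 < x -> derivable N x 1 ->
  N x <= x * derive1 N x.
Proof.
move=> x0 dN; rewrite -ler_pdivrMl// mulrC.
apply: cvgr_to_ge (cvg_dnbhs_at_left (derive1_cvg dN)) _.
near=> h.
have h0 : h < 0 by [].
have hx : - x <= h by near: h; apply: nbhs_left_ge; rewrite oppr_lt0.
rewrite [leRHS]mulrC ler_ndivlMr//.
have t01 : 0 <= (h + x) / x <= 1.
  rewrite divr_ge0 ?(ltW x0)//= -?lerBlDr ?sub0r// ler_pdivrMr// mul1r.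
  by rewrite gerDr ltW.
have := N_function_scale (ltW x0) t01; rewrite divfK ?gt_eqF// => Nh.
rewrite lerBlDr (le_trans Nh)// le_eqVlt; apply/orP; left; apply/eqP; field.
by rewrite gt_eqF.
Unshelve. all: end_near. Qed.

(** The slope at x is at most that of the chord over [x, 2x]. Doubling the argument is what lets
    Delta_2 control the derivative. *)
Lemma N_function_ge_derive (x : R) : 0 < x -> derivable N x 1 ->
  x * derive1 N x <= N (2 * x) - N x.
Proof.
move=> x0 dN; rewrite -ler_pdivlMl// mulrC.
apply: cvgr_to_le (cvg_dnbhs_at_right (derive1_cvg dN)) _.
near=> h.
have h0 : 0 < h by [].
have hx : h <= x by near: h; apply: nbhs_right_le.
have t01 : 0 <= h / x <= 1.
  by rewrite divr_ge0 ?(ltW x0) ?(ltW h0)//= ler_pdivrMr// mul1r.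
have x20 : 0 <= 2 * x by rewrite mulr_ge0// ltW.
have := N_function_convex x20 (ltW x0) t01.
have -> : h / x * (2 * x) + (1 - h / x) * x = h + x by field; rewrite gt_eqF.
move=> Nh; rewrite ler_pdivrMl// lerBlDr (le_trans Nh)//.
by rewrite le_eqVlt; apply/orP; left; apply/eqP; field; rewrite gt_eqF.
Unshelve. all: end_near. Qed.

End N_function_theory.

(** * The quotient M(sqrt s) / s and its derivative *)

Section quadratic_quotient.
Context {R : realType} (M : R -> R) (NM : N_function M) (M_C1 : C1_pos M).

(** The function g of the overview. The default values of the square root and of division make it 0
    for s <= 0, whatever its behaviour as s decreases to 0: for M(x) = x^2 it is 1 on s > 0. *)
Definition quot2 (s : R) : R := M (Num.sqrt s) / s.

(* [s] times the derivative of [quot2] at [s > 0] *)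
Definition quot2' (s : R) : R :=
  (Num.sqrt s * derive1 M (Num.sqrt s) / 2 - M (Num.sqrt s)) / s.

Let M_ge0 (x : R) : 0 <= x -> 0 <= M x. Proof. by case: NM => + _ _ _ _; apply. Qed.

Lemma quot2_le0 (s : R) : s <= 0 -> quot2 s = 0.
Proof. by move=> s0; rewrite /quot2 ler0_sqrtr// N_function0// mul0r. Qed.

Lemma quot2_ge0 (s : R) : 0 <= quot2 s.
Proof.
have [s0|s0] := leP s 0; first by rewrite quot2_le0.
by rewrite divr_ge0 ?M_ge0 ?sqrtr_ge0// ltW.
Qed.

Lemma is_derive_quot2 (s : R) : 0 < s -> is_derive s 1 quot2 (quot2' s / s).
Proof.
move=> s0.
have sq0 : 0 < Num.sqrt s by rewrite sqrtr_gt0.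
have [dM _] := M_C1 sq0.
have h1 : is_derive s 1 (M \o Num.sqrt) (derive1 M (Num.sqrt s) * (2 * Num.sqrt s)^-1).
  rewrite derive1E; exact: (@is_derive1_comp R M Num.sqrt s _ _ (derivableP dM) (is_derive1_sqrt s0)).
have h2 : is_derive s 1 (fun x : R => x^-1) (- s ^- 2).
  have := is_deriveV (lt0r_neq0 s0) (is_derive_id s 1).
  by rewrite /GRing.scale/= mulr1.
apply: (@is_derive_eq _ _ _ ((M \o Num.sqrt) * (fun x : R => x^-1))).
rewrite /quot2' /= /GRing.scale/=.
have -> : (2 * Num.sqrt s)^-1 = Num.sqrt s / (2 * s).
  by rewrite -[in RHS](sqr_sqrtr (ltW s0)) sqrtr_sqr ger0_norm ?sqrtr_ge0//; field; rewrite gt_eqF.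
by field; rewrite gt_eqF.
Qed.

(** With y = sqrt s, the product y M'(y) lies between M y and (c - 1) M y: the lower bound is
    convexity, the upper one convexity and Delta_2. *)
Lemma quot2'_le (c : R) (s : R) : (forall x : R, 0 < x -> M (2 * x) <= c * M x) ->
  0 <= s -> `|quot2' s| <= (`|c| + 1) * quot2 s.
Proof.
move=> Mc; rewrite le_eqVlt => /predU1P[<-|s0].
  by rewrite quot2_le0// /quot2' invr0 !mulr0 normr0.
have sq0 : 0 < Num.sqrt s by rewrite sqrtr_gt0.
have [dM _] := M_C1 sq0.
rewrite /quot2' /quot2 normrM mulrA [`|s^-1|]ger0_norm ?invr_ge0 ?(ltW s0)// ler_pM2r ?invr_gt0//.
have h1 := N_function_le_derive NM sq0 dM.
have h2 := N_function_ge_derive NM sq0 dM.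
have h3 := Mc _ sq0.
have h4 := M_ge0 (ltW sq0).
have h5 : c * M (Num.sqrt s) <= `|c| * M (Num.sqrt s) by rewrite ler_wpM2r// ler_norm.
rewrite ler_norml; lra.
Qed.

(** Near 0, M(y) / y^2 <= M'(y) / y is bounded by hypothesis; for y >= r the numerator is at most
    M(sqrt S) and the denominator is bounded below. *)
Lemma quot2_bounded (S : R) :
  (exists C : R, \forall x \near 0^'+, `|derive1 M x / x| <= C) ->
  exists C : R, forall s : R, s <= S -> quot2 s <= C.
Proof.
move=> [C [r /= r0 Cr]].
exists (Num.max 0 (Num.max C (M (Num.sqrt S) / (r ^+ 2 / 4)))) => s sS.
have [s0|s0] := leP s 0; first by rewrite quot2_le0// le_max lexx.
have sq0 : 0 < Num.sqrt s by rewrite sqrtr_gt0.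
have [dM _] := M_C1 sq0.
rewrite !le_max; apply/orP; right.
have [sr|sr] := ltP (Num.sqrt s) r.
  apply/orP; left; apply: le_trans (Cr (Num.sqrt s) _ sq0) => /=; last first.
    by rewrite sub0r normrN gtr0_norm.
  apply: le_trans (ler_norm _).
  rewrite /quot2 ler_pdivrMr// (le_trans (N_function_le_derive NM sq0 dM))//.
  rewrite -[X in _ / _ * X](sqr_sqrtr (ltW s0)) le_eqVlt; apply/orP; left.
  by apply/eqP; field; rewrite gt_eqF.
apply/orP; right; rewrite /quot2 ler_pM ?M_ge0 ?sqrtr_ge0 ?invr_ge0 ?(ltW s0)//.
  by apply: N_function_le; rewrite ?sqrtr_ge0 ?ler_wsqrtr.
rewrite lef_pV2 ?posrE ?divr_gt0 ?exprn_gt0//.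
rewrite -[leRHS](sqr_sqrtr (ltW s0)) (@le_trans _ _ (r ^+ 2))//.
  by rewrite ler_pdivrMr// ler_peMr ?sqr_ge0// ler1n.
by rewrite lerXn2r ?nnegrE ?sqrtr_ge0// ltW.
Qed.

End quadratic_quotient.

Definition poly_primitive {F : fieldType} (p : {poly F}) : {poly F} :=
  \poly_(i < (size p).+1) (p`_i.-1 / i%:R).

Lemma deriv_poly_primitive {F : numFieldType} (p : {poly F}) :
  (poly_primitive p)^`() = p.
Proof.
apply/polyP => i; rewrite coef_deriv coef_poly ltnS /=.
have [ip|ip] := ltnP i (size p); last by rewrite mul0rn nth_default.
by rewrite -[LHS]mulr_natr divfK// pnatr_eq0.
Qed.

Lemma horner_poly_primitive0 {F : fieldType} (p : {poly F}) :
  (poly_primitive p).[0] = 0.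
Proof. by rewrite horner_coef0 coef_poly/= invr0 mulr0. Qed.

Lemma derivable1_continuous {R : realType} (f : R -> R) (x : R) :
  derivable f x 1 -> {for x, continuous f}.
Proof. by move=> /derivable1_diffP/differentiable_continuous. Qed.

(** * Polynomial approximation of the quotient *)

Section quot2_approx.
Context {R : realType} {M : R -> R} (NM : N_function M) (M_C1 : C1_pos M).
Context (c C S : R) (Mc : forall x : R, 0 < x -> M (2 * x) <= c * M x).
Context (S1 : 1 <= S) (MC : forall s : R, s <= S -> quot2 M s <= C).

Let S0 : 0 < S. Proof. exact: lt_le_trans S1. Qed.
Let C0 : 0 <= C. Proof. by have := MC (ltW S0); apply: le_trans; exact: quot2_ge0. Qed.
Let c1 : R := `|c| + 1.
Let c10 : 0 <= c1. Proof. by rewrite addr_ge0. Qed.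

(** Used through its square. A single factor would give g s / (s + d), whose derivative near 0
    behaves like (g + s g') / d and need not converge; the second factor makes the derivative
    O(s). *)
Let cut (d s : R) := s / (s + d).

Let cut01 (d s : R) : 0 < d -> 0 <= s -> 0 <= cut d s <= 1.
Proof.
move=> d0 s0; rewrite /cut divr_ge0//=; last by rewrite addr_ge0// ltW.
by rewrite ler_pdivrMr ?mul1r ?lerDl ?ltW// ltr_wpDl.
Qed.

(* Unlike [quot2 M], its truncation [h d] is of class C^1 on the whole of [0, S], so
   that [h d] and its derivative can be approximated by polynomials at once. *)
Let h (d s : R) := quot2 M s * cut d s ^+ 2.
Let h' (d s : R) := if s <= 0 then 0 else
  (quot2' M s * s + 2 * quot2 M s * cut d s * d) / (s + d) ^+ 2.

Let is_derive_h (d s : R) : 0 < d -> 0 < s -> is_derive s 1 (h d) (h' d s).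
Proof.
move=> d0 s0; rewrite /h' leNgt s0/=.
have sd0 : s + d != 0 by rewrite gt_eqF// addr_gt0.
have ? := is_derive_quot2 M_C1 s0.
have ? : is_derive s 1 (fun s => s + d) 1.
  apply: (@is_derive_eq _ _ _ (id + cst d)); rewrite addr0//.
have ? := is_deriveV sd0 _.
have ? : is_derive s 1 (cut d) (d / (s + d) ^+ 2).
  apply: (@is_derive_eq _ _ _ (id * (fun y => (y + d)^-1))).
  by rewrite /GRing.scale/= /GRing.exp/=; field.
apply: (@is_derive_eq _ _ _ (quot2 M * (cut d ^+ 2))).
rewrite /GRing.scale/= /GRing.exp/= !fctE /cut.
by field; rewrite sd0 gt_eqF.
Qed.

(** The bound does not depend on d, as domination requires: s times the derivative of [cut d] is
    [cut d s] times d / (s + d), hence at most 1. *)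
Let h'_bound (d s : R) : 0 < d -> 0 <= s <= S -> `|s * h' d s| <= c1 * C + 2 * C.
Proof.
move=> d0 /andP[s0 sS]; rewrite /h' (leNgt s); move: s0.
rewrite le_eqVlt => /predU1P[<-|s0].
  by rewrite ltxx mul0r normr0 addr_ge0// mulr_ge0.
rewrite s0/=.
have sd0 : 0 < s + d by rewrite addr_gt0.
have /andP[t0 t1] := cut01 d0 (ltW s0).
have -> : s * ((quot2' M s * s + 2 * quot2 M s * cut d s * d) / (s + d) ^+ 2) =
    quot2' M s * cut d s ^+ 2 + 2 * quot2 M s * (cut d s * (cut d s * (d / (s + d)))).
  by rewrite /cut; field; rewrite gt_eqF.
have t'0 : 0 <= d / (s + d) by rewrite divr_ge0// ltW.
have t'1 : d / (s + d) <= 1 by rewrite ler_pdivrMr// mul1r lerDr ltW.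
have q0 := quot2_ge0 NM s.
rewrite (le_trans (ler_normD _ _))// lerD//.
  rewrite normrM [`|_ ^+ 2|]ger0_norm ?sqr_ge0// (@le_trans _ _ `|quot2' M s|)//.
    by rewrite ler_piMr// expr2 mulr_ile1.
  by rewrite (le_trans (quot2'_le NM M_C1 Mc (ltW s0)))// ler_wpM2l// MC.
set t' := d / (s + d) in t'0 t'1 *.
have p1 : cut d s * t' <= 1 by rewrite mulr_ile1.
have p0 : 0 <= cut d s * t' by rewrite mulr_ge0.
have r1 : cut d s * (cut d s * t') <= 1 by rewrite mulr_ile1.
have r0 : 0 <= cut d s * (cut d s * t') by rewrite mulr_ge0.
rewrite ger0_norm; last by rewrite mulr_ge0// mulr_ge0.
apply: (@le_trans _ _ (2 * quot2 M s)); last by rewrite ler_wpM2l// MC.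
by rewrite ler_piMr// mulr_ge0.
Qed.

Let h_le (d s : R) : 0 < d -> 0 <= s <= S -> 0 <= h d s <= C * s / d.
Proof.
move=> d0 /andP[s0 sS]; have /andP[t0 t1] := cut01 d0 s0.
rewrite /h mulr_ge0 ?quot2_ge0 ?sqr_ge0//= -mulrA ler_pM ?quot2_ge0 ?sqr_ge0 ?MC//.
rewrite expr2 (@le_trans _ _ (cut d s))// ?ler_piMr// /cut ler_wpM2l// lef_pV2 ?posrE ?lerDr//.
by rewrite ltr_wpDl.
Qed.

(** Here the constant blows up with d; the estimate serves for the continuity of [h' d] at 0. *)
Let h'_le (d s : R) : 0 < d -> s <= S -> `|h' d s| <= (c1 * C + 2 * C) / d ^+ 2 * `|s|.
Proof.
move=> d0 sS; rewrite /h'; case: (leP s 0) => s0.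
  by rewrite normr0 mulr_ge0// divr_ge0 ?sqr_ge0// addr_ge0// mulr_ge0.
have sd0 : 0 < s + d by rewrite addr_gt0.
have /andP[t0 t1] := cut01 d0 (ltW s0).
have q0 := quot2_ge0 NM s.
rewrite [leRHS]mulrAC normrM ler_pM//; last first.
  rewrite ger0_norm ?invr_ge0 ?sqr_ge0// lef_pV2 ?posrE ?exprn_gt0//.
  by rewrite lerXn2r ?nnegrE ?(ltW sd0) ?(ltW d0)// lerDr ltW.
rewrite [leRHS]mulrDl (le_trans (ler_normD _ _))// lerD//.
  rewrite normrM ler_wpM2r//.
  by rewrite (le_trans (quot2'_le NM M_C1 Mc (ltW s0)))// ler_wpM2l// MC.
have cd0 : 0 <= cut d s * d by rewrite mulr_ge0// ltW.
have cds : cut d s * d <= s.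
  by rewrite /cut mulrAC ler_pdivrMr// ler_wpM2l ?(ltW s0)// lerDr ltW.
rewrite (ger0_norm (ltW s0)) ger0_norm -mulrA; last by rewrite mulr_ge0// mulr_ge0.
by apply: ler_pM => //; [rewrite mulr_ge0|rewrite ler_wpM2l// MC].
Qed.

Let continuous_h' (d : R) : 0 < d -> continuous (h' d).
Proof.
move=> d0 x; have [x0|x0|->] := ltgtP x 0.
- have e : \forall y \near (x : R), cst 0 y = h' d y.
    near=> y; rewrite /h' ifT//; apply: ltW; near: y; exact: lt_nbhsl.
  by apply: (cvg_trans (near_eq_cvg e)); rewrite /h' ifT ?ltW//; exact: cvg_cst.
- have sd0 : x + d != 0 by rewrite gt_eqF// addr_gt0.
  have sq0 : 0 < Num.sqrt x by rewrite sqrtr_gt0.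
  have [dM cM] := M_C1 sq0.
  have csq := @sqrt_continuous R x.
  have cM0 : {for Num.sqrt x, continuous M}.
    exact: derivable1_continuous dM.
  have cMs : M (Num.sqrt y) @[y --> x] --> M (Num.sqrt x).
    exact: (cvg_comp _ _ csq cM0).
  have cM's : derive1 M (Num.sqrt y) @[y --> x] --> derive1 M (Num.sqrt x).
    exact: (cvg_comp _ _ csq cM).
  have cid : y @[y --> x] --> x by exact: cvg_id.
  have cV : y^-1 @[y --> x] --> x^-1 by apply: cvgV => //; rewrite gt_eqF.
  have cDV : (y + d)^-1 @[y --> x] --> (x + d)^-1.
    by apply: cvgV => //; apply: cvgD => //; exact: cvg_cst.
  have cq : quot2 M y @[y --> x] --> quot2 M x by exact: cvgM.
  have cq' : quot2' M y @[y --> x] --> quot2' M x.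
    apply: cvgM => //; apply: cvgB => //; apply: cvgM; last exact: cvg_cst.
    exact: cvgM.
  have cc : cut d y @[y --> x] --> cut d x by exact: cvgM.
  have hE : h' d x = (quot2' M x * x + 2 * quot2 M x * cut d x * d) * ((x + d)^-1 * (x + d)^-1).
    by rewrite /h' (leNgt x) x0/=; field.
  have e : \forall y \near (x : R), (quot2' M y * y + 2 * quot2 M y * cut d y * d) *
      ((y + d)^-1 * (y + d)^-1) = h' d y.
    near=> y.
    have y0 : 0 < y by near: y; exact: lt_nbhsr.
    by rewrite /h' (leNgt y) y0/= expr2 invfM.
  rewrite /continuous_at hE; apply: (cvg_trans (near_eq_cvg e)).
  apply: cvgM; last exact: cvgM.
  apply: cvgD; first exact: cvgM.
  apply: cvgM; last exact: cvg_cst.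
  by apply: cvgM => //; apply: cvgM => //; exact: cvg_cst.
- have h0E : h' d 0 = 0 by rewrite /h' lexx.
  rewrite /continuous_at h0E; apply/cvgr0Pnorm_lt => e e0.
  pose K := (c1 * C + 2 * C) / d ^+ 2 + 1.
  have K0 : 0 < K.
    by rewrite ltr_wpDl// divr_ge0 ?sqr_ge0// addr_ge0// mulr_ge0.
  near=> y.
  have yS : y <= S by apply: ltW; near: y; exact: lt_nbhsl.
  apply: (le_lt_trans (h'_le d0 yS)).
  apply: (@le_lt_trans _ _ (K * `|y|)); first by rewrite ler_wpM2r// lerDl.
  rewrite mulrC -ltr_pdivlMr//; near: y.
  have /cvgr0Pnorm_lt : y @[y --> (0 : R)] --> (0 : R) by exact: cvg_id.
  by apply; rewrite divr_gt0.
Unshelve. all: end_near. Qed.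

(** The derivative is what gets approximated, to accuracy d / S. The primitive vanishing at 0 is
    then within d of [h d] by the mean value theorem, since [h d] vanishes at 0 too. Thus d is both
    the cut-off parameter and the accuracy. *)
Let h_approx (d : R) : 0 < d ->
  exists q : {poly R}, [/\ q.[0] = 0,
    forall s : R, 0 <= s <= S -> `|q.[s] - h d s| <= d &
    forall s : R, 0 <= s <= S -> `|s * (q^`()).[s] - s * h' d s| <= d].
Proof.
move=> d0; have dS0 : 0 < d / S by rewrite divr_gt0.
have [p ph] := weierstrass S0 (continuous_h' d0) dS0.
exists (poly_primitive p); rewrite deriv_poly_primitive horner_poly_primitive0; split => // s /andP[s0 sS].
  pose f y := (poly_primitive p).[y] - h d y.
  have f0 : f 0 = 0 by rewrite /f horner_poly_primitive0 /h quot2_le0// mul0r subrr.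
  have df x : x \in `]0, s[ -> is_derive x 1 f (p.[x] - h' d x).
    rewrite in_itv/= => /andP[x0 _].
    have := is_derive_poly (poly_primitive p) x; rewrite deriv_poly_primitive => ?.
    have ? := is_derive_h d0 x0.
    exact: (@is_deriveB _ _ _ (horner (poly_primitive p)) (h d) x 1 p.[x] (h' d x)).
  have cf : {within `[0, s], continuous f}.
    apply: continuous_in_subspaceT => x; rewrite inE/= in_itv/= => /andP[x0 xs].
    apply: cvgB; first exact: continuous_horner.
    move: x0; rewrite le_eqVlt => /predU1P[<-|x0]; last first.
      by case: (is_derive_h d0 x0) => dh _; exact: derivable1_continuous dh.
    rewrite [h d 0](_ : _ = 0); last by rewrite /h quot2_le0// mul0r.
    apply/cvgr0Pnorm_lt => e e0; near=> y.
    have yS : y <= S by apply: ltW; near: y; exact: lt_nbhsl.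
    have [y0|y0] := leP y 0; first by rewrite /h quot2_le0// mul0r normr0.
    have y0S : 0 <= y <= S by rewrite (ltW y0).
    have /andP[hy0 hyC] := h_le d0 y0S.
    rewrite ger0_norm// (le_lt_trans hyC)// ltr_pdivrMr//.
    apply: (@le_lt_trans _ _ ((C + 1) * y)); first by rewrite ler_wpM2r ?lerDl// ltW.
    rewrite mulrC -ltr_pdivlMr ?ltr_wpDl//.
    near: y; apply: lt_nbhsl; by rewrite divr_gt0 ?mulr_gt0// ltr_wpDl.
  have [x x0s] := MVT_segment s0 df cf.
  rewrite f0 !subr0 /f => ->; rewrite normrM (ger0_norm s0).
  have x0S : 0 <= x <= S.
    by move: x0s; rewrite in_itv/= => /andP[-> /le_trans]; apply.
  rewrite (@le_trans _ _ (d / S * s))//; first by rewrite ler_wpM2r// distrC ph.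
  by rewrite mulrAC ler_pdivrMr// ler_wpM2l// ltW.
rewrite -mulrBr normrM (ger0_norm s0) distrC.
rewrite (@le_trans _ _ (s * (d / S)))//; first by rewrite ler_wpM2l// ph// s0.
by rewrite mulrCA ler_piMr ?(ltW d0)// ler_pdivrMr// mul1r.
Unshelve. all: end_near. Qed.

(** Cut-off and accuracy are both 1 / (k + 1). Convergence also holds at s = 0, where [h] and s [h']
    vanish and both limits have the default value 0. *)
Lemma quot2_approx : exists q : nat -> {poly R}, exists D : R,
  [/\ forall s : R, 0 <= s <= S -> forall k, `|(q k).[s]| <= D,
      forall s : R, 0 <= s <= S -> forall k, `|s * ((q k)^`()).[s]| <= D,
      forall s : R, 0 <= s <= S -> (q k).[s] @[k --> \oo] --> quot2 M s &
      forall s : R, 0 <= s <= S -> s * ((q k)^`()).[s] @[k --> \oo] --> quot2' M s].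
Proof.
pose e : nat -> R := harmonic.
have e0 k : 0 < e k by rewrite invr_gt0.
have e1 k : e k <= 1 by rewrite invf_le1// ler1n.
have ecvg : e k @[k --> \oo] --> (0 : R) by exact: cvg_harmonic.
have /choice[q qP] := fun k => h_approx (e0 k).
have cvg_approx (a b : nat -> R) (l : R) : (forall k, `|a k - b k| <= e k) ->
    b k @[k --> \oo] --> l -> a k @[k --> \oo] --> l.
  move=> ab bl; rewrite -[l]add0r.
  have -> : a = (fun k => (a k - b k) + b k) by apply/funext => k; rewrite subrK.
  apply: cvgD => //; apply: norm_cvg0.
  apply: (squeeze_cvgr _ (@cvg_cst _ (0 : R) _ _ _) ecvg).
  by near=> k; rewrite normr_ge0/=.
have cutcvg s : 0 < s -> cut (e k) s @[k --> \oo] --> (1 : R).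
  move=> s0; rewrite -(divff (lt0r_neq0 s0)); apply: cvgM; first exact: cvg_cst.
  apply: cvgV; first by rewrite lt0r_neq0.
  by rewrite -[X in _ --> X]addr0; apply: cvgD => //; exact: cvg_cst.
(* Covers C for [h], c1 C + 2 C for s [h'], and 1 for the approximation error. *)
exists q, (c1 * C + 3 * C + 1); split => s s0S.
- move=> k; have [_ /(_ _ s0S) + _] := qP k.
  have := h_le (e0 k) s0S => /andP[h0 _] qh.
  rewrite -(subrK (h (e k) s) (q k).[s]) (le_trans (ler_normD _ _))//.
  have : `|h (e k) s| <= C.
    rewrite ger0_norm// /h (@le_trans _ _ (quot2 M s))// ?MC//; last by case/andP: s0S.
    have /andP[t0 t1] := cut01 (e0 k) (proj1 (andP s0S)).
    by rewrite ler_piMr ?quot2_ge0// expr2 mulr_ile1.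
  have c1C : 0 <= c1 * C by rewrite mulr_ge0.
  move=> hC; have := le_trans qh (e1 k).
  clearbody c1 h e; move: C0 hC c1C; lra.
- move=> k; have [_ _ /(_ _ s0S) qh] := qP k.
  have := h'_bound (e0 k) s0S.
  move=> hb; rewrite -(subrK (s * h' (e k) s) (s * (_).[s])) (le_trans (ler_normD _ _))//.
  have := le_trans qh (e1 k).
  clearbody c1 h' e; move: C0 hb; lra.
- apply: (cvg_approx _ (fun k => h (e k) s)) => [k|]; first by have [_ /(_ _ s0S)] := qP k.
  case/andP: s0S; rewrite le_eqVlt => /predU1P[<- _|s0 sS].
    rewrite /h quot2_le0//; under eq_fun do rewrite mul0r; exact: cvg_cst.
  rewrite -[X in _ --> X]mulr1 /h -[X in _ * X](mulr1 1).
  apply: cvgM; [exact: cvg_cst|by under eq_fun do rewrite expr2; apply: cvgM; exact: cutcvg].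
- apply: (cvg_approx _ (fun k => s * h' (e k) s)) => [k|]; first by have [_ _ /(_ _ s0S)] := qP k.
  case/andP: s0S; rewrite le_eqVlt => /predU1P[<- _|s0 sS].
    rewrite /quot2' invr0 mulr0; under eq_fun do rewrite mul0r; exact: cvg_cst.
  have -> : (fun k => s * h' (e k) s) = (fun k =>
     (quot2' M s * cut (e k) s + 2 * quot2 M s * cut (e k) s * (cut (e k) s * (s^-1 * e k))) * cut (e k) s).
    apply/funext => k; rewrite /h' (leNgt s) s0/= /cut; field.
    by rewrite !gt_eqF// addr_gt0.
  rewrite -[X in _ --> X]mulr1; apply: cvgM; last exact: cutcvg.
  rewrite -[X in _ --> X]addr0; apply: cvgD.
    by rewrite -[X in _ --> X]mulr1; apply: cvgM; [exact: cvg_cst|exact: cutcvg].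
  rewrite -[X in _ --> X](mulr0 (2 * quot2 M s * 1)); apply: cvgM.
    by apply: cvgM; [exact: cvg_cst|exact: cutcvg].
  rewrite -[X in _ --> X](mulr0 1); apply: cvgM; first exact: cutcvg.
  by rewrite -[X in _ --> X](mulr0 s^-1); apply: cvgM => //; exact: cvg_cst.
Unshelve. all: end_near. Qed.

End quot2_approx.

(** * Calculus of smooth functions and test functions *)

Section Ck_calculus.
Context {R : realType} {n : nat}.
Implicit Types (u v : 'rV[R]_n -> R) (x : 'rV[R]_n) (i : 'I_n) (k : nat).

Definition smooth u := forall k, Ck k u.

Lemma CkS k u : Ck k.+1 u -> Ck k u.
Proof.
elim: k u => [|k IH] u; first by case.
by move=> [cu Du]; split => // i; have [du /IH] := Du i.
Qed.

Lemma Ck_cst k (c : R) : Ck k (fun _ : 'rV[R]_n => c).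
Proof.
have Dc i : (fun x => 'D_(evec i) (fun=> c) x) = (fun=> 0 : R) :> ('rV[R]_n -> R).
  by apply/funext => x; exact: derive_cst.
elim: k c Dc => [|k IH] c Dc; first exact: cst_continuous.
split=> [|i]; first exact: cst_continuous.
split=> [x|]; first exact: derivable_cst.
rewrite Dc; apply: IH => j; apply/funext => x; exact: derive_cst.
Qed.

Lemma CkD k u v : Ck k u -> Ck k v -> Ck k (fun x => u x + v x).
Proof.
elim: k u v => [|k IH] u v; first by move=> /= cu cv x; exact: (cvgD (cu x) (cv x)).
move=> [cu Du] [cv Dv]; split => [x|i]; first by exact: (cvgD (cu x) (cv x)).
have [du Cu] := Du i; have [dv Cv] := Dv i.
split=> [x|]; first exact: (derivableD (du x) (dv x)).
rewrite (_ : (fun x => _) = fun x => 'D_(evec i) u x + 'D_(evec i) v x); first exact: IH.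
by apply/funext => x; exact: (deriveD (du x) (dv x)).
Qed.

Lemma derive_mul u v i x : derivable u x (evec i) -> derivable v x (evec i) ->
  'D_(evec i) (fun y => u y * v y) x =
  u x * 'D_(evec i) v x + v x * 'D_(evec i) u x.
Proof. by move=> du dv; rewrite (deriveM du dv). Qed.

Lemma CkM k u v : Ck k u -> Ck k v -> Ck k (fun x => u x * v x).
Proof.
elim: k u v => [|k IH] u v; first by move=> /= cu cv x; exact: (cvgM (cu x) (cv x)).
move=> Cu Cv; have Cu0 := CkS Cu; have Cv0 := CkS Cv.
case: Cu => cu Du; case: Cv => cv Dv.
split => [x|i]; first by exact: (cvgM (cu x) (cv x)).
have [du Cu] := Du i; have [dv Cv] := Dv i.
split=> [x|]; first exact: (derivableM (du x) (dv x)).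
rewrite (_ : (fun x => _) = fun x => u x * 'D_(evec i) v x + v x * 'D_(evec i) u x).
  by apply: CkD; exact: IH.
by apply/funext => x; exact: derive_mul.
Qed.

Lemma Ck_coord k i : Ck k (fun x : 'rV[R]_n => x ord0 i).
Proof.
have H x j : h^-1 *: ((h *: evec j + x) ord0 i - x ord0 i) @[h --> 0^'] --> ((i == j)%:R : R).
  apply: cvg_near_cst; near=> h.
  have h0 : h != 0 by near: h; exact: nbhs_dnbhs_neq.
  by rewrite !mxE/= addrK /GRing.scale/= mulrA mulVf ?mul1r.
elim: k => [|k IH]; first by move=> x; exact: coord_continuous.
split=> [x|j]; first exact: coord_continuous.
split=> [x|]; first by apply/cvg_ex; exists (i == j)%:R; exact: H.
rewrite (_ : (fun x => _) = fun=> (i == j)%:R); first exact: Ck_cst.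
by apply/funext => x; apply/cvg_lim => //; exact: H.
Unshelve. all: end_near. Qed.

Lemma smooth_derivable u i x : smooth u -> derivable u x (evec i).
Proof. by move=> /(_ 1%N)[_ /(_ i)[]]. Qed.

Lemma smooth_continuous u : smooth u -> continuous u.
Proof. by move=> /(_ 0%N). Qed.

Lemma smooth_D u i : smooth u -> smooth (fun x => 'D_(evec i) u x).
Proof. by move=> su k; have [_ /(_ i)[]] := su k.+1. Qed.

Lemma smooth_cst (c : R) : smooth (fun _ : 'rV[R]_n => c). Proof. by move=> k; exact: Ck_cst. Qed.

Lemma smooth_add u v : smooth u -> smooth v -> smooth (fun x => u x + v x).
Proof. by move=> su sv k; exact: CkD. Qed.

Lemma smooth_mul u v : smooth u -> smooth v -> smooth (fun x => u x * v x).
Proof. by move=> su sv k; exact: CkM. Qed.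

Lemma smooth_opp u : smooth u -> smooth (fun x => - u x).
Proof.
move=> su; rewrite (_ : (fun x => _) = fun x => -1 * u x); last first.
  by apply/funext => x; rewrite mulN1r.
by apply: smooth_mul => //; exact: smooth_cst.
Qed.

Lemma smooth_coord i : smooth (fun x : 'rV[R]_n => x ord0 i).
Proof. by move=> k; exact: Ck_coord. Qed.

Lemma smooth_sum (I : Type) (r : seq I) (f : I -> 'rV[R]_n -> R) :
  (forall j, smooth (f j)) -> smooth (fun x => \sum_(j <- r) f j x).
Proof.
move=> sf; elim: r => [|j r IH].
  by under eq_fun do rewrite big_nil; exact: smooth_cst.
by under eq_fun do rewrite big_cons; exact: smooth_add.
Qed.

Lemma smooth_poly u (p : {poly R}) : smooth u -> smooth (fun x => p.[u x]).
Proof.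
move=> su; elim/poly_ind: p => [|p c IH].
  by under eq_fun do rewrite horner0; exact: smooth_cst.
under eq_fun do rewrite hornerMXaddC.
by apply: smooth_add; [exact: smooth_mul|exact: smooth_cst].
Qed.

Lemma derive_poly u (p : {poly R}) i x : smooth u ->
  'D_(evec i) (fun y => p.[u y]) x = p^`().[u x] * 'D_(evec i) u x.
Proof.
move=> su; elim/poly_ind: p => [|p c IH].
  under eq_fun do rewrite horner0.
  by rewrite derive_cst deriv0 horner0 mul0r.
under eq_fun do rewrite hornerMXaddC.
have sp := smooth_poly p su.
have d1 : derivable (fun y => p.[u y] * u y) x (evec i).
  by apply: smooth_derivable; exact: smooth_mul.
have d2 := derivable_cst c x (evec i).
rewrite (deriveD d1 d2) derive_cst addr0 derive_mul; try exact: smooth_derivable.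
rewrite IH derivD derivC addr0 derivM derivX mulr1 hornerD hornerM hornerX.
by rewrite mulrDl addrC mulrA [u x * _]mulrC.
Qed.

Lemma derive_sumE m (f : 'I_m -> 'rV[R]_n -> R) i x :
  (forall j, derivable (f j) x (evec i)) ->
  'D_(evec i) (fun y => \sum_(j < m) f j y) x = \sum_(j < m) 'D_(evec i) (f j) x.
Proof.
move=> df; rewrite -derive_sum//; congr ('D_(_) _ x).
by apply/funext => y; rewrite fct_sumE.
Qed.

Lemma derive_translate u (v : 'rV[R]_n) i :
  (fun x => 'D_(evec i) (fun y => u (y + v)) x) = (fun x => 'D_(evec i) u (x + v)).
Proof.
apply/funext => x; rewrite /derive /=.
by under eq_fun do rewrite -addrA.
Qed.

Lemma smooth_translate u (v : 'rV[R]_n) : smooth u -> smooth (fun x => u (x + v)).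
Proof.
have cT (w : 'rV[R]_n -> R) : smooth w -> continuous (fun x => w (x + v)).
  move=> sw x.
  have h : (y + v) @[y --> x] --> x + v.
    have h : y @[y --> x] --> x by exact: cvg_id.
    exact: (cvgD h (cvg_cst v)).
  have h2 : w y @[y --> x + v] --> w (x + v) by exact: smooth_continuous.
  exact: (cvg_comp _ _ h h2).
move=> su k; elim: k u su => [|k IH] u su; first exact: cT.
split=> [|i]; first exact: cT.
split=> [x|].
  have := @smooth_derivable u i (x + v) su; rewrite /derivable/=.
  by under eq_fun do rewrite addrA.
by rewrite derive_translate; apply: (IH (fun y => 'D_(evec i) u y)); exact: smooth_D.
Qed.

Definition supp u : set 'rV[R]_n := closure [set x | u x != 0].

Lemma supp_out u x : ~ supp u x -> u x = 0.
Proof. by move=> Nx; apply/eqP/negPn/negP => ux; apply: Nx; exact: subset_closure. Qed.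

Lemma supp_sub u (K : set 'rV[R]_n) : closed K -> (forall x, ~ K x -> u x = 0) ->
  supp u `<=` K.
Proof.
move=> cK uK; rewrite /supp closureE; apply: smallest_sub => // x /= ux.
by apply: contrapT => /uK/eqP; rewrite (negbTE ux).
Qed.

Lemma supp_D u i : supp (fun x => 'D_(evec i) u x) `<=` supp u.
Proof.
apply: supp_sub => [|x ux]; first exact: closed_closure.
apply/cvg_lim => //; apply: cvg_near_cst.
have ox : nbhs x (~` supp u).
  by apply: open_nbhs_nbhs; split => //; apply/closed_openC/closed_closure.
have H : \forall h \near (0 : R), (~` supp u) (h *: evec i + x).
  have : h *: evec i + x @[h --> (0 : R)] --> x.
    rewrite -[X in _ --> X]add0r -(scale0r (evec i)).
    have h : h *: evec i @[h --> (0 : R)] --> 0 *: evec i.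
      by apply: cvgZr_tmp; exact: cvg_id.
    exact: (cvgD h (cvg_cst x)).
  by move=> /(_ _ ox).
apply: nbhs_dnbhs; near=> h.
have Nh : ~ supp u (h *: evec i + x) by near: h; exact: H.
by rewrite /= (supp_out ux) (supp_out Nh) subrr scaler0.
Unshelve. all: end_near. Qed.

Lemma test_function_sub (Omega : set 'rV[R]_n) u v : test_function Omega u ->
  smooth v -> supp v `<=` supp u -> test_function Omega v.
Proof.
move=> [_ cu uO] sv vu; split => //; last exact: subset_trans uO.
by apply: subclosed_compact cu vu; exact: closed_closure.
Qed.

Lemma test_function_D (Omega : set 'rV[R]_n) u i :
  test_function Omega u -> test_function Omega (fun x => 'D_(evec i) u x).
Proof.
move=> tu; apply: (test_function_sub tu); last exact: supp_D.
by apply: smooth_D; case: tu.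
Qed.

Lemma test_function_mul (Omega : set 'rV[R]_n) u v : test_function Omega u ->
  smooth v -> test_function Omega (fun x => u x * v x).
Proof.
move=> tu sv; apply: (test_function_sub tu).
  by apply: smooth_mul => //; case: tu.
by apply: supp_sub => [|x /supp_out->]; [exact: closed_closure|rewrite mul0r].
Qed.

End Ck_calculus.

(** * Lebesgue measure on row vectors *)

Section lebesgue_measure_shift.
Context {R : realType}.

Lemma measurable_shift (a : R) : measurable_fun [set: measurableTypeR R] (fun x : measurableTypeR R => (x + a : measurableTypeR R)).
Proof. by apply: measurable_funD. Qed.

Lemma lebesgue_measure_shift (a : R) (A : set (measurableTypeR R)) : measurable A ->
  lebesgue_measure [set x : measurableTypeR R | A (x + a)] = lebesgue_measure A.
Proof.
move=> mA.
pose m2 : {measure set (measurableTypeR R) -> \bar R} :=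
  pushforward lebesgue_measure (fun x : measurableTypeR R => (x + a : measurableTypeR R)).
rewrite [RHS](@lebesgue_measure_unique R (m2 (measurable_shift a)))// => _ [[b c] _ <-].
rewrite /m2/= /pushforward.
rewrite [X in _ = lebesgue_measure X](_ : _ = `]b - a, c - a]%classic); last first.
  by apply/seteqP; split => x/=; rewrite !in_itv/= ltrBlDr lerBrDr.
rewrite !lebesgue_measure_itv/= !lte_fin ltrD2r; case: ifP => // _.
by rewrite -!EFinB opprB addrA subrK.
Qed.

End lebesgue_measure_shift.

Section lebesgue_row_topology.
Context {R : realType} {n : nat}.

Let rbox (qr : 'rV[rat]_n * nat) : set 'rV[R]_n :=
  [set x | forall i, ball (ratr (qr.1 ord0 i) : R) (qr.2.+1%:R^-1) (x ord0 i)].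

(** An open set is the union of the rational boxes it contains. They are countably many, and
    measurable for the sigma-algebra of the coordinates. *)
Lemma open_measurable_row (O : set 'rV[R]_n) : open O -> measurable O.
Proof.
move=> oO.
have -> : O = \bigcup_(qr : 'rV[rat]_n * nat)
    (if pselect (rbox qr `<=` O) then rbox qr else set0).
  apply/seteqP; split => [x Ox|x [qr _]]; last first.
    by case: pselect => // h; exact: h.
  have /nbhs_ballP[e /= e0 xe] := open_nbhs_nbhs (conj oO Ox).
  pose r := Num.truncn (2 / e).
  have re : r.+1%:R^-1 < e / 2.
    rewrite -[e / 2]invrK invf_div ltf_pV2 ?posrE ?ltr0n ?divr_gt0//.
    exact: truncnS_gt.
  have r0 : 0 < r.+1%:R^-1 :> R by rewrite invr_gt0.
  have /choice[q qP] : forall i : 'I_n, exists q : rat, ball (x ord0 i) r.+1%:R^-1 (ratr q : R).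
    move=> i.
    have xx : ball (x ord0 i : R) r.+1%:R^-1 !=set0 by exists (x ord0 i); exact: ballxx.
    have [y [xy [q _ qy]]] := dense_rat xx (ball_open _ _).
    by exists q; rewrite qy.
  exists (\row_i q i, r) => //.
  case: pselect => [_ i|]; first by rewrite mxE; exact: ball_sym.
  case=> y /= yq; apply: xe; split => // i j; rewrite (ord1 i).
  apply: (@le_ball _ _ _ (r.+1%:R^-1 + r.+1%:R^-1)).
    by rewrite [leRHS]splitr lerD// ltW.
  apply: ball_triangle (qP j) _.
  by have := yq j; rewrite mxE.
apply: countable_bigcupT_measurable; first exact: countableP.
move=> qr; case: pselect => [h|h] //=.
apply: (@measurable_box R n (fun i => ball (ratr (qr.1 ord0 i) : R) (qr.2.+1%:R^-1))) => i.
exact: measurable_ball.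
Qed.

Lemma closed_measurable_row (K : set 'rV[R]_n) : closed K -> measurable K.
Proof.
move=> cK; rewrite -(setCK K); apply: measurableC.
by apply: open_measurable_row; exact: closed_openC.
Qed.

Lemma compact_measurable_row (K : set 'rV[R]_n) : compact K -> measurable K.
Proof.
by move=> cK; apply: closed_measurable_row; apply: compact_closed cK; exact: norm_hausdorff.
Qed.

Lemma continuous_measurable_row (f : 'rV[R]_n -> R) :
  continuous f -> measurable_fun setT f.
Proof.
move=> /continuousP cf; apply: (measurability _ (RGenOpens.measurableE R)).
move=> _ [_ [a [b ->] <-]]; rewrite setTI.
by apply: open_measurable_row; exact/cf/interval_open.
Qed.

Lemma lebesgue_row_bounded (r : R) :
  (lebesgue_row n [set x : 'rV[R]_n | forall i, (`|x ord0 i| <= r)%R] < +oo)%E.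
Proof.
have -> : [set x : 'rV[R]_n | forall i, `|x ord0 i| <= r] =
    [set x : 'rV[R]_n | forall i, (`[- r, r]%classic : set R) (x ord0 i)].
  by apply/seteqP; split=> x /= h i; have := h i; rewrite in_itv/= ler_norml.
rewrite (@lebesgue_row_box R n (fun=> `[- r, r]%classic))//.
rewrite ltey_eq prode_fin_num// => i _.
by rewrite lebesgue_measure_itv; case: ifP.
Qed.

Lemma lebesgue_row_compact (K : set 'rV[R]_n) : compact K ->
  (lebesgue_row n K < +oo)%E.
Proof.
move=> cK; have mK := compact_measurable_row cK.
have [C [Cr HC]] := compact_bounded cK.
apply: le_lt_trans (lebesgue_row_bounded (`|C| + 1)).
apply: le_measure; rewrite ?inE//.
  rewrite [X in measurable X](_ : _ = \bigcap_(i in [set: 'I_n])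
    [set x : 'rV[R]_n | `|x ord0 i| <= `|C| + 1]); last first.
    by apply/seteqP; split => [x h i _|x h i]; exact: h.
  apply: fin_bigcap_measurable => // i _.
  have mN := measurableT_comp (@normr_measurable R setT) (@measurable_coord _ R n i).
  have := mN measurableT `]-oo, `|C| + 1]%classic (measurable_itv _).
  by rewrite setTI.
move=> x Kx i; apply: le_trans (HC (`|C| + 1) _ x Kx).
  rewrite /Num.norm/= mx_normrE; exact: (le_bigmax _ (fun ij => `|x ij.1 ij.2|) (ord0, i)).
by rewrite (le_lt_trans (ler_norm _))// ltrDl.
Qed.

Definition translate (v x : 'rV[R]_n) : 'rV[R]_n := x + v.

Lemma measurable_translate (v : 'rV[R]_n) : measurable_fun setT (translate v).
Proof.
apply: measurable_fun_rowP => i.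
rewrite (_ : (fun x => _) = (fun x : 'rV[R]_n => x ord0 i + v ord0 i)); last first.
  by apply/funext => x; rewrite mxE.
by apply: measurable_funD => //; exact: measurable_coord.
Qed.

(** The generators in the definition constrain one coordinate each and are not stable under
    intersection; boxes are, as the uniqueness theorem for measures requires. *)
Lemma measurable_rowE : (measurable : set (set 'rV[R]_n)) =
  <<s [set B : set 'rV[R]_n | exists2 A : 'I_n -> set R, (forall i, measurable (A i)) &
         B = [set x : 'rV[R]_n | forall i, A i (x ord0 i)]] >>.
Proof.
apply/seteqP; split.
  apply: sub_sigma_algebra2 => /= B; rewrite -bigcup_seq/= => -[i _ [A mA <-]].
  exists (fun j => if j == i then A else setT) => [j|].
    by case: ifP.
  rewrite setTI; apply/seteqP; split => x /=; last by move=> /(_ i); rewrite eqxx.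
  by move=> Ax j; case: eqP => [->|].
apply: smallest_sub; first exact: sigma_algebra_measurable.
by move=> _ [A mA ->]; exact: measurable_box.
Qed.

(** By uniqueness it is enough to compare the two measures on boxes, where the claim is the
    one-dimensional invariance in each factor. *)
Lemma lebesgue_row_translate (v : 'rV[R]_n) (E : set 'rV[R]_n) : measurable E ->
  lebesgue_row n (translate v @^-1` E) = lebesgue_row n E.
Proof.
move=> mE.
pose m2 : {measure set 'rV[R]_n -> \bar R} := pushforward (lebesgue_row n) (translate v).
apply/esym.
pose box (k : nat) := [set x : 'rV[R]_n | forall i, (`[- k%:R, k%:R]%classic : set R) (x ord0 i)].
apply: (measure_unique _ box measurable_rowE _ _ _ (lebesgue_row n) (m2 (measurable_translate v))) => //.
- move=> _ _ [A mA ->] [B mB ->]; exists (fun i => A i `&` B i).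
    by move=> i; exact: measurableI.
  apply/seteqP; split=> x /=; first by move=> [hA hB] i; split.
  by move=> h; split=> i; have [] := h i.
- by move=> k; exists (fun=> `[- k%:R, k%:R]%classic).
- apply/seteqP; split=> // x _; exists (Num.truncn `|x|).+1 => // i /=.
  rewrite in_itv/= -ler_norml (@le_trans _ _ `|x|)//; last exact/ltW/truncnS_gt.
  by rewrite [leRHS]/Num.norm/= mx_normrE; exact: (le_bigmax _ (fun ij => `|x ij.1 ij.2|) (ord0, i)).
- move=> _ [A mA ->]; rewrite /m2/= /pushforward lebesgue_row_box//.
  rewrite [X in _ = lebesgue_row n X](_ : _ = [set x : 'rV[R]_n | forall i, [set y | A i (y + v ord0 i)] (x ord0 i)]); last first.
    by apply/seteqP; split=> x /= h i; have := h i; rewrite mxE.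
  rewrite (@lebesgue_row_box R n (fun i => [set y | A i (y + v ord0 i)])); last first.
    move=> i; have := @measurable_shift R (v ord0 i) measurableT _ (mA i).
    by rewrite setTI.
  by apply: eq_bigr => i _; rewrite lebesgue_measure_shift//; exact: mA.
- move=> k; apply: le_lt_trans (lebesgue_row_bounded k%:R).
  rewrite (_ : box k = [set x : 'rV[R]_n | forall i, (`|x ord0 i| <= k%:R)%R])//.
  by rewrite /box; apply/seteqP; split=> x /= h i; have := h i; rewrite in_itv/= ler_norml.
Qed.

End lebesgue_row_topology.

(** * Bounded measurable functions with bounded support *)

Section bounded_compactly_supported.
Context {R : realType} {n : nat}.
Implicit Types (f g h : 'rV[R]_n -> R) (x v : 'rV[R]_n).

(** The bounds hold everywhere, not just almost everywhere. Every [bms] function is integrable, so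
    the chain rule can be carried out with real-valued integrals that are linear without side
    conditions. *)
Definition bmf f := measurable_fun setT f /\ exists C : R, forall x, `|f x| <= C.

Definition bms f := bmf f /\ exists r : R, forall x, r < `|x| -> f x = 0.

Local Notation mu := (lebesgue_row n).

Lemma bmfD f g : bmf f -> bmf g -> bmf (fun x => f x + g x).
Proof.
move=> [mf [C fC]] [mg [D gD]]; split; first exact: measurable_funD.
by exists (C + D) => x; rewrite (le_trans (ler_normD _ _))// lerD.
Qed.

Lemma bmfM f g : bmf f -> bmf g -> bmf (fun x => f x * g x).
Proof.
move=> [mf [C fC]] [mg [D gD]]; split; first exact: measurable_funM.
by exists (C * D) => x; rewrite normrM ler_pM.
Qed.

Lemma bmf_cst (c : R) : bmf (fun=> c).
Proof. by split; [exact: measurable_cst|exists `|c|]. Qed.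

Lemma bmfN f : bmf f -> bmf (fun x => - f x).
Proof.
move=> [mf [C fC]]; split; first exact: measurable_funN.
by exists C => x; rewrite normrN.
Qed.

Lemma bmf_norm f : bmf f -> bmf (fun x => `|f x|).
Proof.
move=> [mf [C fC]]; split; last by exists C => x; rewrite normr_id.
exact: (measurableT_comp (@normr_measurable R setT) mf).
Qed.

Lemma bmf_translate f v : bmf f -> bmf (fun x => f (x + v)).
Proof.
move=> [mf [C fC]]; split; last by exists C => x.
exact: (measurableT_comp mf (@measurable_translate R n v)).
Qed.

Lemma bmf_expRN (Phi : 'rV[R]_n -> R) : bmf Phi -> bmf (fun x => expR (- Phi x)).
Proof.
move=> [mPhi [C PhiC]]; split.
  by apply: (measurableT_comp (@measurable_expR R)); exact: measurable_funN.
exists (expR C) => x; rewrite ger0_norm ?expR_ge0// ler_expR lerNl.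
by have := PhiC x; rewrite ler_norml => /andP[].
Qed.

Lemma bms_bmf f : bms f -> bmf f. Proof. by case. Qed.

Lemma bmsD f g : bms f -> bms g -> bms (fun x => f x + g x).
Proof.
move=> [bf [r fr]] [bg [s gs]]; split; first exact: bmfD.
by exists (Num.max r s) => x; rewrite gt_max => /andP[/fr-> /gs->]; rewrite addr0.
Qed.

Lemma bmsN f : bms f -> bms (fun x => - f x).
Proof.
move=> [bf [r fr]]; split; first exact: bmfN.
by exists r => x /fr->; rewrite oppr0.
Qed.

Lemma bmsB f g : bms f -> bms g -> bms (fun x => f x - g x).
Proof. by move=> bf bg; apply: bmsD => //; exact: bmsN. Qed.

Lemma bmsMl f g : bmf f -> bms g -> bms (fun x => f x * g x).
Proof.
move=> bf [bg [r gr]]; split; first exact: bmfM.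
by exists r => x /gr->; rewrite mulr0.
Qed.

Lemma bmsMr f g : bms f -> bmf g -> bms (fun x => f x * g x).
Proof. by move=> bf bg; under eq_fun do rewrite mulrC; exact: bmsMl. Qed.

Lemma bms_norm f : bms f -> bms (fun x => `|f x|).
Proof.
move=> [bf [r fr]]; split; first exact: bmf_norm.
by exists r => x /fr->; rewrite normr0.
Qed.

Lemma bms_sum (I : Type) (s : seq I) (F : I -> 'rV[R]_n -> R) :
  (forall i, bms (F i)) -> bms (fun x => \sum_(i <- s) F i x).
Proof.
move=> bF; elim: s => [|i s IH].
  under eq_fun do rewrite big_nil.
  by split; [exact: bmf_cst|exists 0].
by under eq_fun do rewrite big_cons; exact: bmsD.
Qed.

Lemma bms_translate f v : bms f -> bms (fun x => f (x + v)).
Proof.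
move=> [bf [r fr]]; split; first exact: bmf_translate.
exists (r + `|v|) => x rx; apply: fr.
rewrite -(ltrD2r `|v|) (lt_le_trans rx)// -[leLHS](_ : `|x + v - v| = _); last by rewrite addrK.
by rewrite (le_trans (ler_normB _ _)).
Qed.

Let mbox (r : R) : measurable [set x : 'rV[R]_n | `|x| <= r].
Proof.
apply: closed_measurable_row.
have -> : [set x : 'rV[R]_n | `|x| <= r] = (fun x : 'rV[R]_n => `|x|) @^-1` [set t | t <= r] by [].
by apply: closed_comp; [move=> *; exact: norm_continuous|exact: closed_le].
Qed.

Let mu_box (r : R) : (mu [set x : 'rV[R]_n | (`|x| <= r)%R] < +oo)%E.
Proof.
apply: lebesgue_row_compact; apply: bounded_closed_compact.
  exists r; split; first exact: num_real.
  by move=> y ry x /= xr; rewrite (le_trans xr)// ltW.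
have -> : [set x : 'rV[R]_n | `|x| <= r] = (fun x : 'rV[R]_n => `|x|) @^-1` [set t | t <= r] by [].
by apply: closed_comp; [move=> *; exact: norm_continuous|exact: closed_le].
Qed.

Lemma bms_integrable f : bms f -> mu.-integrable setT (EFin \o f).
Proof.
move=> [[mf [C fC]] [r fr]].
have : mu.-integrable setT ((EFin \o f) \_ [set x : 'rV[R]_n | `|x| <= r]).
  apply/(integrable_mkcond _ (mbox r)).
  apply: measurable_bounded_integrable (mbox r) (mu_box r) _ _; first exact: measurable_funTS.
  exists C; split; first exact: num_real.
  by move=> y Cy x _ /=; rewrite (le_trans (fC x))// ltW.
congr (mu.-integrable _ _); apply/funext => x; rewrite patchE; case: ifPn => //.
by rewrite notin_setE/= => /negP; rewrite -ltNge => /fr /= ->.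
Qed.

Local Notation I f := (\int[mu]_x f x).

Lemma intD f g : bms f -> bms g -> I (fun x => f x + g x) = I f + I g.
Proof. by move=> bf bg; apply: RintegralD => //; exact: bms_integrable. Qed.

Lemma intB f g : bms f -> bms g -> I (fun x => f x - g x) = I f - I g.
Proof. by move=> bf bg; apply: RintegralB => //; exact: bms_integrable. Qed.

Lemma intZ (c : R) f : bms f -> I (fun x => c * f x) = c * I f.
Proof. by move=> bf; apply: RintegralZl => //; exact: bms_integrable. Qed.

Lemma intN f : bms f -> I (fun x => - f x) = - I f.
Proof.
move=> bf; rewrite -mulN1r -intZ//; apply: eq_Rintegral => x _.
by rewrite mulN1r.
Qed.

Lemma int_sum (J : Type) (s : seq J) (F : J -> 'rV[R]_n -> R) :
  (forall i, bms (F i)) -> I (fun x => \sum_(i <- s) F i x) = \sum_(i <- s) I (F i).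
Proof.
move=> bF; elim: s => [|i s IH].
  rewrite big_nil; under eq_Rintegral do rewrite big_nil.
  by rewrite Rintegral_cst// mul0r.
rewrite big_cons -IH -intD//; last exact: bms_sum.
by apply: eq_Rintegral => x _; rewrite big_cons.
Qed.

Lemma le_int f g : bms f -> bms g -> (forall x, f x <= g x) -> I f <= I g.
Proof. by move=> bf bg fg; apply: le_Rintegral => //; exact: bms_integrable. Qed.

Lemma le_normr_int f : bms f -> `|I f| <= I (fun x => `|f x|).
Proof. by move=> bf; apply: le_normr_Rintegral => //; exact: bms_integrable. Qed.

Lemma int_norm_ge0 f : 0 <= I (fun x => `|f x|).
Proof. exact: Rintegral_ge0. Qed.

Lemma int_translate f v : bms f -> I (fun x => f (x + v)) = I f.
Proof.
move=> bf; congr fine.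
have mf : measurable_fun setT (EFin \o f) by apply/measurable_EFinP; case: bf => [[]].
have := @integral_pushforward _ _ _ _ R _ (@measurable_translate R n v) mu setT (EFin \o f) mf.
rewrite preimage_setT => /(_ _ measurableT) <-.
  pose m2 : {measure set 'rV[R]_n -> \bar R} := pushforward mu (translate v).
  apply: (@eq_measure_integral _ _ _ _ mu (m2 (measurable_translate v))) => A mA _.
  exact: lebesgue_row_translate.
by have := bms_integrable (bms_translate v bf).
Qed.

Lemma int_dominated (F : nat -> 'rV[R]_n -> R) f (C r : R) :
  (forall k, measurable_fun setT (F k)) -> (forall k x, `|F k x| <= C) ->
  (forall k x, r < `|x| -> F k x = 0) -> (forall x, F k x @[k --> \oo] --> f x) ->
  bms f /\ I (F k) @[k --> \oo] --> I f.
Proof.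
move=> mF FC Fr Ff.
have bF k : bms (F k) by split; [split; [exact: mF|exists C; exact: FC]|exists r; exact: Fr].
have mf : measurable_fun setT f.
  by apply: (measurable_fun_cvg mF) => x _; exact: Ff.
have bf : bms f.
  split; first split => //.
    exists C => x; apply: (cvgr_to_le (cvg_norm (Ff x))).
    by near=> k; exact: FC.
  exists r => x rx; apply: (cvg_unique _ (Ff x)); first exact: norm_hausdorff.
  by rewrite /= (_ : (fun k => F k x) = cst 0); [exact: cvg_cst|apply/funext => k; rewrite Fr].
split => //.
have C0 : 0 <= C by exact: le_trans (FC 0%N 0).
pose g x : R := if `|x| <= r then C else 0.
have bg : bms g.
  split; last by exists r => x rx; rewrite /g leNgt rx.
  split; last by exists C => x; rewrite /g; case: ifP => _; rewrite ?normr0// ger0_norm.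
  apply: measurable_fun_ifT => //.
  apply: (measurable_fun_bool true).
  by rewrite setTI; exact: mbox.
have mF' k : measurable_fun setT (EFin \o F k) by exact/measurable_EFinP.
have mf' : measurable_fun setT (EFin \o f) by exact/measurable_EFinP.
have Ff' : {ae mu, forall x, setT x -> (EFin \o F k) x @[k --> \oo] --> (EFin \o f) x}.
  by apply: aeW => x _ /=; apply/fine_cvgP; split; [exact: nearW|exact: Ff].
have Fg : {ae mu, forall x, forall k, setT x -> (`|(EFin \o F k) x| <= (EFin \o g) x)%E}.
  apply: aeW => x k _; rewrite /g/= lee_fin; case: ifPn => // xr.
  by rewrite Fr ?normr0// ltNge.
have [_ _ H] := dominated_convergence measurableT mF' mf' Ff' (bms_integrable bg) Fg.
have fin h : bms h -> (\int[mu]_x (h x)%:E)%E \is a fin_num.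
  by move=> bh; apply: integrable_fin_num => //; exact: bms_integrable.
by apply: fine_cvg; rewrite fineK// fin.
Unshelve. all: end_near. Qed.

End bounded_compactly_supported.

(** * Density of smooth functions in a weighted L^1 space *)

Section polynomial_density.
Context {R : realType} {n : nat}.
Local Notation mu := (lebesgue_row n).
Local Notation I f := (\int[mu]_x f x).

Lemma continuous_bounded_ball (u : 'rV[R]_n -> R) (r : R) : continuous u ->
  exists2 C : R, 0 <= C & forall x, `|x| <= r -> `|u x| <= C.
Proof.
move=> cu.
have cK : compact [set x : 'rV[R]_n | `|x| <= r].
  apply: bounded_closed_compact.
    exists r; split; first exact: num_real.
    by move=> y ry x /= xr; rewrite (le_trans xr)// ltW.
  have -> : [set x : 'rV[R]_n | `|x| <= r] = (fun x : 'rV[R]_n => `|x|) @^-1` [set t | t <= r] by [].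
  by apply: closed_comp; [move=> *; exact: norm_continuous|exact: closed_le].
have := continuous_compact (continuous_subspaceT cu) cK => /compact_bounded[C [Cr HC]].
exists (`|C| + 1) => [|x xr]; first by rewrite addr_ge0.
apply: (HC (`|C| + 1)); first by rewrite (le_lt_trans (ler_norm _))// ltrDl.
by exists x.
Qed.

Lemma bms_continuous (u : 'rV[R]_n -> R) (r : R) : continuous u ->
  (forall x, r < `|x| -> u x = 0) -> bms u.
Proof.
move=> cu ur; split; last by exists r.
split; first exact: continuous_measurable_row.
have [C C0 uC] := continuous_bounded_ball r cu.
exists C => x; have [/uC//|/ur->] := leP `|x| r; by rewrite normr0.
Qed.

Variables (eta : 'rV[R]_n -> R) (r : R).
Hypotheses (ceta : continuous eta) (etar : forall x, r < `|x| -> eta x = 0).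

Let beta : bms eta. Proof. exact: bms_continuous etar. Qed.

Let bmul (p : 'rV[R]_n -> R) : continuous p -> bms (fun x => eta x * p x).
Proof.
move=> cp; apply: (@bms_continuous _ r) => [|x /etar->]; last by rewrite mul0r.
exact: (@CkM R n 0 eta p).
Qed.

(** Bounded functions that smooth ones approximate in L^1(|eta| dx). A monotone class argument shows
    that all bounded measurable functions belong to it: [V] is an algebra, closed under bounded
    pointwise limits, and contains the indicators of coordinate half-spaces. *)
Let V (g : 'rV[R]_n -> R) := bmf g /\ forall e : R, 0 < e ->
  exists2 p, smooth p & I (fun x => `|eta x * (g x - p x)|) <= e.

Let bdiff (g p : 'rV[R]_n -> R) : bmf g -> continuous p ->
  bms (fun x => `|eta x * (g x - p x)|).
Proof.
move=> bg cp; apply: bms_norm; under eq_fun do rewrite mulrBr.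
by apply: bmsB; [exact: bmsMr|exact: bmul].
Qed.

Let V_smooth (p : 'rV[R]_n -> R) : bmf p -> smooth p -> V p.
Proof.
move=> bp sp; split => // e e0; exists p => //.
under eq_Rintegral do rewrite subrr mulr0 normr0.
by rewrite Rintegral_cst// mul0r ltW.
Qed.

Let V_cst (c : R) : V (fun=> c).
Proof. by apply: V_smooth; [exact: bmf_cst|exact: smooth_cst]. Qed.

Let V_add f g : V f -> V g -> V (fun x => f x + g x).
Proof.
move=> [bf Vf] [bg Vg]; split; first exact: bmfD.
move=> e e0; have e20 : 0 < e / 2 by rewrite divr_gt0.
have [p sp pe] := Vf _ e20; have [q sq qe] := Vg _ e20.
exists (fun x => p x + q x); first exact: smooth_add.
rewrite (splitr e) (le_trans _ (lerD pe qe))//.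
have cp := smooth_continuous sp; have cq := smooth_continuous sq.
rewrite -intD; try exact: bdiff.
apply: le_int.
- by apply: bdiff; [exact: bmfD|exact: (smooth_continuous (smooth_add sp sq))].
- by apply: bmsD; exact: bdiff.
- move=> x; rewrite (le_trans _ (ler_normD _ _))// -mulrDr.
  by rewrite le_eqVlt; apply/orP; left; apply/eqP; congr (`|_ * _|); ring.
Qed.

Let V_mul f g : V f -> V g -> V (fun x => f x * g x).
Proof.
move=> [bf Vf] [bg Vg]; split; first exact: bmfM.
move=> e e0; have [_ [B gB]] := bg.
have B0 : 0 <= B by exact: le_trans (gB 0).
have eB0 : 0 < e / 2 / (B + 1) by rewrite !divr_gt0// ltr_wpDl.
have [p sp pe] := Vf _ eB0.
have cp := smooth_continuous sp.
(* [q] is chosen after [p], because its accuracy depends on the bound of [p] on the ball carrying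
   [eta]. *)
have [D D0 pD] := continuous_bounded_ball r cp.
have eD0 : 0 < e / 2 / (D + 1) by rewrite !divr_gt0// ltr_wpDl.
have [q sq qe] := Vg _ eD0.
have cq := smooth_continuous sq.
exists (fun x => p x * q x); first exact: smooth_mul.
have h1 := bdiff bf cp; have h2 := bdiff bg cq.
apply: (@le_trans _ _ (I (fun x => (B + 1) * `|eta x * (f x - p x)| + (D + 1) * `|eta x * (g x - q x)|))).
  apply: le_int.
  - by apply: bdiff; [exact: bmfM|exact: (smooth_continuous (smooth_mul sp sq))].
  - by apply: bmsD; apply: bmsMl => //; exact: bmf_cst.
  move=> x; have [xr|/etar->] := leP `|x| r; last by rewrite !mul0r normr0 !mulr0 addr0.
  have -> : eta x * (f x * g x - p x * q x) =
     g x * (eta x * (f x - p x)) + p x * (eta x * (g x - q x)) by ring.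
  rewrite (le_trans (ler_normD _ _))// !(normrM (_ x) (_ * _)).
  by rewrite lerD// ler_wpM2r// ler_wpDr// pD.
rewrite intD; try by apply: bmsMl => //; exact: bmf_cst.
rewrite !intZ// (splitr e) lerD//.
  by rewrite mulrC -ler_pdivlMr// ltr_wpDl.
by rewrite mulrC -ler_pdivlMr// ltr_wpDl.
Qed.

Let V_lim (w : nat -> 'rV[R]_n -> R) (f : 'rV[R]_n -> R) (C : R) : (forall k, V (w k)) ->
  (forall k x, `|w k x| <= C) -> (forall x, w k x @[k --> \oo] --> f x) -> V f.
Proof.
move=> Vw wC wf.
have mw k : measurable_fun setT (w k) by have [[]] := Vw k.
have mf : measurable_fun setT f.
  by apply: (measurable_fun_cvg mw) => x _; exact: wf.
have fC x : `|f x| <= C.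
  by apply: (cvgr_to_le (cvg_norm (wf x))); near=> k; exact: wC.
have bf : bmf f by split => //; exists C.
split => // e e0; have e20 : 0 < e / 2 by rewrite divr_gt0.
have [_ [A etaA]] := bms_bmf beta.
have A0 : 0 <= A by exact: le_trans (etaA 0).
have bdw k : bms (fun x => `|eta x * (f x - w k x)|).
  have [bw _] := Vw k; apply/bms_norm/bmsMr => //.
  by apply: bmfD => //; exact: bmfN.
have [] := @int_dominated R n (fun k x => `|eta x * (f x - w k x)|) (fun=> 0) (A * (C + C)) r.
- by move=> k; have [[]] := bdw k.
- move=> k x; rewrite normr_id normrM ler_pM// (le_trans (ler_normB _ _))// lerD//.
- by move=> k x /etar->; rewrite mul0r normr0.
- move=> x; rewrite -[X in _ --> X](@normr0 _ R); apply: cvg_norm.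
  rewrite -[X in _ --> X](mulr0 (eta x)); apply: cvgM; first exact: cvg_cst.
  rewrite -[X in _ --> X](subrr (f x)); apply: cvgB; [exact: cvg_cst|exact: wf].
move=> _; rewrite Rintegral_cst// mul0r => /cvgr0Pnorm_le/(_ _ e20)[k _ /(_ k (leqnn k))] wk.
have [bw /(_ _ e20)[p sp pe]] := Vw k.
exists p => //; have cp := smooth_continuous sp.
apply: (@le_trans _ _ (I (fun x => `|eta x * (f x - w k x)| + `|eta x * (w k x - p x)|))).
  apply: le_int; [exact: bdiff|apply: bmsD => //; exact: bdiff|].
  move=> x; rewrite (le_trans _ (ler_normD _ _))// -mulrDr.
  by rewrite addrA subrK.
rewrite intD//; last exact: bdiff.
by rewrite (splitr e) lerD// (le_trans (ler_norm _)).
Unshelve. all: end_near. Qed.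

(** The indicator is a limit of continuous ramps in the i-th coordinate. On the bounded range of
    that coordinate over the ball carrying [eta], Weierstrass replaces each ramp by a polynomial,
    which is smooth in x. *)
Let V_coord i (a : R) : V (fun x => ((a < x ord0 i)%R : nat)%:R).
Proof.
(* The ramp equal to y = j (t - a) for y in [0, 1], to 0 below and to 1 above. *)
pose c (j : nat) (t : R) : R := (`|j%:R * (t - a)| - `|j%:R * (t - a) - 1| + 1) / 2.
have c1 j t : `|c j t| <= 1.
  rewrite /c; move: (j%:R * (t - a)) => y; rewrite ler_norml.
  case: (leP 0 y) => y0; case: (leP 0 (y - 1)) => y1; do ?[rewrite (ger0_norm y0)|rewrite (ltr0_norm y0)];
    do ?[rewrite (ger0_norm y1)|rewrite (ltr0_norm y1)]; lra.
have cc j : continuous (c j).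
  move=> t; have h : j%:R * (s - a) @[s --> t] --> j%:R * (t - a).
    by apply: cvgM; [exact: cvg_cst|apply: cvgB; [exact: cvg_id|exact: cvg_cst]].
  apply: cvgM; last exact: cvg_cst.
  apply: cvgD; last exact: cvg_cst.
  by apply: cvgB; apply: cvg_norm => //; apply: cvgB => //; exact: cvg_cst.
have ci j : continuous (fun x : 'rV[R]_n => c j (x ord0 i)).
  move=> x; have h : c j t @[t --> x ord0 i] --> c j (x ord0 i) by exact: cc.
  exact: (cvg_comp _ _ (@coord_continuous R 1 n ord0 i x) h).
apply: (@V_lim (fun j x => c j (x ord0 i)) _ 1) => [j|j x|x]; last 2 first.
- exact: c1.
- have [ax|xa] := ltP a (x ord0 i).
  + have xa0 : 0 < x ord0 i - a by rewrite subr_gt0.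
    apply: cvg_near_cst; near=> j.
    rewrite /c; have : 1 <= j%:R * (x ord0 i - a).
      rewrite -ler_pdivrMr//; near: j; exact: nbhs_infty_ger.
    move: (j%:R * (x ord0 i - a)) => y y1.
    have y0 : 0 <= y by lra.
    have y2 : 0 <= y - 1 by lra.
    by rewrite (ger0_norm y0) (ger0_norm y2) /=; lra.
  + apply: cvg_near_cst; near=> j.
    rewrite /c; have : j%:R * (x ord0 i - a) <= 0.
      by rewrite mulr_ge0_le0// subr_le0.
    move: (j%:R * (x ord0 i - a)) => y y1.
    have y2 : y - 1 <= 0 by lra.
    by rewrite (ler0_norm y1) (ler0_norm y2) /=; lra.
split.
  by split; [exact: continuous_measurable_row|exists 1 => x; exact: c1].
move=> e e0.
pose J := I (fun x => `|eta x|) + 1.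
have J0 : 0 < J by rewrite ltr_wpDl// int_norm_ge0.
have S0 : - (`|r| + 1) < `|r| + 1 :> R by rewrite gtrN// ltr_wpDl.
have [p pe] := weierstrass S0 (cc j) (divr_gt0 e0 J0).
exists (fun x => p.[x ord0 i]); first by apply: smooth_poly; exact: smooth_coord.
have cp : continuous (fun x : 'rV[R]_n => p.[x ord0 i]).
  by apply: smooth_continuous; apply: smooth_poly; exact: smooth_coord.
apply: (@le_trans _ _ (I (fun x => e / J * `|eta x|))).
  apply: le_int.
  - by apply: bdiff => //; split; [exact: continuous_measurable_row|exists 1 => x; exact: c1].
  - by apply: bmsMl; [exact: bmf_cst|exact: bms_norm].
  move=> x; have [xr|/etar->] := leP `|x| r; last by rewrite !mul0r normr0 !mulr0.
  rewrite normrM mulrC ler_wpM2r// pe// -ler_norml.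
  apply: (@le_trans _ _ `|x|).
    by rewrite [leRHS]/Num.norm/= mx_normrE; exact: (le_bigmax _ (fun ij => `|x ij.1 ij.2|) (ord0, i)).
  by rewrite (le_trans xr)// (le_trans (ler_norm _))// lerDl.
rewrite intZ; last exact: bms_norm.
by rewrite mulrAC ler_pdivrMr// ler_wpM2l ?(ltW e0)// /J lerDl.
Unshelve. all: end_near. Qed.

Let S : set (set 'rV[R]_n) := [set E | V (\1_E : 'rV[R]_n -> R)].

Let SU A B : S A -> S B -> S (A `|` B).
Proof.
move=> SA SB; rewrite /S/=.
have -> : (\1_(A `|` B) : 'rV[R]_n -> R) =
    (fun x => \1_A x + (\1_B x + -1 * (\1_A x * \1_B x))).
  apply/funext => x; rewrite !indicE in_setU.
  by case: (x \in A); case: (x \in B) => /=; ring.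
by apply: V_add => //; apply: V_add => //; apply: V_mul => //; exact: V_mul.
Qed.

(** Complements and finite unions come from the algebra operations of [V]; a countable union is the
    bounded limit of its finite partial unions. *)
Let S_sigma : sigma_algebra setT S.
Proof.
split.
- rewrite /S/= (_ : \1_set0 = (fun=> 0))//.
  by apply/funext => x; rewrite indicE in_set0.
- move=> A SA; rewrite /S/= (_ : \1_(setT `\` A) = (fun x => 1 + -1 * \1_A x)); last first.
    by apply/funext => x; rewrite setTD !indicE in_setC; case: (x \in A) => /=; ring.
  by apply: V_add => //; exact: V_mul.
- move=> F SF.
  have SUF k : S (\big[setU/set0]_(i < k) F i).
    elim: k => [|k IH]; last by rewrite big_ord_recr; exact: SU.
    rewrite big_ord0 /S/= (_ : \1_set0 = (fun=> 0))//.
    by apply/funext => x; rewrite indicE in_set0.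
  apply: (@V_lim (fun k => \1_(\big[setU/set0]_(i < k) F i)) _ 1 SUF) => [k x|x].
    by rewrite indicE; case: (_ \in _); rewrite ?normr0 ?normr1.
  have [[j _ Fjx]|Nx] := pselect ((\bigcup_k F k) x).
    apply: cvg_near_cst; exists j.+1 => // k /= jk.
    rewrite !indicE !mem_set//; first by exists j.
    by rewrite -bigcup_mkord; exists j.
  apply: cvg_near_cst; near=> k.
  rewrite !indicE !memNset//.
  by rewrite -bigcup_mkord => -[j _ Fjx]; apply: Nx; exists j.
Unshelve. all: end_near. Qed.

Let S_measurable : measurable `<=` S.
Proof.
apply: smallest_sub => //= A; rewrite -bigcup_seq/= => -[i _ [B mB <-]]; rewrite setTI.
suff : <<s @RGenOInfty.G R >> `<=`
    [set B | S ((fun x : 'rV[R]_n => x ord0 i) @^-1` B)].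
  apply.
  have : (@ocitv R).-sigma.-measurable B by exact: mB.
  by rewrite RGenOInfty.measurableE.
have [S0 SC SUn] := S_sigma.
apply: smallest_sub; first split => /=.
- by rewrite preimage_set0.
- by move=> D; rewrite setTD preimage_setC -setTD; exact: SC.
- by move=> F SF; rewrite preimage_bigcup; exact: SUn.
move=> _ [a ->] /=; rewrite /S/=.
rewrite (_ : \1_ _ = (fun x : 'rV[R]_n => ((a < x ord0 i)%R : nat)%:R)); first exact: V_coord.
apply/funext => x; rewrite indicE; congr (_%:R); congr nat_of_bool.
by apply/idP/idP; rewrite inE /= in_itv/= andbT.
Qed.

Import HBNNSimple.

Let V_ge0 f : bmf f -> (forall x, 0 <= f x) -> V f.
Proof.
move=> [mf [C fC]] f0.
have mf' : measurable_fun setT (EFin \o f) by exact/measurable_EFinP.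
pose h := nnsfun_approx measurableT mf'.
have f0' x : setT x -> (0 <= (EFin \o f) x)%E by rewrite lee_fin f0.
pose w (k : nat) (x : 'rV[R]_n) : R := h k x.
suff [h1 h2 h3] : [/\ (forall k, V (w k)), (forall k x, `|w k x| <= C) & (forall x, w k x @[k --> \oo] --> f x)].
  exact: V_lim h1 h2 h3.
split => [k|k x|x].
- have [s ->] : exists s : seq R, w k = (fun x => \sum_(y <- s) y * \1_(h k @^-1` [set y]) x).
    exists (finmap.enum_fset (fset_set (range (h k)))).
    by apply/funext => x; rewrite [LHS]fimfunE fsbig_finite.
  elim: s => [|y s IH].
    by under eq_fun do rewrite big_nil.
  under eq_fun do rewrite big_cons.
  apply: V_add => //; apply: V_mul => //.
  by apply: S_measurable; exact: measurable_funPTI.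
- have h0 : 0 <= h k x by [].
  rewrite ger0_norm// (le_trans _ (fC x))// ger0_norm//.
  by rewrite -lee_fin /w /h nnsfun_approxE; exact: (le_approx k f0').
- have := cvg_nnsfun_approx measurableT mf' f0' (Logic.I : setT x).
  by move=> /fine_cvg.
Qed.

(** Adding the bound [C] makes the function nonnegative, hence a bounded limit of simple functions;
    the constant is subtracted inside [V]. *)
Lemma smooth_dense f : bmf f -> forall e : R, 0 < e ->
  exists2 p, smooth p & I (fun x => `|eta x * (f x - p x)|) <= e.
Proof.
move=> bf; have [_ [C fC]] := bf.
have : V (fun x => (f x + C) + - C).
  apply: V_add => //; apply: V_ge0; first by apply: bmfD => //; exact: bmf_cst.
  by move=> x; rewrite -lerBlDr sub0r lerNl (le_trans (ler_norm _))// normrN.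
rewrite (_ : (fun x => _) = f); first by case.
by apply/funext => x; rewrite addrK.
Qed.

End polynomial_density.

(** * The weak chain rule *)

Section weak_chain_rule.
Context {R : realType} {n : nat}.
Local Notation mu := (lebesgue_row n).
Local Notation I f := (\int[mu]_x f x).
Implicit Types (psi eta f : 'rV[R]_n -> R).

(** K stays fixed while the function varies, so that one radius of admissible translations serves
    all functions supported in it. *)
Definition test_in (K : set 'rV[R]_n) psi :=
  [/\ smooth psi, compact (supp psi) & supp psi `<=` K].

Lemma compact_support_radius psi : compact (supp psi) ->
  exists r : R, forall x, r < `|x| -> psi x = 0.
Proof.
move=> /compact_bounded[C [Cr HC]]; exists (`|C| + 1) => x xC; apply: supp_out => sx.
have CC : C < `|C| + 1 by rewrite (le_lt_trans (ler_norm _))// ltrDl.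
by have := HC _ CC x sx; rewrite /= leNgt xC.
Qed.

Lemma test_in_bms K psi : test_in K psi -> bms psi.
Proof.
move=> [spsi /compact_support_radius[r rpsi] _].
by apply: bms_continuous rpsi; exact: smooth_continuous.
Qed.

Lemma test_inM K psi (p : 'rV[R]_n -> R) : test_in K psi -> smooth p ->
  test_in K (fun x => psi x * p x).
Proof.
move=> [spsi cpsi psiK] sp.
have sub : supp (fun x => psi x * p x) `<=` supp psi.
  by apply: supp_sub => [|x /supp_out->]; [exact: closed_closure|rewrite mul0r].
split; [exact: smooth_mul| |exact: subset_trans psiK].
by apply: subclosed_compact cpsi sub; exact: closed_closure.
Qed.

Lemma test_inD K psi i : test_in K psi -> test_in K (fun x => 'D_(evec i) psi x).
Proof.
move=> [spsi cpsi psiK]; have sub := @supp_D R n psi i.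
split; [exact: smooth_D| |exact: subset_trans psiK].
by apply: subclosed_compact cpsi sub; exact: closed_closure.
Qed.

Lemma is_derive_line psi i (x : 'rV[R]_n) (t : R) : smooth psi ->
  is_derive t 1 (fun s : R => psi (x + s *: evec i)) ('D_(evec i) psi (x + t *: evec i)).
Proof.
move=> spsi; have := smooth_derivable (i := i) (x := x + t *: evec i) spsi.
have E : (fun h : R => h^-1 *: ((psi \o shift (x + t *: evec i)) (h *: evec i) - psi (x + t *: evec i)))
  = (fun h : R => h^-1 *: (((fun s : R => psi (x + s *: evec i)) \o shift t) (h *: (1 : R)) - psi (x + t *: evec i))).
  apply/funext => h /=; congr (_ *: (psi _ - _)).
  by rewrite [h *: 1]mulr1 scalerDl addrCA.
by rewrite /derivable E => d; split => //; rewrite /derive E.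
Qed.

Lemma bms_ball (r C : R) : bms (fun x : 'rV[R]_n => if `|x| <= r then C else 0).
Proof.
split; last by exists r => x; rewrite ltNge => /negbTE->.
split; last first.
  by exists `|C| => x; case: ifP => // _; rewrite normr0.
apply: measurable_fun_ifT => //.
have := @continuous_measurable_row R n (fun x => `|x|) (@norm_continuous _ _).
move=> mN; apply: (measurable_fun_bool true); rewrite setTI.
have := mN measurableT `]-oo, r]%classic (measurable_itv _).
by rewrite setTI; congr measurable; apply/seteqP; split => x /=; rewrite in_itv/=.
Qed.

(** [W] is only bounded: the derivative falls on [psi]. For |s - t| < 1 all translates vanish
    outside one ball, on which a constant dominates the derivative of the integrand. *)
Lemma is_derive_int_translate (W psi : 'rV[R]_n -> R) K i (t : R) :
  bmf W -> test_in K psi ->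
  is_derive t 1 (fun s : R => I (fun x => W x * psi (x + s *: evec i)))
    (I (fun x => W x * 'D_(evec i) psi (x + t *: evec i))).
Proof.
move=> bW tpsi; have [spsi _ _] := tpsi.
have tD := test_inD i tpsi; have [sD cD _] := tD.
have bpsi := test_in_bms tpsi; have bD := test_in_bms tD.
have [mW [C WC]] := bW; have [[_ [C' DC']] [r rD]] := bD.
pose F (s : R) x := W x * psi (x + s *: evec i).
have intF s : mu.-integrable setT (EFin \o F s).
  by apply: bms_integrable; apply: bmsMl => //; exact: bms_translate.
have dF (s : R) (x : 'rV[R]_n) : is_derive s 1 (F ^~ x) (W x * 'D_(evec i) psi (x + s *: evec i)).
  have d := is_derive_line i x s spsi.
  exact: (@is_deriveZ _ _ _ (fun s : R => psi (x + s *: evec i)) (W x) s 1).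
pose r' := r + (`|t| + 1) * `|evec i : 'rV[R]_n|.
pose g (x : 'rV[R]_n) := if `|x| <= r' then C * C' else 0.
have C0 : 0 <= C by exact: le_trans (WC 0).
have C'0 : 0 <= C' by exact: le_trans (DC' 0).
have g0 x : 0 <= g x by rewrite /g; case: ifP => // _; rewrite mulr_ge0.
have tI : `]t - 1, t + 1[%classic t by rewrite /= in_itv/= gtrBl ltrDl ltr01.
have Fg (s : R) (x : 'rV[R]_n) : `]t - 1, t + 1[%classic s -> setT x -> `|partial1of2 F s x| <= g x.
  rewrite /= in_itv/= => /andP[s1 s2] _.
  have [_] := dF s x; rewrite partial1of2E => ->; rewrite /g; case: ifPn => [_|].
    by rewrite normrM ler_pM.
  rewrite -ltNge => xr; rewrite rD ?mulr0 ?normr0//.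
  rewrite -(ltrD2r `|s *: evec i : 'rV[R]_n|); apply: (@le_lt_trans _ _ r').
    rewrite /r' lerD2l normrZ ler_wpM2r//.
    rewrite -lerBlDl (le_trans (lerB_dist _ _))// ler_norml; lra.
  apply: (lt_le_trans xr); rewrite -[leLHS](_ : `|x + s *: evec i - s *: evec i| = _); last by rewrite addrK.
  exact: ler_normB.
have dFx (s : R) (x : 'rV[R]_n) : `]t - 1, t + 1[%classic s -> setT x -> derivable (F ^~ x) s 1.
  by move=> _ _; case: (dF s x).
have ib := bms_integrable (bms_ball r' (C * C')).
split.
  exact: (derivable_under_integral measurableT tI (fun s _ => intF s) dFx g0 ib Fg).
rewrite -derive1E (differentiation_under_integral measurableT tI (fun s _ => intF s) dFx g0 ib Fg).
apply: eq_Rintegral => x _.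
by have [_] := dF t x; rewrite partial1of2E.
Qed.

Lemma derive_scale_sub (p q : 'rV[R]_n -> R) (c : R) i (x : 'rV[R]_n) :
  smooth p -> smooth q ->
  'D_(evec i) (fun y => c * (p y - q y)) x =
  c * ('D_(evec i) p x - 'D_(evec i) q x).
Proof.
move=> sp sq.
have dp := smooth_derivable (i := i) (x := x) sp.
have dq := smooth_derivable (i := i) (x := x) sq.
by rewrite (deriveZ c (derivableB dp dq)) (deriveB dp dq).
Qed.

Let le_pairing_split (a b c c' t k d : R) : `|- a - t * b| <= d / 2 ->
  `|t * c'| <= k -> `|c| <= k -> 2 * k <= d / 2 ->
  `|- (a + c) - t * (b + c')| <= d.
Proof.
rewrite !ler_norml mulrDr; move: (t * b) (t * c') => u v.
by move=> *; lra.
Qed.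

Section shifts.
Context (Phi G : 'rV[R]_n -> R) (i : 'I_n) (K : set 'rV[R]_n) (rho : R).
Hypotheses (bPhi : bmf Phi) (bG : bmf G) (rho0 : 0 < rho).
Local Notation e := (evec i).
Hypothesis weakG : forall psi, test_in K psi -> forall t : R, `|t| <= rho ->
  I (fun x => Phi x * 'D_e psi (x + t *: e)) = - I (fun x => G x * psi (x + t *: e)).

(** Pairs the increment of [Phi] along -t e with f. Moving the translation onto f turns it into an
    increment of f, which is smooth when f is a test function. *)
Let B (t : R) f := I (fun x => (Phi (x - t *: e) - Phi x) * f x).

Let bdPhi t : bmf (fun x => Phi (x - t *: e) - Phi x).
Proof. by apply: bmfD; [exact: bmf_translate|exact: bmfN]. Qed.

Let B_translate (W : 'rV[R]_n -> R) t f : bmf W -> bms f ->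
  I (fun x => (W (x - t *: e) - W x) * f x) =
  I (fun x => W x * f (x + t *: e)) - I (fun x => W x * f x).
Proof.
move=> bW bf.
rewrite -[X in _ = X - _](int_translate (- (t *: e))); last first.
  by apply: bmsMl => //; exact: bms_translate.
rewrite -intB; last 2 first.
- under eq_fun do rewrite subrK.
  by apply: bmsMl => //; exact: bmf_translate.
- exact: bmsMl.
by apply: eq_Rintegral => x _; rewrite subrK mulrBl.
Qed.

(** The integral of [Phi] against the translates of [psi] has a derivative bounded through [weakG]
    by C times the L^1 norm of [psi]; the mean value theorem concludes. A bound of order |t| in the
    L^1 norm is what survives approximation. *)
Let B_le_test psi (C t : R) : test_in K psi -> (forall x, `|G x| <= C) -> `|t| <= rho ->
  `|B t psi| <= `|t| * (C * I (fun x => `|psi x|)).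
Proof.
move=> tpsi GC trho; have bpsi := test_in_bms tpsi.
rewrite /B B_translate//.
pose J (s : R) := I (fun x => Phi x * psi (x + s *: e)).
rewrite -/(J t) [X in _ - X](_ : _ = J 0); last first.
  by apply: eq_Rintegral => x _; rewrite scale0r addr0.
have dJ s := is_derive_int_translate i s bPhi tpsi.
have J'le s : `|s| <= rho ->
    `|I (fun x => Phi x * 'D_e psi (x + s *: e))| <= C * I (fun x => `|psi x|).
  move=> srho; rewrite weakG// normrN.
  have bG' : bms (fun x => G x * psi (x + s *: e)).
    by apply: bmsMl => //; exact: bms_translate.
  apply: (le_trans (le_normr_int bG')).
  rewrite -(int_translate (s *: e) (bms_norm bpsi)).
  have bn : bms (fun x => `|psi (x + s *: e)|) by apply: bms_norm; exact: bms_translate.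
  rewrite -intZ//; apply: le_int; first exact: bms_norm.
    by apply: bmsMl => //; exact: bmf_cst.
  by move=> x; rewrite normrM ler_wpM2r.
have cJ a b : {within `[a, b], continuous J}.
  by apply: derivable_within_continuous => s _; case: (dJ s).
have [t0|t0] := leP 0 t.
  have [c ct ->] := MVT_segment t0 (fun s _ => dJ s) (cJ _ _).
  rewrite subr0 normrM mulrC ler_wpM2l// J'le//.
  move: ct; rewrite in_itv/= => /andP[c0 ct]; rewrite ger0_norm// (le_trans ct)//.
  by rewrite (le_trans _ trho)// ler_norm.
have [c ct] := MVT_segment (ltW t0) (fun s _ => dJ s) (cJ _ _).
rewrite distrC => ->; rewrite sub0r normrM normrN mulrC ler_wpM2l// J'le//.
move: ct; rewrite in_itv/= => /andP[tc c0]; rewrite ler0_norm// (le_trans _ trho)//.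
by rewrite ltr0_norm// lerN2.
Qed.

Section limit.
Context (eta f : 'rV[R]_n -> R) (teta : test_in K eta) (bf : bmf f).

Let beta : bms eta. Proof. exact: test_in_bms teta. Qed.

Let bmul (p : 'rV[R]_n -> R) : smooth p -> bms (fun x => eta x * p x).
Proof. by move=> sp; apply: (@test_in_bms K); exact: test_inM. Qed.

Let bdiff (p : 'rV[R]_n -> R) : smooth p -> bms (fun x => eta x * (f x - p x)).
Proof.
by move=> sp; under eq_fun do rewrite mulrBr; apply: bmsB; [exact: bmsMr|exact: bmul].
Qed.

Let dense (d : R) : 0 < d ->
  exists2 p, smooth p & I (fun x => `|eta x * (f x - p x)|) <= d.
Proof.
move=> d0; have [seta /compact_support_radius[r etar] _] := teta.
exact: (smooth_dense (smooth_continuous seta) etar).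
Qed.

(** For fixed t the pairing is continuous in L^1, with constant 2 D, so [B_le_test] extends by
    density. The error made in replacing f by a smooth q is absorbed in the arbitrary d, through the
    normalization [E]. *)
Let B_le (p : 'rV[R]_n -> R) (C t : R) : smooth p -> (forall x, `|G x| <= C) ->
  `|t| <= rho ->
  `|B t (fun x => eta x * (f x - p x))| <=
  `|t| * (C * I (fun x => `|eta x * (f x - p x)|)).
Proof.
move=> sp GC trho.
have C0 : 0 <= C by exact: le_trans (GC 0).
have [_ [D PhiD]] := bPhi; have D0 : 0 <= D by exact: le_trans (PhiD 0).
apply/ler_addgt0Pr => d d0.
pose E := `|t| * C + 2 * D + 1.
have E0 : 0 < E by rewrite ltr_wpDl// addr_ge0// mulr_ge0.
have [q sq qd] := dense (divr_gt0 d0 E0).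
have spq : smooth (fun x => q x - p x) by apply: smooth_add => //; exact: smooth_opp.
have tq := test_inM teta spq; have bq := bmul spq.
have -> : B t (fun x => eta x * (f x - p x)) =
    B t (fun x => eta x * (q x - p x)) + B t (fun x => eta x * (f x - q x)).
  rewrite /B -intD; try by apply: bmsMl => //; exact: bdiff.
  by apply: eq_Rintegral => x _; ring.
have h1 := B_le_test tq GC trho.
have h2 : `|B t (fun x => eta x * (f x - q x))| <= 2 * D * (d / E).
  have bdq := bdiff sq.
  rewrite /B (le_trans (le_normr_int (bmsMl (bdPhi t) bdq)))//.
  apply: (@le_trans _ _ (2 * D * I (fun x => `|eta x * (f x - q x)|))); last first.
    by rewrite ler_wpM2l// mulr_ge0.
  rewrite -intZ; last exact: bms_norm.
  apply: le_int; [exact/bms_norm/bmsMl|by apply: bmsMl; [exact: bmf_cst|exact: bms_norm]|].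
  move=> x; rewrite normrM ler_wpM2r// (le_trans (ler_normB _ _))//.
  by rewrite mulr2n mulrDl mul1r lerD.
have h3 : I (fun x => `|eta x * (q x - p x)|) <=
    I (fun x => `|eta x * (f x - p x)|) + d / E.
  apply: (@le_trans _ _ (I (fun x => `|eta x * (f x - p x)|) + I (fun x => `|eta x * (f x - q x)|))).
    rewrite -intD; try by apply: bms_norm; exact: bdiff.
    apply: le_int; [exact: bms_norm|by apply: bmsD; apply: bms_norm; exact: bdiff|].
    move=> x; rewrite (le_trans _ (ler_normB _ _))//.
    by rewrite le_eqVlt; apply/orP; left; apply/eqP; congr (`|_|); ring.
  by rewrite lerD2l.
rewrite (le_trans (ler_normD _ _))//.
have h4 : `|t| * (C * I (fun x => `|eta x * (q x - p x)|)) <=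
    `|t| * (C * I (fun x => `|eta x * (f x - p x)|)) + `|t| * C * (d / E).
  by rewrite -mulrA -mulrDr -mulrDr ler_wpM2l// ler_wpM2l.
apply: (le_trans (lerD (le_trans h1 h4) h2)).
rewrite -addrA lerD2l -mulrDl mulrA ler_pdivrMr// mulrC ler_wpM2l ?(ltW d0)//.
by rewrite /E lerDl.
Qed.

(** For a smooth p in place of f this is the derivative at 0 of a translated integral. The remainder
    f - p contributes at most C N to the quotient, uniformly in t, and at most C N to the limit. *)
Lemma B_cvg : t^-1 * B t (fun x => eta x * f x) @[t --> (0 : R)^'] -->
  - I (fun x => G x * (eta x * f x)).
Proof.
have [_ [C GC]] := bG; have C0 : 0 <= C by exact: le_trans (GC 0).
apply/cvgrPdist_le => d d0.
have d20 : 0 < d / 2 by rewrite divr_gt0.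
have C10 : 0 < 2 * C + 1 by rewrite ltr_wpDl// mulr_ge0.
have [p sp pd] := dense (divr_gt0 d20 C10).
have tp := test_inM teta sp; have bp := bmul sp; have bd := bdiff sp.
have bn := bms_norm bd.
pose N := I (fun x => `|eta x * (f x - p x)|).
have dJ := is_derive_int_translate i 0 bPhi tp.
have rho0' : `|0 : R| <= rho by rewrite normr0 ltW.
have cp : t^-1 * B t (fun x => eta x * p x) @[t --> (0 : R)^'] -->
    - I (fun x => G x * (eta x * p x)).
  case: dJ => dJ; rewrite weakG// /derive => JE.
  have <- : - I (fun x => G x * (eta (x + 0 *: e) * p (x + 0 *: e))) = - I (fun x => G x * (eta x * p x)).
    by congr (- _); apply: eq_Rintegral => x _; rewrite scale0r addr0.
  rewrite -JE; move: dJ; rewrite /derivable.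
  pose J (s : R) := I (fun x => Phi x * (eta (x + s *: e) * p (x + s *: e))).
  have E : (fun h : R => h^-1 *: ((J \o shift 0) (h *: (1 : R)) - J 0)) =
      (fun t => t^-1 * B t (fun x => eta x * p x)).
    apply/funext => h /=; rewrite /B B_translate//; congr (_ * (_ - _)).
      by apply: eq_Rintegral => x _; rewrite [h *: 1]mulr1 addr0.
    by apply: eq_Rintegral => x _; rewrite scale0r addr0.
  by rewrite -/J -/(J 0) E.
move/cvgrPdist_le : cp => /(_ _ d20) cp; near=> t.
have t0 : t != 0 by near: t; exact: nbhs_dnbhs_neq.
have trho : `|t| <= rho.
  near: t; apply: nbhs_dnbhs; apply/nbhs_ballP; exists rho => //= s.
  by rewrite /ball/= sub0r normrN => /ltW.
have cpt : `|- I (fun x => G x * (eta x * p x)) - t^-1 * B t (fun x => eta x * p x)| <= d / 2.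
  by near: t.
have -> : I (fun x => G x * (eta x * f x)) =
    I (fun x => G x * (eta x * p x)) + I (fun x => G x * (eta x * (f x - p x))).
  rewrite -intD; try exact: bmsMl.
  by apply: eq_Rintegral => x _; ring.
have -> : B t (fun x => eta x * f x) =
    B t (fun x => eta x * p x) + B t (fun x => eta x * (f x - p x)).
  rewrite /B -intD; try by apply: bmsMl.
  by apply: eq_Rintegral => x _; ring.
have h1 : `|t^-1 * B t (fun x => eta x * (f x - p x))| <= C * N.
  rewrite normrM normfV ler_pdivrMl ?normr_gt0//.
  exact: B_le.
have h2 : `|I (fun x => G x * (eta x * (f x - p x)))| <= C * N.
  rewrite (le_trans (le_normr_int (bmsMl bG bd)))// /N -intZ//.
  apply: le_int; [exact/bms_norm/bmsMl|by apply: bmsMl => //; exact: bmf_cst|].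
  by move=> x; rewrite normrM ler_wpM2r.
have h3 : 2 * C * N <= d / 2.
  rewrite (le_trans (ler_wpM2l _ pd)) ?mulr_ge0//.
  rewrite mulrA ler_pdivrMr// mulrC ler_wpM2l ?(ltW d20)// lerDl//.
by apply: (le_pairing_split cpt h1 h2); rewrite mulrA.
Unshelve. all: end_near. Qed.

End limit.

(* [expR (- b) - expR (- a) >= - expR (- a) * (b - a)] with [b] a translate of
   [a = Phi x]; the two signs of the step give both inequalities. *)
Let weak_chain_ge0 psi : test_in K psi -> (forall x, 0 <= psi x) ->
  I (fun x => expR (- Phi x) * 'D_e psi x) = I (fun x => expR (- Phi x) * (G x * psi x)).
Proof.
move=> tpsi psi0; have bpsi := test_in_bms tpsi.
pose W x := expR (- Phi x).
have bW : bmf W by exact: bmf_expRN.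
(* The weight exp(-Phi) is merely bounded and measurable; this is why [B_cvg] allows such a factor
   beside the test function. *)
have cB := B_cvg tpsi bW.
have dE := is_derive_int_translate i 0 bW tpsi.
pose E (s : R) := I (fun x => W x * psi (x + s *: e)).
have E0 : E 0 = I (fun x => W x * psi x).
  by apply: eq_Rintegral => x _; rewrite scale0r addr0.
have cE : t^-1 * (E t - E 0) @[t --> (0 : R)^'] --> I (fun x => W x * 'D_e psi x).
  case: dE; rewrite /derivable /derive => dE vE.
  have <- : I (fun x => W x * 'D_e psi (x + 0 *: e)) = I (fun x => W x * 'D_e psi x).
    by apply: eq_Rintegral => x _; rewrite scale0r addr0.
  rewrite -vE; move: dE.
  have -> : (fun h : R => h^-1 *: ((E \o shift 0) (h *: (1 : R)) - E 0)) = (fun t => t^-1 * (E t - E 0)).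
    by apply/funext => h /=; rewrite [h *: 1]mulr1 addr0.
  by [].
have EB t : - B t (fun x => psi x * W x) <= E t - E 0.
  rewrite E0 -(B_translate t bW bpsi) /B -intN; last first.
    by apply: bmsMl => //; exact: bmsMr.
  apply: le_int.
  - by apply: bmsN; apply: bmsMl => //; exact: bmsMr.
  - by apply: bmsMl => //; apply: bmfD; [exact: bmf_translate|exact: bmfN].
  move=> x; rewrite mulrCA -mulrN mulrC ler_wpM2r// -/(W x).
  have := expR_ge1Dx (Phi x - Phi (x - t *: e)).
  move=> /(ler_wpM2l (expR_ge0 (- Phi x))); rewrite -expRD -/(W x).
  have -> : - Phi x + (Phi x - Phi (x - t *: e)) = - Phi (x - t *: e) by ring.
  by rewrite -/(W (x - t *: e)); lra.
have IE : I (fun x => G x * (psi x * W x)) = I (fun x => W x * (G x * psi x)).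
  by apply: eq_Rintegral => x _; ring.
apply/eqP; rewrite eq_le -!/(W _) -IE; apply/andP; split.
  rewrite -lerN2.
  apply: (@ler_cvg_to _ (0 : R)^'- _ _ (fun t => t^-1 * B t (fun x => psi x * W x)) (fun t => - (t^-1 * (E t - E 0)))).
  - exact: (cvg_dnbhs_at_left cB).
  - by apply: cvgN; exact: (cvg_dnbhs_at_left cE).
  near=> t; have t0 : t < 0 by [].
  by rewrite -mulrN ler_wnM2l ?invr_le0 ?(ltW t0)// -lerN2 opprK.
rewrite -lerN2.
apply: (@ler_cvg_to _ (0 : R)^'+ _ _ (fun t => - (t^-1 * (E t - E 0))) (fun t => t^-1 * B t (fun x => psi x * W x))).
- by apply: cvgN; exact: (cvg_dnbhs_at_right cE).
- exact: (cvg_dnbhs_at_right cB).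
near=> t; have t0 : 0 < t by [].
by rewrite -mulrN ler_wpM2l ?invr_ge0 ?(ltW t0)// -lerN2 opprK.
Unshelve. all: end_near. Qed.

(* polarization reduces a product of test functions to nonnegative ones *)
Lemma weak_chain_mul a b : test_in K a -> test_in K b ->
  I (fun x => expR (- Phi x) * 'D_e (fun y => a y * b y) x) =
  I (fun x => expR (- Phi x) * (G x * (a x * b x))).
Proof.
move=> ta tb.
have [sa _ _] := ta; have [sb _ _] := tb.
have tN c : test_in K c -> test_in K (fun x => - c x).
  move=> [sc cc cK]; have sub : supp (fun x => - c x) `<=` supp c.
    by apply: supp_sub => [|x /supp_out->]; [exact: closed_closure|rewrite oppr0].
  split; [exact: smooth_opp| |exact: subset_trans cK].
  by apply: subclosed_compact cc sub; exact: closed_closure.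
have tA c d : test_in K c -> test_in K d -> test_in K (fun x => c x + d x).
  move=> [sc cc cK] [sd cd dK].
  have sub : supp (fun x => c x + d x) `<=` supp c `|` supp d.
    apply: supp_sub => [|x /not_orP[/supp_out-> /supp_out->]]; last by rewrite addr0.
    by apply: closedU; exact: closed_closure.
  split; first exact: smooth_add.
    by apply: subclosed_compact sub; [exact: closed_closure|exact: compactU].
  by apply: (subset_trans sub) => x [/cK|/dK].
pose p x := (a x + b x) * (a x + b x); pose q x := (a x - b x) * (a x - b x).
have tab := tA _ _ ta tb; have [sab _ _] := tab.
have tamb := tA _ _ ta (tN _ tb); have [samb _ _] := tamb.
have tp : test_in K p by exact: test_inM.
have tq : test_in K q by exact: test_inM.
have [sp _ _] := tp; have [sq _ _] := tq.
have p0 x : 0 <= p x by rewrite /p -expr2 sqr_ge0.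
have q0 x : 0 <= q x by rewrite /q -expr2 sqr_ge0.
have hp := weak_chain_ge0 tp p0; have hq := weak_chain_ge0 tq q0.
have abE : (fun y => a y * b y) = (fun y => 4^-1 * (p y - q y)).
  by apply/funext => x; rewrite /p /q; field.
have bW : bmf (fun x => expR (- Phi x)).
  have [mPhi [C PhiC]] := bPhi; split.
    by apply: (measurableT_comp (@measurable_expR R)); exact: measurable_funN.
  exists (expR C) => x; rewrite ger0_norm ?expR_ge0// ler_expR lerNl.
  by have := PhiC x; rewrite ler_norml => /andP[].
have DE x : 'D_e (fun y => a y * b y) x = 4^-1 * ('D_e p x - 'D_e q x).
  by rewrite abE derive_scale_sub.
have bDp := test_in_bms (test_inD i tp); have bDq := test_in_bms (test_inD i tq).
have bp := test_in_bms tp; have bq := test_in_bms tq.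
transitivity (4^-1 * (I (fun x => expR (- Phi x) * 'D_e p x) - I (fun x => expR (- Phi x) * 'D_e q x))).
  rewrite -intB; try exact: bmsMl.
  rewrite -intZ; last by apply: bmsB; exact: bmsMl.
  by apply: eq_Rintegral => x _; rewrite DE mulrCA -mulrBr.
rewrite hp hq -intB; try by apply: bmsMl => //; exact: bmsMl.
rewrite -intZ; last by apply: bmsB; apply: bmsMl => //; exact: bmsMl.
by apply: eq_Rintegral => x _; rewrite /p /q; field.
Qed.

End shifts.

End weak_chain_rule.

(** * Localization to compact subsets of the domain *)

Section localization.
Context {R : realType} {n : nat}.
Local Notation mu := (lebesgue_row n).
Local Notation I f := (\int[mu]_x f x).

Lemma compact_ball0 (r : R) : compact [set x : 'rV[R]_n | `|x| <= r].
Proof.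
apply: bounded_closed_compact.
  exists r; split; first exact: num_real.
  by move=> y ry x /= xr; rewrite (le_trans xr)// ltW.
have -> : [set x : 'rV[R]_n | `|x| <= r] = (fun x : 'rV[R]_n => `|x|) @^-1` [set t | t <= r] by [].
by apply: closed_comp; [move=> *; exact: norm_continuous|exact: closed_le].
Qed.

(** K' is K plus a closed ball, the image of a compact product under addition; compactness of K
    provides a radius valid at all of its points. *)
Lemma compact_thickening (K Omega : set 'rV[R]_n) : compact K -> open Omega ->
  K `<=` Omega -> exists (rho : R) (K' : set 'rV[R]_n),
  [/\ 0 < rho, compact K', K' `<=` Omega &
    forall x v, K x -> `|v| <= rho -> K' (x + v)].
Proof.
move=> cK oO KO.
have [rho rho0 KrO] : exists2 rho : R, 0 < rho & forall x v, K x -> `|v| <= rho -> Omega (x + v).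
  have /compact_near_coveringP nK := cK.
  have /= := nK R^o (0^'+) (fun d x => 0 < d -> forall v, `|v| <= d -> Omega (x + v)) _ _.
  case=> [x Kx|d /= d0 Hd].
    have /nbhs_ballP[d /= d0 Hd] := open_nbhs_nbhs (conj oO (KO _ Kx)).
    exists (ball x (d / 2), [set t | t < d / 2]) => /=.
      split; first by apply: nbhsx_ballx; rewrite divr_gt0.
      by apply: nbhs_right_lt; rewrite divr_gt0.
    move=> [x' t] /= [xx' td] t0 v vt; apply: Hd.
    rewrite -ball_normE/= opprD addrA (splitr d) (le_lt_trans (ler_normB _ _))// ltrD//.
      by move: xx'; rewrite -ball_normE.
    exact: le_lt_trans td.
  exists (d / 2); first by rewrite divr_gt0.
  move=> x v Kx; apply: (Hd (d / 2)) => //=; last by rewrite divr_gt0.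
    by rewrite sub0r normrN gtr0_norm ?divr_gt0//; lra.
  by rewrite divr_gt0.
exists rho, ((fun p : 'rV[R]_n * 'rV[R]_n => p.1 + p.2) @` (K `*` [set v | `|v| <= rho])).
split => //.
- apply: continuous_compact; last by apply: compact_setX => //; exact: compact_ball0.
  by apply: continuous_subspaceT => p; exact: add_continuous.
- by move=> _ [[x v] /= [Kx vr] <-]; exact: KrO.
- by move=> x v Kx vr; exists (x, v).
Qed.

(** Turns an integral over Omega of data known almost everywhere into a real integral, over the
    whole space, of an everywhere bounded function. *)
Lemma int_transfer (Omega K : set 'rV[R]_n) (f F : 'rV[R]_n -> R) :
  measurable Omega -> K `<=` Omega -> measurable_fun Omega f -> bms F ->
  {ae mu, forall x, K x -> f x = F x} ->
  (forall x, Omega x -> ~ K x -> f x = 0) -> (forall x, ~ K x -> F x = 0) ->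
  (\int[mu]_(x in Omega) (f x)%:E = (I F)%:E)%E.
Proof.
move=> mO KO mf bF fF f0 F0.
rewrite /Rintegral fineK; last by apply: integrable_fin_num => //; exact: bms_integrable.
rewrite [LHS]integral_mkcond.
apply: (@ae_eq_integral _ _ R mu setT (EFin \o F) ((EFin \o f) \_ Omega) measurableT).
- by apply/(measurable_restrictT _ mO)/measurable_EFinP.
- by apply/measurable_EFinP; case: bF => [[]].
apply: filterS fF => x /= fFx _; rewrite patchE; case: ifPn => [/set_mem Ox|/negP Ox].
  have [Kx|Kx] := pselect (K x); first by rewrite /= (fFx Kx).
  by rewrite /= (f0 _ Ox Kx) (F0 _ Kx).
by rewrite F0// => /KO /mem_set.
Qed.

(** f is cut off outside K and clamped at its essential bound there, which changes it on K only
    within a null set. *)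
Lemma Linfty_loc_truncate (Omega K : set 'rV[R]_n) (f : 'rV[R]_n -> R) :
  open Omega -> Linfty_loc Omega f -> compact K -> K `<=` Omega ->
  exists2 F, bmf F & {ae mu, forall x, K x -> f x = F x}.
Proof.
move=> oO [mf Lf] cK KO; have [C fC] := Lf K cK KO.
have mK := compact_measurable_row cK.
pose h : 'rV[R]_n -> R := f \_ K.
have mh : measurable_fun setT h.
  apply/(measurable_restrictT f mK).
  by apply: (measurable_funS _ KO mf); exact: open_measurable_row.
exists (fun x => Num.max (- `|C|) (Num.min `|C| (h x))).
  split; first by apply: measurable_maxr => //; exact: measurable_minr.
  exists `|C| => x; rewrite ler_norml le_max lexx/= ge_max ge_min lexx/= andbT.
  by rewrite (le_trans (y := 0))// oppr_le0.
apply: filterS fC => x /= fCx Kx; have := fCx Kx; rewrite /h patchE mem_set//.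
move=> /le_trans/(_ (ler_norm C)); rewrite ler_norml => /andP[h1 h2].
by rewrite min_r// max_r.
Qed.

End localization.

Section weak_chain_local.
Context {R : realType} {n : nat}.
Local Notation mu := (lebesgue_row n).
Local Notation I f := (\int[mu]_x f x).

(** Small translates of a function supported in K are supported in K', where [phi] and [dphi] agree
    almost everywhere with bounded functions. The definition of the weak gradient, applied to these
    translates, is the hypothesis [weakG] of the chain rule. *)
Lemma weak_chain_local (Omega K : set 'rV[R]_n) (phi : 'rV[R]_n -> R)
    (dphi : 'rV[R]_n -> 'rV[R]_n) :
  open Omega -> W1oo_loc Omega phi dphi -> compact K -> K `<=` Omega ->
  exists (K' : set 'rV[R]_n) (Phi : 'rV[R]_n -> R) (G : 'I_n -> 'rV[R]_n -> R),
  [/\ compact K', K `<=` K' & K' `<=` Omega] /\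
  [/\ bmf Phi, (forall i, bmf (G i)), {ae mu, forall x, K' x -> phi x = Phi x},
      (forall i, {ae mu, forall x, K' x -> dphi x ord0 i = G i x}) &
      forall i a b, test_in K a -> test_in K b ->
        I (fun x => expR (- Phi x) * 'D_(evec i) (fun y => a y * b y) x) =
        I (fun x => expR (- Phi x) * (G i x * (a x * b x)))].
Proof.
move=> oO [Lphi Ldphi wphi] cK KO.
have [rho [K' [rho0 cK' K'O KK']]] := compact_thickening cK oO KO.
have mO := open_measurable_row oO.
have [Phi bPhi phiE] := Linfty_loc_truncate oO Lphi cK' K'O.
have /choice[G GP] : forall i, exists G, bmf G /\ {ae mu, forall x, K' x -> dphi x ord0 i = G x}.
  by move=> i; have [G bG GE] := Linfty_loc_truncate oO (Ldphi i) cK' K'O; exists G.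
exists K', Phi, G; split; first split => //.
  by move=> x Kx; rewrite -[x]addr0; apply: KK' => //; rewrite normr0 ltW.
split => //; try by move=> i; have [] := GP i.
move=> i a b ta tb; have [bG GE] := GP i.
pose r := rho / (`|evec i : 'rV[R]_n| + 1).
have e0 : 0 < `|evec i : 'rV[R]_n| + 1 by rewrite ltr_wpDl.
have r0 : 0 < r by rewrite divr_gt0.
apply: (weak_chain_mul bPhi bG r0 _ ta tb) => psi tpsi t tr.
have [spsi cpsi psiK] := tpsi.
pose v : 'rV[R]_n := t *: evec i.
have vr : `|v| <= rho.
  rewrite normrZ (@le_trans _ _ (r * (`|evec i : 'rV[R]_n| + 1)))//.
    by rewrite ler_pM// lerDl.
  by rewrite /r divfK// gt_eqF.
pose eta x := psi (x + v).
have eta0 x : ~ K' x -> eta x = 0.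
  move=> NK'; apply: (@supp_out _ _ psi) => sx; have Kxv := psiK _ sx; apply: NK'.
  by rewrite -[x](addrK v); apply: KK' => //; rewrite normrN.
have clK' : closed K' by apply: compact_closed cK'; exact: norm_hausdorff.
have etaK' : supp eta `<=` K' by exact: supp_sub.
have seta : smooth eta by exact: smooth_translate.
have teta : test_function Omega eta.
  split => //; last exact: subset_trans K'O.
  by apply: subclosed_compact cK' etaK'; exact: closed_closure.
have tin : test_in K' eta by case: teta.
have tD := test_inD i tin.
have D0 x : ~ K' x -> 'D_(evec i) eta x = 0.
  by case: tD => _ _ DK' NK'; apply: (@supp_out _ _ (fun y => 'D_(evec i) eta y)) => sx; exact/NK'/DK'.
have mT f : measurable_fun setT f -> measurable_fun Omega (f : 'rV[R]_n -> R).
  exact: measurable_funTS.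
have := wphi i eta teta.
rewrite (@int_transfer _ _ Omega K' _ (fun x => Phi x * 'D_(evec i) eta x))//; last 5 first.
- apply: measurable_funM; first by case: Lphi.
  by apply: mT; case: (test_in_bms tD) => [[]].
- by apply: bmsMl => //; exact: test_in_bms tD.
- by apply: filterS phiE => x /= + Kx => ->.
- by move=> x _ /D0->; rewrite mulr0.
- by move=> x /D0->; rewrite mulr0.
rewrite (@int_transfer _ _ Omega K' _ (fun x => G i x * eta x))//; last 5 first.
- apply: measurable_funM; first by case: (Ldphi i).
  by apply: mT; case: (test_in_bms tin) => [[]].
- by apply: bmsMl => //; exact: test_in_bms tin.
- by apply: filterS GE => x /= + Kx => ->.
- by move=> x _ /eta0->; rewrite mulr0.
- by move=> x /eta0->; rewrite mulr0.
move=> [<-]; apply: eq_Rintegral => x _.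
by congr (_ * _); exact/esym/(congr1 (fun F => F x) (derive_translate psi v i)).
Qed.

Import HBNNSimple.

(** The formula holds for indicators by hypothesis, for simple functions by linearity, and for f by
    monotone convergence on both sides. *)
Lemma integral_density (Omega : set 'rV[R]_n) (phi f : 'rV[R]_n -> R)
    (nu : {measure set 'rV[R]_n -> \bar R}) :
  measurable Omega -> measurable_fun Omega phi ->
  (forall E : set 'rV[R]_n, measurable E ->
     nu E = (\int[mu]_(x in E `&` Omega) (expR (- phi x))%:E)%E) ->
  measurable_fun Omega f -> (forall x, Omega x -> 0 <= f x) ->
  (\int[nu]_(x in Omega) (f x)%:E = \int[mu]_(x in Omega) (f x * expR (- phi x))%:E)%E.
Proof.
move=> mO mphi nuE mf f0.
pose g x := expR (- phi x).
have mg : measurable_fun Omega (EFin \o g).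
  apply/measurable_EFinP; apply: (measurableT_comp (@measurable_expR R)).
  exact: measurable_funN.
have g0 x : (0 <= (g x)%:E)%E by rewrite lee_fin expR_ge0.
have mf' : measurable_fun Omega (EFin \o f) by exact/measurable_EFinP.
have f0' x : Omega x -> (0 <= (EFin \o f) x)%E by move=> /f0; rewrite lee_fin.
pose h := nnsfun_approx mO mf'.
have mh k : measurable_fun Omega (EFin \o h k).
  by apply/measurable_EFinP; apply: measurable_funTS; exact/measurable_funP.
have -> : (\int[nu]_(x in Omega) (f x)%:E =
    limn (fun k => \int[nu]_(x in Omega) (EFin \o h k) x))%E.
  rewrite -monotone_convergence//.
  - apply: eq_integral => x /[!inE] Ox; apply/esym/cvg_lim => //.
    exact: (cvg_nnsfun_approx mO mf' f0').
  - by move=> k x Ox; rewrite lee_fin.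
  - by move=> x Ox a b ab; rewrite lee_fin; exact/lefP/nd_nnsfun_approx.
have -> : (\int[mu]_(x in Omega) (f x * expR (- phi x))%:E =
    limn (fun k => \int[mu]_(x in Omega) ((EFin \o h k) x * (g x)%:E)))%E.
  rewrite -monotone_convergence//.
  - apply: eq_integral => x /[!inE] Ox; apply/esym/cvg_lim => //.
    rewrite EFinM; apply: cvgeZr => //.
    exact: (cvg_nnsfun_approx mO mf' f0').
  - by move=> k; exact: emeasurable_funM.
  - by move=> k x Ox; rewrite mule_ge0// lee_fin.
  - by move=> x Ox a b ab; rewrite lee_wpmul2r// lee_fin; exact/lefP/nd_nnsfun_approx.
congr (limn _); apply/funext => k.
transitivity (\int[nu]_(x in Omega)
   (\sum_(y \in range (h k)) (y * \1_(h k @^-1` [set y]) x)%:E))%E.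
  by apply: eq_integral => t tE; rewrite /= fimfunE -fsumEFin.
have indich r : measurable_fun Omega (fun x => (r * \1_(h k @^-1` [set r]) x)%:E).
  by apply: (measurable_comp measurableT) => //; exact: measurable_funM.
rewrite ge0_integral_fsum//; last by move=> y x Ox; exact: nnfun_muleindic_ge0.
transitivity (\int[mu]_(x in Omega) (\sum_(y \in range (h k))
    (y * \1_(h k @^-1` [set y]) x)%:E * (g x)%:E))%E; last first.
  under [RHS]eq_integral do rewrite /= fimfunE -fsumEFin//.
  apply: eq_integral => x xO.
  by rewrite ge0_mule_fsuml// => y; exact: nnfun_muleindic_ge0.
rewrite ge0_integral_fsum//; last 2 first.
- by move=> y; apply: emeasurable_funM.
- by move=> y x Ox; rewrite mule_ge0// nnfun_muleindic_ge0.
apply: eq_fsbigr => r rhn.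
have r0 : 0 <= r by move: rhn; rewrite inE => -[t _ <-].
under eq_integral do rewrite EFinM.
rewrite integralZl_indic_nnsfun//.
under [RHS]eq_integral do rewrite EFinM -muleA.
rewrite ge0_integralZl//.
- have -> : (\int[mu]_(x in Omega) ((\1_(h k @^-1` [set r]) x)%:E * (g x)%:E) =
      \int[mu]_(x in Omega) ((EFin \o g) \_ (h k @^-1` [set r])) x)%E.
    by apply: eq_integral => x xE; rewrite epatch_indic muleC.
  rewrite -integral_mkcondr integral_indic//.
  have mp : measurable (h k @^-1` [set r]) by [].
  rewrite nuE; last exact: measurableI.
  by rewrite -setIA setIid setIC.
- apply: emeasurable_funM => //; apply/measurable_EFinP.
  exact: measurable_funTS.
- by move=> t Et; rewrite mule_ge0// lee_fin.
Qed.

End weak_chain_local.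

(** * The key inequality *)

Section euclidean_norm.
Context {R : realType} {m n : nat}.
Implicit Types A : 'M[R]_(m, n).

Lemma eucl_norm_ge0 A : 0 <= eucl_norm A.
Proof. exact: sqrtr_ge0. Qed.

Lemma eucl_norm_sqr A : eucl_norm A ^+ 2 = \sum_i \sum_j A i j ^+ 2.
Proof.
by rewrite sqr_sqrtr//; apply: sumr_ge0 => i _; apply: sumr_ge0 => j _; exact: sqr_ge0.
Qed.

Lemma entry_le_eucl_norm A i j : `|A i j| <= eucl_norm A.
Proof.
rewrite -ler_sqr ?nnegrE ?eucl_norm_ge0// eucl_norm_sqr real_normK ?num_real//.
rewrite (bigD1 i)//= (bigD1 j)//= -addrA lerDl addr_ge0//.
  by apply: sumr_ge0 => k _; exact: sqr_ge0.
by apply: sumr_ge0 => k _; apply: sumr_ge0 => l _; exact: sqr_ge0.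
Qed.

End euclidean_norm.

(** * The divergence of u q(|Du|^2) Du *)

Section first_second_derivatives.
Context {R : realType} {n : nat}.
Implicit Types (u : 'rV[R]_n -> R) (x : 'rV[R]_n).

Lemma eucl_norm_grad_sqr u x :
  eucl_norm (grad u x) ^+ 2 = \sum_j 'D_(evec j) u x ^+ 2.
Proof. by rewrite eucl_norm_sqr big_ord1; apply: eq_bigr => j _; rewrite mxE. Qed.

Definition laplacian u x := \sum_i 'D_(evec i) (fun y => 'D_(evec i) u y) x.

(** The quadratic form of the Hessian at Du, that is, half the scalar product of Du with the
    gradient of |Du|^2. *)
Definition hess_form u x := \sum_i 'D_(evec i) u x *
  (\sum_j 'D_(evec j) u x * 'D_(evec i) (fun y => 'D_(evec j) u y) x).

Lemma laplacian_le u x : `|laplacian u x| <= n%:R * eucl_norm (hess u x).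
Proof.
rewrite (le_trans (ler_norm_sum _ _ _))// -[n in n%:R]card_ord mulr_natl -sumr_const.
by apply: ler_sum => i _; have := entry_le_eucl_norm (hess u x) i i; rewrite mxE.
Qed.

(** The factor |Du|^2 is essential: it is the s that accompanies q'(s). *)
Lemma hess_form_le u x :
  `|hess_form u x| <= n%:R ^+ 2 * eucl_norm (hess u x) * eucl_norm (grad u x) ^+ 2.
Proof.
have gE i : `|'D_(evec i) u x| <= eucl_norm (grad u x).
  by have := entry_le_eucl_norm (grad u x) ord0 i; rewrite mxE.
have hE i j : `|'D_(evec i) (fun y => 'D_(evec j) u y) x| <= eucl_norm (hess u x).
  by have := entry_le_eucl_norm (hess u x) i j; rewrite mxE.
have g0 := eucl_norm_ge0 (grad u x); have h0 := eucl_norm_ge0 (hess u x).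
move: (eucl_norm (grad u x)) (eucl_norm (hess u x)) gE hE g0 h0 => g h gE hE g0 h0.
have sum_le (F : 'I_n -> R) (c : R) : (forall i, `|F i| <= c) -> `|\sum_i F i| <= n%:R * c.
  move=> Fc; rewrite (le_trans (ler_norm_sum _ _ _))// -[n in n%:R]card_ord mulr_natl -sumr_const.
  exact: ler_sum.
rewrite [leRHS](_ : _ = n%:R * (g * (n%:R * (g * h)))); last by ring.
apply: (sum_le) => i; rewrite normrM ler_pM//.
by apply: (sum_le) => j; rewrite normrM ler_pM.
Qed.

Lemma smooth_grad_sqr u : smooth u -> smooth (fun x => eucl_norm (grad u x) ^+ 2).
Proof.
move=> su; under eq_fun do rewrite eucl_norm_grad_sqr.
by apply: smooth_sum => j; under eq_fun do rewrite expr2; apply: smooth_mul; exact: smooth_D.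
Qed.

Lemma smooth_laplacian u : smooth u -> smooth (laplacian u).
Proof. by move=> su; apply: smooth_sum => i; do 2!apply: smooth_D. Qed.

Lemma smooth_hess_form u : smooth u -> smooth (hess_form u).
Proof.
move=> su; apply: smooth_sum => i; apply: smooth_mul; first exact: smooth_D.
by apply: smooth_sum => j; apply: smooth_mul; do ?apply: smooth_D.
Qed.

(** The term without u is q(s) s, which tends to M(|Du|) when q tends to g; every other term carries
    u and second derivatives. *)
Lemma divergence_poly_grad u (q : {poly R}) x : smooth u ->
  \sum_i 'D_(evec i) (fun y => u y * (q.[eucl_norm (grad u y) ^+ 2] * 'D_(evec i) u y)) x =
  let s := eucl_norm (grad u x) ^+ 2 in
  q.[s] * s + u x * (q.[s] * laplacian u x + 2 * (q^`().[s] * hess_form u x)).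
Proof.
move=> su /=; have sG := smooth_grad_sqr su.
have sD i : smooth (fun y => 'D_(evec i) u y) by exact: smooth_D.
have sq : smooth (fun y => q.[eucl_norm (grad u y) ^+ 2]) by exact: smooth_poly.
have sum_lin (a b c : 'I_n -> R) (q0 q1 v t : R) : t = \sum_i a i ->
    \sum_i (q0 * a i + (v * q0 * b i + v * 2 * q1 * c i)) =
    q0 * t + v * (q0 * \sum_i b i + 2 * (q1 * \sum_i c i)).
  by move->; rewrite !big_split/= -!mulr_sumr; ring.
have DG i : 'D_(evec i) (fun y => eucl_norm (grad u y) ^+ 2) x =
    2 * \sum_j 'D_(evec j) u x * 'D_(evec i) (fun y => 'D_(evec j) u y) x.
  rewrite (_ : (fun y => _) = fun y => \sum_j 'D_(evec j) u y * 'D_(evec j) u y); last first.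
    by apply/funext => y; rewrite eucl_norm_grad_sqr.
  rewrite derive_sumE; last by move=> j; exact/smooth_derivable/smooth_mul.
  rewrite mulr_sumr; apply: eq_bigr => j _.
  by rewrite derive_mul; do ?exact: smooth_derivable; ring.
move: (eucl_norm_grad_sqr u x); set s := eucl_norm _ ^+ 2 => sE.
transitivity (\sum_i (q.[s] * 'D_(evec i) u x ^+ 2 +
  (u x * q.[s] * 'D_(evec i) (fun y => 'D_(evec i) u y) x + u x * 2 * q^`().[s] *
    ('D_(evec i) u x * \sum_j 'D_(evec j) u x * 'D_(evec i) (fun y => 'D_(evec j) u y) x)))).
  apply: eq_bigr => i _.
  have su0 : derivable u x (evec i) by exact: smooth_derivable.
  have sq0 : derivable (fun y => q.[eucl_norm (grad u y) ^+ 2]) x (evec i).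
    exact: smooth_derivable.
  have sD0 : derivable (fun y => 'D_(evec i) u y) x (evec i) by exact: smooth_derivable.
  rewrite (derive_mul su0); last by apply: smooth_derivable; exact: smooth_mul.
  rewrite (derive_mul sq0 sD0) derive_poly// DG.
  by move: (\sum_j _) => T; rewrite -/s; ring.
exact: sum_lin.
Qed.

End first_second_derivatives.

(** * The key inequality for Lebesgue integrals *)

Section key_inequality.
Context {R : realType} {n : nat}.
Local Notation leb := (lebesgue_row n).
Local Notation I f := (\int[leb]_x f x).
Context (M : R -> R) (NM : N_function M) (M_C1 : C1_pos M).
Context (c : R) (Mc : forall x : R, 0 < x -> M (2 * x) <= c * M x).
Hypothesis M_near0 : exists C : R, \forall x \near 0^'+, `|derive1 M x / x| <= C.

(** n bounds the Laplacian and the pairing with the weak gradient of phi; 2 (|c| + 1) n^2 comes from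
    the Hessian form, |c| + 1 being the constant of [quot2'_le]. *)
Definition key_constant : R := n%:R + 2 * (`|c| + 1) * n%:R ^+ 2.

Lemma key_constant_ge0 : 0 <= key_constant.
Proof. by rewrite addr_ge0// !mulr_ge0// ?exprn_ge0// addr_ge0. Qed.

Lemma bmf_lim (w : nat -> 'rV[R]_n -> R) (f : 'rV[R]_n -> R) (C : R) :
  (forall k, measurable_fun setT (w k)) -> (forall k x, `|w k x| <= C) ->
  (forall x, w k x @[k --> \oo] --> f x) -> bmf f.
Proof.
move=> mw wC wf; split; first by apply: (measurable_fun_cvg mw) => x _; exact: wf.
exists C => x; apply: (cvgr_to_le (cvg_norm (wf x))).
by apply: nearW => k; exact: wC.
Qed.

Lemma measurable_eucl_norm p q (D : set 'rV[R]_n) (F : 'rV[R]_n -> 'M[R]_(p, q)) :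
  (forall i j, measurable_fun D (fun x => F x i j)) ->
  measurable_fun D (fun x => eucl_norm (F x)).
Proof.
move=> mF; apply: (measurableT_comp (continuous_measurable_fun (@sqrt_continuous R))).
apply: measurable_sum => i; apply: measurable_sum => j.
under eq_fun do rewrite expr2.
exact: measurable_funM.
Qed.

Lemma bmf_eucl_norm p q (F : 'rV[R]_n -> 'M[R]_(p, q)) :
  (forall i j, bmf (fun x => F x i j)) -> bmf (fun x => eucl_norm (F x)).
Proof.
move=> bF; split; first by apply: measurable_eucl_norm => i j; case: (bF i j).
have [C FC] : exists C : 'I_p -> 'I_q -> R, forall i j x, `|F x i j| <= C i j.
  have /choice[C FC] : forall ij : 'I_p * 'I_q, exists C : R, forall x, `|F x ij.1 ij.2| <= C.
    by move=> [i j]; case: (bF i j).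
  by exists (fun i j => C (i, j)) => i j; exact: (FC (i, j)).
exists (Num.sqrt (\sum_i \sum_j C i j ^+ 2)) => x; rewrite ger0_norm ?sqrtr_ge0// ler_wsqrtr//.
apply: ler_sum => i _; apply: ler_sum => j _.
by rewrite -real_normK ?num_real// lerXn2r ?nnegrE// (le_trans _ (FC i j x)).
Qed.

Lemma bms_eucl_norm p q (F : 'rV[R]_n -> 'M[R]_(p, q)) :
  (forall i j, bms (fun x => F x i j)) -> bms (fun x => eucl_norm (F x)).
Proof.
move=> bF; split; first by apply: bmf_eucl_norm => i j; case: (bF i j).
have : bms (fun x => \sum_i \sum_j F x i j ^+ 2).
  apply: bms_sum => i; apply: bms_sum => j.
  under eq_fun do rewrite expr2.
  by apply: bmsMl => //; case: (bF i j).
by move=> [_ [r Fr]]; exists r => x /Fr; rewrite /eucl_norm => ->; rewrite sqrtr0.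
Qed.

(** The last bracket is the difference of two integrands with equal integrals, so it disappears on
    integration. What remains to be estimated is w v (q d + 2 q' t - q p), term by term. *)
Let key_pointwise (a w q q' v d t p c1 k h g b : R) :
  0 <= w -> 0 <= q -> 0 <= h -> 0 <= g -> 0 <= b -> 0 <= k -> 0 <= c1 ->
  `|q'| <= c1 * q -> `|d| <= k * h -> `|t| <= k ^+ 2 * h -> `|p| <= k * (b * g) ->
  a <= (k + 2 * c1 * k ^+ 2) * (q * (`|v| * (h + g * b))) * w +
    (a + w * (v * (q * d + 2 * (q' * t))) - w * (v * (q * p))).
Proof.
move=> w0 q0 h0 g0 b0 k0 c10 q'q dh th pb.
pose X := q * d + 2 * (q' * t) - q * p.
have XE : `|X| <= (k + 2 * c1 * k ^+ 2) * (q * (h + g * b)).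
  have e1 : `|q * d| <= q * (k * h) by rewrite normrM ger0_norm// ler_wpM2l.
  have e2 : `|2 * (q' * t)| <= 2 * (c1 * q * (k ^+ 2 * h)).
    by rewrite normrM ger0_norm// ler_wpM2l// normrM ler_pM.
  have e3 : `|q * p| <= q * (k * (b * g)) by rewrite normrM ger0_norm// ler_wpM2l.
  have e4 : 0 <= 2 * (c1 * (k ^+ 2 * (q * (g * b)))).
    by apply: mulr_ge0 => //; apply: mulr_ge0 => //; apply: mulr_ge0; rewrite ?exprn_ge0//; apply: mulr_ge0 => //; apply: mulr_ge0.
  rewrite (le_trans (ler_normB _ _))// (le_trans (lerD (ler_normD _ _) (lexx _)))//.
  rewrite (le_trans (lerD (lerD e1 e2) e3))// -subr_ge0 [leRHS](_ : _ = 2 * (c1 * (k ^+ 2 * (q * (g * b)))))//.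
  by ring.
have : `|w * (v * X)| <= (k + 2 * c1 * k ^+ 2) * (q * (`|v| * (h + g * b))) * w.
  rewrite normrM ger0_norm// normrM [leRHS](_ : _ = w * (`|v| * ((k + 2 * c1 * k ^+ 2) * (q * (h + g * b))))); last by ring.
  by rewrite ler_wpM2l// ler_wpM2l.
rewrite ler_norml => /andP[+ _]; rewrite /X.
rewrite -[X in _ <= _ + X]addrA -mulrBr -mulrBr.
by move: (w * (v * _)) (_ * w) => y z; lra.
Qed.

Section test.
Context (u : 'rV[R]_n -> R) (K : set 'rV[R]_n) (tu : test_in K u).
Context (Phi : 'rV[R]_n -> R) (G : 'I_n -> 'rV[R]_n -> R).
Hypotheses (bPhi : bmf Phi) (bG : forall i, bmf (G i)).
Hypothesis chain : forall i a b, test_in K a -> test_in K b ->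
  I (fun x => expR (- Phi x) * 'D_(evec i) (fun y => a y * b y) x) =
  I (fun x => expR (- Phi x) * (G i x * (a x * b x))).

Let s x := eucl_norm (grad u x) ^+ 2.
Let s0 x : 0 <= s x. Proof. exact: sqr_ge0. Qed.

Let su : smooth u. Proof. by case: tu. Qed.

Let tD i : test_in K (fun x => 'D_(evec i) u x). Proof. exact: test_inD. Qed.

Let W x := expR (- Phi x).
Let bW : bmf W. Proof. exact: bmf_expRN. Qed.

Let tW psi : test_in K psi -> bms (fun x => W x * psi x).
Proof. by move=> /test_in_bms; exact: bmsMl. Qed.

Let pairing x := \sum_i G i x * 'D_(evec i) u x.

Let bms_pairing : bms pairing.
Proof. by apply: bms_sum => i; apply: bmsMl => //; exact: test_in_bms. Qed.

(** [chain] is applied to the two test functions u and q(s) D_i u, then summed over i. *)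
Let integral_divergence (q : {poly R}) :
  I (fun x => W x * (q.[s x] * s x +
     u x * (q.[s x] * laplacian u x + 2 * (q^`().[s x] * hess_form u x)))) =
  I (fun x => W x * (u x * (q.[s x] * pairing x))).
Proof.
have sq : smooth (fun y => q.[s y]) by exact/smooth_poly/smooth_grad_sqr.
have tqD i : test_in K (fun y => q.[s y] * 'D_(evec i) u y).
  by under eq_fun do rewrite mulrC; exact: test_inM.
have tuq i : test_in K (fun y => u y * (q.[s y] * 'D_(evec i) u y)).
  by apply: test_inM => //; case: (tqD i).
transitivity (\sum_i I (fun x => W x * 'D_(evec i) (fun y => u y * (q.[s y] * 'D_(evec i) u y)) x)).
  rewrite -int_sum; last by move=> i; apply: tW; exact: test_inD.
  by apply: eq_Rintegral => x _; rewrite -mulr_sumr divergence_poly_grad.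
transitivity (\sum_i I (fun x => W x * (G i x * (u x * (q.[s x] * 'D_(evec i) u x))))).
  by apply: eq_bigr => i _; exact: chain.
rewrite -int_sum => [|i].
  apply: eq_Rintegral => x _; rewrite -mulr_sumr; congr (_ * _).
  by rewrite /pairing !mulr_sumr; apply: eq_bigr => i _; ring.
by apply: bmsMl => //; apply: bmsMl => //; exact: test_in_bms.
Qed.

Let bms_u : bms u. Proof. exact: (test_in_bms tu). Qed.

Let bms_hess : bms (fun x => eucl_norm (hess u x)).
Proof.
apply: bms_eucl_norm => i j; under eq_fun do rewrite mxE.
exact: test_in_bms (test_inD i (tD j)).
Qed.

Let bms_grad : bms (fun x => eucl_norm (grad u x)).
Proof.
by apply: bms_eucl_norm => i j; under eq_fun do rewrite mxE; exact: test_in_bms (tD j).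
Qed.

Let bms_s : bms s.
Proof. by rewrite /s; under eq_fun do rewrite expr2; apply: bmsMl; case: bms_grad. Qed.

Let quot2_sE x : quot2 M (s x) * s x = M (eucl_norm (grad u x)).
Proof.
rewrite /quot2 /s sqrtr_sqr ger0_norm ?eucl_norm_ge0//.
have [->|g0] := eqVneq (eucl_norm (grad u x)) 0; first by rewrite expr0n mulr0 N_function0.
by rewrite divfK// expf_neq0.
Qed.

(** Dividing by s isolates the product s q'(s). Where s = 0 the default value 0 is consistent, since
    the Hessian form vanishes there. *)
Let Ts x := hess_form u x / s x.

Let TsE x : s x * Ts x = hess_form u x.
Proof.
rewrite /Ts; have [sx0|sx0] := eqVneq (s x) 0; last by rewrite mulrC divfK.
rewrite sx0 mul0r; apply/esym/eqP; rewrite -normr_le0 (le_trans (hess_form_le u x))//.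
by rewrite -/(s x) sx0 mulr0.
Qed.

Let Ts_le x : `|Ts x| <= n%:R ^+ 2 * eucl_norm (hess u x).
Proof.
have := hess_form_le u x; rewrite -/(s x) /Ts normrM normfV (ger0_norm (s0 x)).
have [->|sx0] := eqVneq (s x) 0.
  by rewrite invr0 !mulr0 mulr_ge0// ?exprn_ge0// eucl_norm_ge0.
by rewrite ler_pdivrMr// lt_def sx0 s0.
Qed.

Let pairing_le x : `|pairing x| <=
  n%:R * (eucl_norm (\row_i G i x) * eucl_norm (grad u x)).
Proof.
rewrite /pairing (le_trans (ler_norm_sum _ _ _))// -[n in n%:R]card_ord mulr_natl -sumr_const.
apply: ler_sum => i _; rewrite normrM ler_pM//.
  by have := entry_le_eucl_norm (\row_i G i x) ord0 i; rewrite mxE.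
by have := entry_le_eucl_norm (grad u x) ord0 i; rewrite mxE.
Qed.

(** [a] stands for q(s) and [b] for s q'(s), so that the passage to the limit only replaces this
    pair. *)
Let Lhs (a b : 'rV[R]_n -> R) x :=
  W x * (a x * s x + u x * (a x * laplacian u x + 2 * (b x * Ts x))).

Let Rhs (a : 'rV[R]_n -> R) x := W x * (u x * (a x * pairing x)).

(** Dominated convergence on both sides of [integral_divergence]; written with [Ts], the integrands
    involve the polynomials only through q_k(s) and s q_k'(s), which are bounded uniformly in k. *)
Let limit_identity : exists C, [/\ forall x, quot2 M (s x) <= C,
  bmf (fun x => quot2 M (s x)), bms (Lhs (quot2 M \o s) (quot2' M \o s)),
  bms (Rhs (quot2 M \o s)) &
  I (Lhs (quot2 M \o s) (quot2' M \o s)) = I (Rhs (quot2 M \o s))].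
Proof.
have [[_ [S' sS']] [r sr]] := bms_s.
pose S := Num.max 1 S'.
have S1 : 1 <= S by rewrite le_max lexx.
have s0S x : 0 <= s x <= S.
  by rewrite s0/= le_max (le_trans (ler_norm _) (sS' x)) orbT.
have [C MC] := quot2_bounded NM M_C1 S M_near0.
have [q [D [qD q'D qq qq']]] := quot2_approx NM M_C1 Mc S1 MC.
have [mW [CW WC]] := bW.
have [[mu' [Cu uC]] [ru ur]] := bms_u.
have [[_ [CH hC]] _] := bms_hess.
have [[mp [Cp pC]] _] := bms_pairing.
have ss : smooth s by exact: smooth_grad_sqr.
have nn0 (f : 'rV[R]_n -> R) (B : R) : (forall x, `|f x| <= B) -> 0 <= B.
  by move=> fB; exact: le_trans (fB 0).
have H0 x : 0 <= eucl_norm (hess u x) by exact: eucl_norm_ge0.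
have HC x : eucl_norm (hess u x) <= CH by exact: le_trans (ler_norm _) (hC x).
have CH0 := nn0 _ _ hC.
have n0 : 0 <= n%:R :> R by [].
pose F k := Lhs (fun x => (q k).[s x]) (fun x => s x * (q k)^`().[s x]).
have [] := @int_dominated R n F (Lhs (quot2 M \o s) (quot2' M \o s))
  (CW * (D * S + Cu * (D * (n%:R * CH) + 2 * (D * (n%:R ^+ 2 * CH))))) (Num.max r ru).
- move=> k; rewrite (_ : F k = fun x => W x * ((q k).[s x] * s x + u x *
      ((q k).[s x] * laplacian u x + 2 * ((q k)^`().[s x] * hess_form u x)))).
    apply: measurable_funM => //; apply: continuous_measurable_row; apply: smooth_continuous.
    apply: smooth_add; first by apply: smooth_mul => //; exact: smooth_poly.
    apply: smooth_mul => //; apply: smooth_add; first by apply: smooth_mul; [exact: smooth_poly|exact: smooth_laplacian].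
    by apply: smooth_mul; [exact: smooth_cst|apply: smooth_mul; [exact: smooth_poly|exact: smooth_hess_form]].
  by apply/funext => x; rewrite /F /Lhs -TsE; ring.
- move=> k x; rewrite /F /Lhs normrM ler_pM// (le_trans (ler_normD _ _))// lerD//.
    rewrite normrM ler_pM//; first exact: qD.
    by rewrite ger0_norm ?s0//; case/andP: (s0S x).
  rewrite normrM ler_pM// (le_trans (ler_normD _ _))// lerD//.
    rewrite normrM ler_pM//; first exact: qD.
    by rewrite (le_trans (laplacian_le _ _))// ler_wpM2l.
  rewrite normrM (ger0_norm (ler0n _ _)) ler_wpM2l// normrM ler_pM//; first exact: q'D.
  by rewrite (le_trans (Ts_le _))// ler_wpM2l// exprn_ge0.
- by move=> k x; rewrite gt_max => /andP[/sr sx0 /ur ux0]; rewrite /F /Lhs sx0 ux0; ring.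
- move=> x; rewrite /F /Lhs/=; apply: cvgMr.
  apply: cvgD; first by apply: cvgMl; exact: qq.
  apply: cvgMr; apply: cvgD; first by apply: cvgMl; exact: qq.
  by apply: cvgMr; apply: cvgMl; exact: qq'.
move=> bL cL.
pose E k := Rhs (fun x => (q k).[s x]).
have [] := @int_dominated R n E (Rhs (quot2 M \o s)) (CW * (Cu * (D * Cp))) ru.
- move=> k; apply: measurable_funM => //; apply: measurable_funM => //.
  apply: measurable_funM => //.
  by apply: continuous_measurable_row; exact/smooth_continuous/smooth_poly.
- move=> k x; rewrite /E /Rhs normrM ler_pM// normrM ler_pM// normrM ler_pM//.
  exact: qD.
- by move=> k x /ur ux0; rewrite /E /Rhs ux0; ring.
- by move=> x; rewrite /E /Rhs/=; do 2!apply: cvgMr; apply: cvgMl; exact: qq.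
move=> bR cR; exists C; split => //.
- by move=> x; apply: MC; case/andP: (s0S x).
- apply: (@bmf_lim (fun k x => (q k).[s x]) _ D) => [k|k x|x]; [|exact: qD|exact: qq].
  by apply: continuous_measurable_row; exact/smooth_continuous/smooth_poly.
have EF : (fun k => I (E k)) = (fun k => I (F k)).
  apply/funext => k; rewrite /E /Rhs -integral_divergence; apply: eq_Rintegral => x _.
  by rewrite /F /Lhs -TsE; ring.
rewrite EF in cR.
by transitivity (limn (fun k => I (F k))); [exact/esym/cvg_lim|exact/cvg_lim].
Qed.

Lemma key_lebesgue :
  let Y x := quot2 M (eucl_norm (grad u x) ^+ 2) * (`|u x| *
      (eucl_norm (hess u x) + eucl_norm (grad u x) * eucl_norm (\row_i G i x))) in
  [/\ bmf (fun x => quot2 M (eucl_norm (grad u x) ^+ 2)),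
      bms (fun x => M (eucl_norm (grad u x)) * expR (- Phi x)),
      bms (fun x => key_constant * Y x * expR (- Phi x)) &
      I (fun x => M (eucl_norm (grad u x)) * expR (- Phi x)) <=
      I (fun x => key_constant * Y x * expR (- Phi x))].
Proof.
move=> Y; have [C [q2C bq2 bL bR LR]] := limit_identity.
have bM : bms (fun x => M (eucl_norm (grad u x)) * expR (- Phi x)).
  by under eq_fun do rewrite -quot2_sE; apply: bmsMr => //; exact: bmsMl.
have bY : bms (fun x => key_constant * Y x * expR (- Phi x)).
  apply: bmsMr => //; apply: bmsMl; first exact: bmf_cst.
  apply: bmsMl => //; apply: bmsMr; first exact: bms_norm.
  apply: bmfD; first by case: bms_hess.
  apply: bmfM; first by case: bms_grad.
  by apply: bmf_eucl_norm => i j; under eq_fun do rewrite mxE.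
split => //.
(* Adding a difference of integral zero makes the inequality hold pointwise. *)
have -> : I (fun x => key_constant * Y x * expR (- Phi x)) =
    I (fun x => key_constant * Y x * expR (- Phi x) +
      (Lhs (quot2 M \o s) (quot2' M \o s) x - Rhs (quot2 M \o s) x)).
  by rewrite intD//; [rewrite intB// LR subrr addr0|exact: bmsB].
apply: le_int => // [|x]; first by apply: bmsD => //; exact: bmsB.
rewrite /Lhs /Rhs /= mulrDr quot2_sE -/(W x) [W x * M _]mulrC.
set q := quot2 M (s x); set q' := quot2' M (s x).
have q0 : 0 <= q by exact: quot2_ge0.
have q'q : `|q'| <= (`|c| + 1) * q by exact: quot2'_le.
have W0 : 0 <= W x by exact: expR_ge0.
have := laplacian_le u x; have := Ts_le x; have := pairing_le x.
move=> p_le t_le d_le.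
by apply: key_pointwise => //; exact: eucl_norm_ge0.
Qed.

End test.
End key_inequality.

(** * From Lebesgue integrals to the measure on the domain *)

Section transfer.
Context {R : realType} {n : nat}.
Local Notation leb := (lebesgue_row n).
Local Notation I f := (\int[leb]_x f x).

Lemma measurable_fun_ge0_comp (N : R -> R) (D : set 'rV[R]_n) (f : 'rV[R]_n -> R) :
  measurable_fun (`[0, +oo[%classic : set R) N -> measurable_fun D f ->
  (forall x, D x -> 0 <= f x) -> measurable_fun D (fun x => N (f x)).
Proof.
move=> mN mf f0; apply: (measurable_comp _ _ mN mf); first exact: measurable_itv.
by move=> _ [x Dx <-]; rewrite /= in_itv/= andbT f0.
Qed.

Lemma N_function_measurable (N : R -> R) : N_function N ->
  measurable_fun (`[0, +oo[%classic : set R) N.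
Proof.
by move=> [_ cN _ _ _]; apply: subspace_continuous_measurable_fun.
Qed.

Lemma measurable_grad_norm (D : set 'rV[R]_n) (u : 'rV[R]_n -> R) : smooth u ->
  measurable_fun D (fun x => eucl_norm (grad u x)).
Proof.
move=> su; apply: measurable_funTS; apply: measurable_eucl_norm => i j.
under eq_fun do rewrite mxE.
by apply: continuous_measurable_row; exact/smooth_continuous/smooth_D.
Qed.

Lemma measurable_hess_norm (D : set 'rV[R]_n) (u : 'rV[R]_n -> R) : smooth u ->
  measurable_fun D (fun x => eucl_norm (hess u x)).
Proof.
move=> su; apply: measurable_funTS; apply: measurable_eucl_norm => i j.
under eq_fun do rewrite mxE.
by apply: continuous_measurable_row; apply: smooth_continuous; do 2!apply: smooth_D.
Qed.

Context (Omega : set 'rV[R]_n) (phi : 'rV[R]_n -> R) (dphi : 'rV[R]_n -> 'rV[R]_n)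
  (mu : {measure set 'rV[R]_n -> \bar R}).
Hypotheses (oO : open Omega) (Wphi : W1oo_loc Omega phi dphi)
  (muE : forall E : set 'rV[R]_n, measurable E ->
      mu E = (\int[leb]_(x in E `&` Omega) (expR (- phi x))%:E)%E).
Context (M : R -> R) (NM : N_function M) (M_C1 : C1_pos M).
Context (c : R) (Mc : forall x : R, 0 < x -> M (2 * x) <= c * M x).
Hypothesis M_near0 : exists C : R, \forall x \near 0^'+, `|derive1 M x / x| <= C.

Let mO : measurable Omega. Proof. exact: open_measurable_row. Qed.

Lemma measurable_weak_gradient_norm : measurable_fun Omega (fun x => eucl_norm (dphi x)).
Proof.
apply: measurable_eucl_norm => i j; rewrite (ord1 i).
by case: Wphi => _ + _ => /(_ j)[].
Qed.

(** Finiteness is recorded for the later absorption: the left-hand side is the real integral of a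
    bounded function with bounded support. *)
Lemma key_inequality u : test_function Omega u ->
  let Y x := @key_constant R n c * (quot2 M (eucl_norm (grad u x) ^+ 2) * (`|u x| *
    (eucl_norm (hess u x) + eucl_norm (grad u x) * eucl_norm (dphi x)))) in
  [/\ (\int[mu]_(x in Omega) (M (eucl_norm (grad u x)))%:E < +oo)%E,
      measurable_fun Omega Y &
      (\int[mu]_(x in Omega) (M (eucl_norm (grad u x)))%:E <=
       \int[mu]_(x in Omega) (Y x)%:E)%E].
Proof.
move=> tu Y; have [su cK KO] := tu.
have [K' [Phi [G [[cK' KK' K'O] [bPhi bG phiE dphiE chain]]]]] :=
  weak_chain_local oO Wphi cK KO.
have tuK : test_in (supp u) u by split.
have [bq bM bY MY] := key_lebesgue NM M_C1 Mc M_near0 tuK bPhi bG chain.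
have mg := measurable_grad_norm (D := Omega) su.
have mh := measurable_hess_norm (D := Omega) su.
have mphi : measurable_fun Omega phi by case: Wphi => -[].
have mW : measurable_fun Omega (fun x => expR (- phi x)).
  by apply: (measurableT_comp (@measurable_expR R)); exact: measurable_funN.
have grad0 x : ~ supp u x -> grad u x = 0.
  move=> xK; apply/rowP => i; rewrite !mxE.
  apply: (@supp_out _ _ (fun y => 'D_(evec i) u y)) => /supp_D; exact: xK.
have eucl0 : eucl_norm (0 : 'rV[R]_n) = 0.
  by rewrite /eucl_norm big1 ?sqrtr0// => i _; rewrite big1// => j _; rewrite mxE expr0n.
have M0 x : ~ supp u x -> M (eucl_norm (grad u x)) = 0.
  by move=> /grad0->; rewrite eucl0 N_function0.
have mM : measurable_fun Omega (fun x => M (eucl_norm (grad u x))).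
  apply: measurable_fun_ge0_comp => //; first exact: N_function_measurable.
  by move=> x _; exact: eucl_norm_ge0.
have M_ge0 x : 0 <= M (eucl_norm (grad u x)).
  by case: NM => h _ _ _ _; apply: h; exact: eucl_norm_ge0.
have mY : measurable_fun Omega Y.
  apply: measurable_funM => //; apply: measurable_funM.
    by apply: measurable_funTS; case: bq.
  apply: measurable_funM.
    apply: (measurableT_comp (@normr_measurable R setT)); apply: measurable_funTS.
    by apply: continuous_measurable_row; exact: smooth_continuous.
  apply: measurable_funD => //; apply: measurable_funM => //.
  exact: measurable_weak_gradient_norm.
have dphiE' : {ae leb, forall x, K' x -> forall i, dphi x ord0 i = G i x}.
  have dall : {ae leb, forall x, forall i, K' x -> dphi x ord0 i = G i x}.
    exact: filter_forall.
  by apply: filterS dall => x h K'x i; exact: h.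
rewrite (integral_density mO mphi muE) //.
rewrite (@int_transfer _ _ Omega (supp u) _ (fun x => M (eucl_norm (grad u x)) * expR (- Phi x)))//; last 4 first.
- exact: measurable_funM.
- by apply: filterS phiE => x + /KK' => /[apply] ->.
- by move=> x _ /M0->; rewrite mul0r.
- by move=> x /M0->; rewrite mul0r.
split; [exact: ltry|by []|].
rewrite (integral_density mO mphi muE) //; last first.
  move=> x Ox; rewrite mulr_ge0 ?key_constant_ge0// mulr_ge0 ?quot2_ge0// mulr_ge0//.
  by rewrite addr_ge0 ?mulr_ge0 ?eucl_norm_ge0.
rewrite (@int_transfer _ _ Omega (supp u) _ _ _ _ _ bY)//; last 4 first.
- exact: measurable_funM.
- apply: filterS2 phiE dphiE' => x Px Gx /KK' K'x; rewrite /Y Px//.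
  by rewrite (_ : dphi x = \row_i G i x)//; apply/rowP => i; rewrite mxE Gx.
- by move=> x _ /supp_out; rewrite /Y => ->; rewrite normr0 !(mul0r, mulr0).
- by move=> x /supp_out->; rewrite normr0 !(mul0r, mulr0).
Qed.

End transfer.

(** * The inequality for the integrals *)

Section euclidean_gradient.
Context {R : realType} {n : nat}.
Implicit Types (u : 'rV[R]_n -> R) (x v : 'rV[R]_n).

(** Otherwise the sum of the squared entries would be at most n / (n + 1)^2 times itself. The factor
    n + 1 is a crude form of sqrt n that stays positive in dimension 0. *)
Lemma eucl_norm_le_entry v : eucl_norm v = 0 \/
  exists i, eucl_norm v <= n.+1%:R * `|v ord0 i|.
Proof.
have [//|v0] := eqVneq (eucl_norm v) 0; first by left.
have {}v0 : 0 < eucl_norm v by rewrite lt_def v0 eucl_norm_ge0.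
right; apply: contrapT => /forallNP h.
have h' i : n.+1%:R ^+ 2 * v ord0 i ^+ 2 <= eucl_norm v ^+ 2.
  rewrite -[v ord0 i ^+ 2]real_normK ?num_real// -exprMn lerXn2r ?nnegrE ?eucl_norm_ge0//.
  by have /negP := h i; rewrite -ltNge => /ltW.
have : n.+1%:R ^+ 2 * eucl_norm v ^+ 2 <= n%:R * eucl_norm v ^+ 2.
  rewrite {1}eucl_norm_sqr big_ord1 mulr_sumr -[n in n%:R * _]card_ord mulr_natl -sumr_const.
  exact: ler_sum.
rewrite ler_pM2r ?exprn_gt0// -natrX ler_nat leqNgt => /negP; apply.
by rewrite (@leq_trans (n.+1 ^ 1))// leq_pexp2l.
Qed.

Lemma eucl_norm_grad_scale (k : R) u x : smooth u ->
  eucl_norm (grad (fun y => k * u y) x) = `|k| * eucl_norm (grad u x).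
Proof.
move=> su; apply/eqP; rewrite -(@eqrXn2 _ 2)// ?mulr_ge0 ?eucl_norm_ge0//.
rewrite exprMn real_normK ?num_real// !eucl_norm_grad_sqr mulr_sumr; apply/eqP.
apply: eq_bigr => i _; rewrite -exprMn; congr (_ ^+ 2).
rewrite derive_mul; [|exact: derivable_cst|exact: smooth_derivable].
by rewrite derive_cst mulr0 addr0.
Qed.

Lemma grad_partial_le_hess u i x :
  eucl_norm (grad (fun y => 'D_(evec i) u y) x) <= eucl_norm (hess u x).
Proof.
rewrite -ler_sqr ?nnegrE ?eucl_norm_ge0// eucl_norm_grad_sqr eucl_norm_sqr.
apply: ler_sum => j _; rewrite (bigD1 i)//= mxE lerDl; apply: sumr_ge0 => k _.
exact: sqr_ge0.
Qed.

End euclidean_gradient.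

Section young.
Context {R : realType} (M P Q : R -> R).
Hypotheses (M_ge0 : forall x : R, 0 <= x -> 0 <= M x)
  (P_ge0 : forall x : R, 0 <= x -> 0 <= P x)
  (Q_ge0 : forall x : R, 0 <= x -> 0 <= Q x).
Hypothesis MPQ : forall u v w : R, 0 < u -> 0 < v -> 0 < w ->
  M u / u ^+ 2 * (v * w) <= M u + P v + Q w.

(** [MPQ] is used at th h and K v / (eps th), whose product is K v h / eps. As it is assumed for
    positive arguments, vanishing factors are treated apart: the left-hand side is then 0. *)
Lemma quot2_young (eps th K a v h : R) : 0 < eps -> 0 < th -> 0 <= K ->
  0 <= a -> 0 <= v -> 0 <= h ->
  K * (quot2 M (a ^+ 2) * (v * h)) <=
  eps * (M a + P (th * h) + Q (K * v / (eps * th))).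
Proof.
move=> e0 t0 K0 a0 v0 h0.
have R0 : 0 <= eps * (M a + P (th * h) + Q (K * v / (eps * th))).
  have b0 : 0 <= th * h by rewrite mulr_ge0// ltW.
  have d0 : 0 <= K * v / (eps * th) by apply: divr_ge0; [exact: mulr_ge0|apply: ltW; exact: mulr_gt0].
  by rewrite mulr_ge0 ?(ltW e0)// addr_ge0 ?Q_ge0// addr_ge0 ?M_ge0 ?P_ge0.
have [a00|a1] := eqVneq a 0.
  have -> : quot2 M (a ^+ 2) = 0 by rewrite /quot2 a00 expr0n invr0 mulr0.
  by rewrite mul0r mulr0.
have [v00|v1] := eqVneq v 0; first by apply: le_trans R0; rewrite v00 !(mul0r, mulr0).
have [h00|h1] := eqVneq h 0; first by apply: le_trans R0; rewrite h00 !(mul0r, mulr0).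
have [K00|K1] := eqVneq K 0; first by apply: le_trans R0; rewrite K00 !(mul0r, mulr0).
have ap : 0 < a by rewrite lt_def a1.
have vp : 0 < v by rewrite lt_def v1.
have hp : 0 < h by rewrite lt_def h1.
have Kp : 0 < K by rewrite lt_def K1.
have b0 : 0 < th * h by rewrite mulr_gt0.
have d0 : 0 < K * v / (eps * th) by rewrite divr_gt0// mulr_gt0.
have := MPQ ap b0 d0; rewrite -(ler_pM2l e0); apply: le_trans.
rewrite /quot2 sqrtr_sqr ger0_norm// le_eqVlt; apply/orP; left; apply/eqP.
move: (M a / a ^+ 2) => y; field.
by rewrite !gt_eqF.
Qed.

End young.

Section part1.
Context {R : realType} {n : nat}.
Local Notation leb := (lebesgue_row n).
Context (Omega : set 'rV[R]_n) (M P Q : R -> R) (phi : 'rV[R]_n -> R)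
  (dphi : 'rV[R]_n -> 'rV[R]_n) (mu : {measure set 'rV[R]_n -> \bar R}) (K1 K2 A : R).
Hypotheses (oO : open Omega) (NM : N_function M) (M_C1 : C1_pos M) (M_Delta2 : Delta2 M)
  (M_near0 : exists C : R, \forall x \near 0^'+, `|derive1 M x / x| <= C)
  (Wphi : W1oo_loc Omega phi dphi)
  (muE : forall E : set 'rV[R]_n, measurable E ->
      mu E = (\int[leb]_(x in E `&` Omega) (expR (- phi x))%:E)%E)
  (P_ge0 : forall x : R, 0 <= x -> 0 <= P x)
  (Q_ge0 : forall x : R, 0 <= x -> 0 <= Q x)
  (P_ndecr : forall x y : R, 0 <= x -> x <= y -> P x <= P y)
  (Q_ndecr : forall x y : R, 0 <= x -> x <= y -> Q x <= Q y)
  (P_meas : measurable_fun (`[0, +oo[%classic : set R) P)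
  (Q_meas : measurable_fun (`[0, +oo[%classic : set R) Q)
  (P0 : P 0 = 0)
  (MPQ : forall u v w : R, 0 < u -> 0 < v -> 0 < w ->
      M u / u ^+ 2 * (v * w) <= M u + P v + Q w)
  (K1_gt0 : 0 < K1) (K2_gt0 : 0 < K2) (A_gt0 : 0 < A)
  (hP : forall u : 'rV[R]_n -> R, test_function Omega u ->
      (\int[mu]_(x in Omega) (P (eucl_norm (dphi x) * `|u x|))%:E <=
       K1%:E * \int[mu]_(x in Omega) (P (A * eucl_norm (grad u x)))%:E +
       K2%:E * \int[mu]_(x in Omega) (M `|u x|)%:E)%E).

Let mO : measurable Omega. Proof. exact: open_measurable_row. Qed.
Let M_ge0 (x : R) : 0 <= x -> 0 <= M x.
Proof. by case: NM => h _ _ _ _; exact: h. Qed.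

Lemma gradient_interpolation : exists L B : R, [/\ 0 < L, 0 < B &
  forall theta : R, 0 < theta -> theta <= 1 ->
  forall u : 'rV[R]_n -> R, test_function Omega u ->
    (\int[mu]_(x in Omega) (M (eucl_norm (grad u x)))%:E <=
     L%:E * \int[mu]_(x in Omega) (P (theta * eucl_norm (hess u x)))%:E +
     \int[mu]_(x in Omega) (Q (B / theta * `|u x|))%:E)%E].
Proof.
have [c c0 Mc] := M_Delta2.
pose K := @key_constant R n c; have K0 : 0 <= K by exact: key_constant_ge0.
pose N : R := n.+1%:R; have N0 : 0 < N by rewrite ltr0Sn.
pose A1 := Num.max A 1.
have A10 : 0 < A1 by rewrite lt_max ltr01 orbT.
(* Gives M(|Du|) the total coefficient 1/2: eps from each of the two Young inequalities, and eps K2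
   from each of the n partial derivatives. *)
pose eps := (2 * (2 + n%:R * K2))^-1.
have d0 : 0 < 2 + n%:R * K2 by rewrite ltr_wpDr// mulr_ge0// ltW.
have eps0 : 0 < eps by rewrite invr_gt0 mulr_gt0.
have epsE : eps * (2 + n%:R * K2) = 1 / 2.
  by rewrite /eps; field; rewrite gt_eqF.
(* The quotient theta / kap is the delta of the overview: [N] compares |Du| with one of its entries,
   and [A1] makes up for the factor A in the hypothesis on [P]. *)
pose kap := N * A1; have kap0 : 0 < kap by exact: mulr_gt0.
(* The second Young inequality puts K |u| / (eps delta) = (K kap / eps) |u| / theta into [Q]; the
   first one has a smaller argument since delta <= theta. The summand 1 ensures positivity. *)
pose B := K * kap / eps + 1.
have B0 : 0 < B by rewrite ltr_wpDl// divr_ge0// ?(ltW eps0)// mulr_ge0// ltW.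
have L0 : 0 < 2 * eps * (1 + n%:R * K1).
  by rewrite !mulr_gt0// ltr_wpDr// mulr_ge0// ltW.
(* Before absorption the integral of P(theta |H|) has coefficient eps from the first Young
   inequality and eps K1 from each partial derivative; absorbing half of the left-hand side doubles
   this. *)
exists (2 * eps * (1 + n%:R * K1)), B; split => // th th0 th1 u tu.
have [su _ _] := tu.
pose de := th / kap; have de0 : 0 < de by exact: divr_gt0.
(* The factor equals theta / A1. From A1 >= A follows A |D w_i| <= theta |H|, and from A1 >= 1 >=
   theta follows |w_i| <= |Du|; monotonicity of [P] and of [M] then applies. *)
pose w i := fun x => (de * N) * 'D_(evec i) u x.
have tw i : test_function Omega (w i).
  rewrite /w; under eq_fun do rewrite mulrC.
  by apply: test_function_mul; [exact: test_function_D|exact: smooth_cst].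
have deN0 : 0 < de * N by exact: mulr_gt0.
have deNE : de * N = th / A1.
  by rewrite /de /kap; field; rewrite !gt_eqF.
have deN1 : de * N <= 1.
  by rewrite deNE ler_pdivrMr// mul1r (le_trans th1)// le_max lexx orbT.
have AdeN : A * (de * N) <= th.
  by rewrite deNE mulrC -mulrA ler_piMr ?(ltW th0)// mulrC ler_pdivrMr// mul1r le_max lexx.
have kap1 : 1 <= kap.
  by rewrite /kap -[1]mulr1 ler_pM// ?le_max ?lexx ?orbT// /N ler1n.
have deth : de <= th by rewrite ler_pdivrMr// ler_peMr// ltW.
pose a x := eucl_norm (grad u x); pose h x := eucl_norm (hess u x).
pose b x := eucl_norm (dphi x).
have a0 x : 0 <= a x by exact: eucl_norm_ge0.
have h0 x : 0 <= h x by exact: eucl_norm_ge0.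
have b0 x : 0 <= b x by exact: eucl_norm_ge0.
have [IMoo mX key] := key_inequality oO Wphi muE NM M_C1 Mc M_near0 tu.
rewrite -/(K) in key mX.
pose Y x := 2 * eps * M (a x) + eps * P (th * h x) + 2 * eps * Q (B / th * `|u x|) +
   eps * \sum_i P (b x * `|w i x|).
have pointwise x : K * (quot2 M (a x ^+ 2) * (`|u x| * (h x + a x * b x))) <= Y x.
  have y1 := quot2_young M_ge0 P_ge0 Q_ge0 MPQ eps0 th0 K0 (a0 x) (normr_ge0 (u x)) (h0 x).
  have ab0 : 0 <= a x * b x by exact: mulr_ge0.
  have y2 := quot2_young M_ge0 P_ge0 Q_ge0 MPQ eps0 de0 K0 (a0 x) (normr_ge0 (u x)) ab0.
  have q1 t : 0 < t -> de <= t -> Q (K * `|u x| / (eps * t)) <= Q (B / th * `|u x|).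
    move=> t0 det; have et0 := mulr_gt0 eps0 t0; have ed0 := mulr_gt0 eps0 de0; apply: Q_ndecr; first by apply: divr_ge0; [exact: mulr_ge0|apply: ltW; exact: mulr_gt0].
    rewrite (@le_trans _ _ (K * `|u x| / (eps * de)))//.
      apply: ler_wpM2l; first exact: mulr_ge0.
      by rewrite lef_pV2 ?posrE; [rewrite ler_pM2l|exact: mulr_gt0|exact: mulr_gt0].
    rewrite [leLHS](_ : _ = K * kap / eps / th * `|u x|); last first.
      by rewrite /de; field; rewrite !gt_eqF.
    by rewrite ler_wpM2r// ler_wpM2r ?invr_ge0 ?(ltW th0)// /B lerDl.
  (* One summand dominates, the one of an entry comparable to |Du|; the others are nonnegative. When
     |Du| = 0 the left-hand side is P 0. *)
  have p1 : P (de * (a x * b x)) <= \sum_i P (b x * `|w i x|).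
    have s0 (J : pred 'I_n) : 0 <= \sum_(i | J i) P (b x * `|w i x|).
      by apply: sumr_ge0 => i _; apply: P_ge0; rewrite mulr_ge0.
    have [ax0|[i ai]] := eucl_norm_le_entry (grad u x).
      by rewrite /a ax0 mul0r mulr0 P0.
    rewrite (bigD1 i)//= (@le_trans _ _ (P (b x * `|w i x|)))//; last by rewrite lerDl.
    apply: P_ndecr; first by rewrite mulr_ge0// ltW.
    rewrite mulrCA mulrA [_ * b x]mulrC ler_wpM2l// /w normrM (gtr0_norm deN0).
    rewrite [a x * de]mulrC -[de * N * _]mulrA ler_pM2l//.
    by move: ai; rewrite mxE.
  have := q1 th th0 deth; have := q1 de de0 (lexx _).
  rewrite /Y => e2 e1.
  have {}e1 := ler_wpM2l (ltW eps0) e1; have {}e2 := ler_wpM2l (ltW eps0) e2.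
  have {}p1 : eps * P (de * (a x * b x)) <= eps * \sum_i P (b x * `|w i x|).
    by rewrite ler_pM2l.
  rewrite [leLHS](_ : _ = K * (quot2 M (a x ^+ 2) * (`|u x| * h x)) +
    K * (quot2 M (a x ^+ 2) * (`|u x| * (a x * b x)))); last by ring.
  apply: le_trans (lerD y1 y2) _.
  move: e1 e2 p1; move: (Q _) (Q _) (Q _) (P _) (P _) (\sum_i _) (M _) => q1' q2' q3' p1' p2' S m.
  by lra.
have mw i : measurable_fun Omega (fun x => `|w i x|).
  apply: (measurableT_comp (@normr_measurable R setT)); apply: measurable_funTS.
  by apply: continuous_measurable_row; apply: smooth_continuous; case: (tw i).
have mM : measurable_fun Omega (fun x => M (a x)).
  by apply: measurable_fun_ge0_comp => //; [exact: N_function_measurable|exact: measurable_grad_norm].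
have mP : measurable_fun Omega (fun x => P (th * h x)).
  apply: measurable_fun_ge0_comp => // [|x _]; last by rewrite mulr_ge0// ltW.
  by apply: measurable_funM => //; exact: measurable_hess_norm.
have mQ : measurable_fun Omega (fun x => Q (B / th * `|u x|)).
  apply: measurable_fun_ge0_comp => // [|x _]; last by rewrite mulr_ge0// divr_ge0// ltW.
  apply: measurable_funM => //; apply: (measurableT_comp (@normr_measurable R setT)).
  by apply: measurable_funTS; apply: continuous_measurable_row; exact: smooth_continuous.
have mPw i : measurable_fun Omega (fun x => P (b x * `|w i x|)).
  apply: measurable_fun_ge0_comp => // [|x _]; last by rewrite mulr_ge0.
  by apply: measurable_funM => //; exact: (measurable_weak_gradient_norm Wphi).
pose J (f : 'rV[R]_n -> R) : \bar R := (\int[mu]_(x in Omega) (f x)%:E)%E.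
have JD (f g : 'rV[R]_n -> R) : measurable_fun Omega f -> measurable_fun Omega g ->
    (forall x, 0 <= f x) -> (forall x, 0 <= g x) -> J (fun x => f x + g x) = (J f + J g)%E.
  move=> mf mg f0 g0; rewrite /J; under eq_integral do rewrite EFinD.
  by rewrite ge0_integralD//; do ?[exact/measurable_EFinP|move=> x _; rewrite lee_fin].
have JZ (k : R) (f : 'rV[R]_n -> R) : measurable_fun Omega f -> 0 <= k ->
    (forall x, 0 <= f x) -> J (fun x => k * f x) = (k%:E * J f)%E.
  move=> mf k0 f0; rewrite /J; under eq_integral do rewrite EFinM.
  by rewrite ge0_integralZl//; [exact/measurable_EFinP|move=> x _; rewrite lee_fin].
have M0 x : 0 <= M (a x) by exact: M_ge0.
have P0' x : 0 <= P (th * h x) by apply: P_ge0; rewrite mulr_ge0// ltW.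
have Q0' x : 0 <= Q (B / th * `|u x|) by apply: Q_ge0; rewrite mulr_ge0// divr_ge0// ltW.
have Pw0 i x : 0 <= P (b x * `|w i x|) by apply: P_ge0; rewrite mulr_ge0.
have mS : measurable_fun Omega (fun x => \sum_i P (b x * `|w i x|)).
  exact: measurable_sum.
have S0 x : 0 <= \sum_i P (b x * `|w i x|) by exact: sumr_ge0.
have JS : J (fun x => \sum_i P (b x * `|w i x|)) = (\sum_i J (fun x => P (b x * `|w i x|)))%E.
  rewrite /J; under eq_integral do rewrite -sumEFin.
  by rewrite ge0_integral_sum// => [i|i x _]; [exact/measurable_EFinP|rewrite lee_fin].
have e20 : 0 <= 2 * eps by rewrite mulr_ge0// ltW.
pose f1 x := 2 * eps * M (a x); pose f2 x := eps * P (th * h x).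
pose f3 x := 2 * eps * Q (B / th * `|u x|); pose f4 x := eps * \sum_i P (b x * `|w i x|).
have [m1 m2 m3 m4] : [/\ measurable_fun Omega f1, measurable_fun Omega f2,
    measurable_fun Omega f3 & measurable_fun Omega f4].
  by split; exact: measurable_funM.
have n1 x : 0 <= f1 x by exact: mulr_ge0.
have n2 x : 0 <= f2 x by apply: mulr_ge0 => //; exact: ltW.
have n3 x : 0 <= f3 x by exact: mulr_ge0.
have n4 x : 0 <= f4 x by apply: mulr_ge0 => //; exact: ltW.
have m12 : measurable_fun Omega (fun x => f1 x + f2 x) by exact: measurable_funD.
have m123 : measurable_fun Omega (fun x => f1 x + f2 x + f3 x) by exact: measurable_funD.
have n12 x : 0 <= f1 x + f2 x by exact: addr_ge0.
have n123 x : 0 <= f1 x + f2 x + f3 x by exact: addr_ge0.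
have mY : measurable_fun Omega Y by exact: measurable_funD.
have JY : J Y = ((2 * eps)%:E * J (fun x => M (a x)) + eps%:E * J (fun x => P (th * h x)) +
    (2 * eps)%:E * J (fun x => Q (B / th * `|u x|)%R) +
    eps%:E * \sum_i J (fun x => P (b x * `|w i x|)%R))%E.
  rewrite -JS -!JZ//; do ?exact: ltW.
  by rewrite -(JD f1 f2)// -(JD (fun x => f1 x + f2 x) f3)// -(JD (fun x => f1 x + f2 x + f3 x) f4).
have Jle (f g : 'rV[R]_n -> R) : measurable_fun Omega f -> measurable_fun Omega g ->
    (forall x, 0 <= f x) -> (forall x, f x <= g x) -> (J f <= J g)%E.
  move=> mf mg f0 fg; apply: ge0_le_integral => //; do ?exact/measurable_EFinP.
  - by move=> x _; rewrite lee_fin.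
  - by move=> x _; rewrite lee_fin.
have sw i : smooth (fun x => 'D_(evec i) u x) by exact: smooth_D.
have gw i x : eucl_norm (grad (w i) x) = de * N * eucl_norm (grad (fun y => 'D_(evec i) u y) x).
  by rewrite /w eucl_norm_grad_scale// gtr0_norm.
have Jw i : (J (fun x => P (b x * `|w i x|)%R) <=
    K1%:E * J (fun x => P (th * h x)) + K2%:E * J (fun x => M (a x)))%E.
  have [swi _ _] := tw i.
  apply: (le_trans (hP (tw i))); apply: leeD.
    apply: lee_wpmul2l; first by rewrite lee_fin ltW.
    apply: Jle => // [|x|x].
    - apply: measurable_fun_ge0_comp => // [|x _]; last by rewrite mulr_ge0 ?eucl_norm_ge0// ltW.
      by apply: measurable_funM => //; exact: measurable_grad_norm.
    - by apply: P_ge0; rewrite mulr_ge0 ?eucl_norm_ge0// ltW.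
    apply: P_ndecr; first by rewrite mulr_ge0 ?eucl_norm_ge0// ltW.
    rewrite gw mulrA; apply: ler_pM; rewrite ?eucl_norm_ge0//.
      by rewrite mulr_ge0// ltW.
    exact: grad_partial_le_hess.
  apply: lee_wpmul2l; first by rewrite lee_fin ltW.
  apply: Jle => // [|x|x].
  - by apply: measurable_fun_ge0_comp => //; exact: N_function_measurable.
  - exact: M_ge0.
  apply: (N_function_le NM) => //; rewrite /w normrM (gtr0_norm deN0).
  rewrite -[leRHS]mul1r; apply: ler_pM => //; first exact: ltW.
  by have := entry_le_eucl_norm (grad u x) ord0 i; rewrite mxE.
have JM : (J (fun x => M (a x)) <= J Y)%E.
  apply: (le_trans key); apply: Jle => // x.
  apply: mulr_ge0 => //; apply: mulr_ge0; first exact: quot2_ge0.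
  by apply: mulr_ge0 => //; apply: addr_ge0; [exact: h0|apply: mulr_ge0; [exact: a0|exact: b0]].
have J0 (f : 'rV[R]_n -> R) : (forall x, 0 <= f x) -> (0 <= J f)%E.
  by move=> f0; apply: integral_ge0 => x _; rewrite lee_fin.
have Jsum : (\sum_i J (fun x => P (b x * `|w i x|)%R) <=
    \sum_(i < n) (K1%:E * J (fun x => P (th * h x)) + K2%:E * J (fun x => M (a x))))%E.
  by apply: lee_sum => i _.
move: JM; rewrite JY; move: IMoo (J0 _ M0) (J0 _ P0') (J0 _ Q0') Jsum.
rewrite -/(J (fun x => M (a x))) -/(J (fun x => P (th * h x))) -/(J (fun x => Q (B / th * `|u x|))).
move: (J (fun x => M (a x))) (J (fun x => P (th * h x))) (J (fun x => Q (B / th * `|u x|)%R))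
  (\sum_i J (fun x => P (b x * `|w i x|)%R))%E.
(* [m] is finite by integrability of M(|Du|); if the integral of [P] or of [Q] is infinite, its
   positive coefficient makes the claim trivial. *)
move=> [m| |]// [p| |]// [q| |]// s _ m0 p0 q0;
  try by move=> _ _; rewrite ?gt0_muley ?lte_fin// ?addye// ?addey// leey.
rewrite sumEFin sumr_const card_ord -EFinD -[_ *+ n]mulr_natl => sle mle.
have {}mle : ((m)%:E <= (2 * eps * m + eps * p + 2 * eps * q + eps * (n%:R * (K1 * p + K2 * m)))%:E)%E.
  apply: (le_trans mle); rewrite [X in (_ <= X)%E]EFinD; apply: leeD => //.
  by rewrite EFinM; apply: lee_wpmul2l => //; rewrite lee_fin ltW.
move: mle m0 p0 q0; rewrite -EFinM -EFinD !lee_fin => mle m0 p0 q0.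
(* Absorption turns the coefficient 2 eps of the integral of [Q] into 4 eps, which is at most 1
   because 2 eps <= 1/2. *)
have e4 : 4 * eps * q <= q.
  rewrite -[leRHS]mul1r ler_wpM2r//; have : 0 <= eps * (n%:R * K2) by rewrite mulr_ge0 ?(ltW eps0)// mulr_ge0// ltW.
  by move: epsE; rewrite mulrDr; move: (eps * (n%:R * K2)) => y; lra.
have eE : eps * (n%:R * (K2 * m)) = m / 2 - 2 * eps * m.
  by rewrite (_ : m / 2 = eps * (2 + n%:R * K2) * m); [ring|rewrite epsE; field].
move: mle; rewrite [n%:R * (_ + _)]mulrDr [eps * (_ + _)]mulrDr eE => mle.
rewrite [2 * eps * (1 + _)]mulrDr [(2 * eps * 1 + _) * p]mulrDl.
have -> : 2 * eps * (n%:R * K1) * p = 2 * (eps * (n%:R * (K1 * p))) by ring.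
by move: mle e4; move: (eps * (n%:R * (K1 * p))) => y; lra.
Qed.

End part1.

(** * The inequality for the Luxemburg norms *)

Section euclidean_scale.
Context {R : realType} {n : nat}.

Lemma eucl_normZ p q (k : R) (A : 'M[R]_(p, q)) : eucl_norm (k *: A) = `|k| * eucl_norm A.
Proof.
apply/eqP; rewrite -(@eqrXn2 _ 2)// ?mulr_ge0 ?eucl_norm_ge0//.
rewrite exprMn real_normK ?num_real// !eucl_norm_sqr mulr_sumr; apply/eqP.
apply: eq_bigr => i _; rewrite mulr_sumr; apply: eq_bigr => j _.
by rewrite mxE exprMn.
Qed.

Lemma hess_scale (k : R) (u : 'rV[R]_n -> R) x : smooth u ->
  hess (fun y => k * u y) x = k *: hess u x.
Proof.
move=> su; have DZ (v : 'rV[R]_n -> R) i y : smooth v ->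
    'D_(evec i) (fun z => k * v z) y = k * 'D_(evec i) v y.
  move=> sv; rewrite derive_mul; [|exact: derivable_cst|exact: smooth_derivable].
  by rewrite derive_cst mulr0 addr0.
apply/matrixP => i j; rewrite !mxE.
rewrite (_ : (fun y => 'D_(evec j) _ y) = fun y => k * 'D_(evec j) u y); last first.
  by apply/funext => y; exact: DZ.
by apply: DZ; exact: smooth_D.
Qed.

End euclidean_scale.

Section part2.
Context {R : realType} {n : nat}.
Context (Omega : set 'rV[R]_n) (mu : {measure set 'rV[R]_n -> \bar R})
  (M P Q : R -> R) (L B : R).
Hypotheses (oO : open Omega) (mu_radon : radon_on Omega mu)
  (NM : N_function M) (NP : N_function P) (NQ : N_function Q)
  (L0 : 0 < L) (B0 : 0 < B)
  (interpolation : forall theta : R, 0 < theta -> theta <= 1 ->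
    forall u : 'rV[R]_n -> R, test_function Omega u ->
      (\int[mu]_(x in Omega) (M (eucl_norm (grad u x)))%:E <=
       L%:E * \int[mu]_(x in Omega) (P (theta * eucl_norm (hess u x)))%:E +
       \int[mu]_(x in Omega) (Q (B / theta * `|u x|))%:E)%E).

Let mO : measurable Omega. Proof. exact: open_measurable_row. Qed.

Let N_ge0 (N : R -> R) (NN : N_function N) (x : R) : 0 <= x -> 0 <= N x.
Proof. by case: NN => h _ _ _ _; exact: h. Qed.

Let integral_comp_le (N : R -> R) (f g : 'rV[R]_n -> R) : N_function N ->
  measurable_fun Omega f -> measurable_fun Omega g ->
  (forall x, 0 <= f x) -> (forall x, f x <= g x) ->
  (\int[mu]_(x in Omega) (N (f x))%:E <= \int[mu]_(x in Omega) (N (g x))%:E)%E.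
Proof.
move=> NN mf mg f0 fg; have g0 x : 0 <= g x by exact: le_trans (fg x).
have mN := N_function_measurable NN.
apply: ge0_le_integral => //.
- by move=> x _; rewrite lee_fin N_ge0.
- by apply/measurable_EFinP; exact: measurable_fun_ge0_comp.
- by apply/measurable_EFinP; exact: measurable_fun_ge0_comp.
- by move=> x _; rewrite lee_fin (N_function_le NN).
Qed.

Let measurable_mull (k : R) (f : 'rV[R]_n -> R) : measurable_fun Omega f ->
  measurable_fun Omega (fun x => k * f x).
Proof. by move=> mf; exact: measurable_funM. Qed.

Section test.
Context (u : 'rV[R]_n -> R) (tu : test_function Omega u).

Let su : smooth u. Proof. by case: tu. Qed.

(** p and q are any numbers competing in the two infima. The first part is applied to u / k, with k
    = sqrt(B p q) + B q and theta such that theta p <= k and B q / theta <= k; its right-hand side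
    is then at most L + 1. *)
Let admissible (p q : R) : 0 < p -> 0 < q ->
  (\int[mu]_(x in Omega) (P (`|eucl_norm (hess u x)| / p))%:E <= 1)%E ->
  (\int[mu]_(x in Omega) (Q (`|u x| / q))%:E <= 1)%E ->
  (luxemburg_norm mu Omega M (fun x => eucl_norm (grad u x)) <=
   ((L + 2) * (Num.sqrt (B * (p * q)) + B * q))%:E)%E.
Proof.
move=> p0 q0 Pp Qq.
(* theta = r balances theta p and B q / theta, both equal to sqrt(B p q). If r > 1, then theta = 1
   leaves p <= sqrt(B p q) and B q; this explains the two summands of k. *)
pose r := Num.sqrt (B * q / p).
have r0 : 0 < r by rewrite sqrtr_gt0 divr_gt0// mulr_gt0.
pose th := Num.min 1 r.
have th0 : 0 < th by rewrite lt_min ltr01.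
have th1 : th <= 1 by rewrite ge_min lexx.
pose k := Num.sqrt (B * (p * q)) + B * q.
have k0 : 0 < k by rewrite ltr_wpDl ?sqrtr_ge0// mulr_gt0.
have r2 : r ^+ 2 = B * q / p by rewrite sqr_sqrtr// divr_ge0 ?mulr_ge0// ltW.
have rp : r * p = Num.sqrt (B * (p * q)).
  rewrite -[p in LHS]ger0_norm ?(ltW p0)// -sqrtr_sqr -sqrtrM; last by rewrite divr_ge0 ?mulr_ge0// ltW.
  by congr Num.sqrt; field; rewrite gt_eqF.
have thp : th * p <= k.
  rewrite /k (@le_trans _ _ (r * p))//; first by rewrite ler_wpM2r ?(ltW p0)// ge_min lexx orbT.
  by rewrite rp lerDl mulr_ge0// ltW.
have Bq : B * q / th <= k.
  rewrite /k /th; have [r1|r1] := leP 1 r; first by rewrite divr1 lerDr sqrtr_ge0.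
  have rpr : r * p * r = B * q by rewrite mulrAC -expr2 r2 divfK// gt_eqF.
  rewrite -[in leLHS]rpr mulfK ?gt_eqF// rp lerDl mulr_ge0//; exact: ltW.
have ki0 : 0 < k^-1 by rewrite invr_gt0.
pose v x := k^-1 * u x.
have tv : test_function Omega v.
  by rewrite /v; under eq_fun do rewrite mulrC; apply: test_function_mul => //; exact: smooth_cst.
have mg := measurable_grad_norm (D := Omega) su.
have mh := measurable_hess_norm (D := Omega) su.
have mu' : measurable_fun Omega (fun x => `|u x|).
  apply: (measurableT_comp (@normr_measurable R setT)); apply: measurable_funTS.
  by apply: continuous_measurable_row; exact: smooth_continuous.
have key : (\int[mu]_(x in Omega) (M (k^-1 * eucl_norm (grad u x)))%:E <= (L + 1)%:E)%E.
  have := interpolation th0 th1 tv.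
  under eq_integral do rewrite eucl_norm_grad_scale// gtr0_norm//.
  move=> /le_trans; apply; rewrite EFinD -[X in (_ <= X + _)%E]mule1; apply: leeD.
    apply: lee_wpmul2l; first by rewrite lee_fin ltW.
    apply: le_trans Pp; apply: integral_comp_le => //.
    - by apply: measurable_mull; apply: measurable_hess_norm; case: tv.
    - by under eq_fun do rewrite mulrC; apply: measurable_mull; apply: (measurableT_comp (@normr_measurable R setT)).
    - by move=> x; rewrite mulr_ge0 ?eucl_norm_ge0// ltW.
    move=> x; rewrite /v hess_scale// eucl_normZ (gtr0_norm ki0) ger0_norm ?eucl_norm_ge0//.
    rewrite mulrA [leRHS]mulrC ler_wpM2r ?eucl_norm_ge0//.
    by rewrite ler_pdivrMr// ler_pdivlMl// mulrC.
  apply: le_trans Qq; apply: integral_comp_le => //.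
  - apply: measurable_mull; apply: (measurableT_comp (@normr_measurable R setT)).
    by apply: measurable_mull; apply: measurable_funTS; apply: continuous_measurable_row; exact: smooth_continuous.
  - by under eq_fun do rewrite mulrC; exact: measurable_mull.
  - by move=> x; rewrite mulr_ge0// divr_ge0// ltW.
  move=> x; rewrite /v normrM (gtr0_norm ki0) mulrA [leRHS]mulrC ler_wpM2r//.
  by rewrite ler_pdivrMr// [leRHS]mulrC ler_pdivlMr// mulrAC.
have L2 : 0 < L + 2 by rewrite addr_gt0.
(* Convexity gives M(y / (L + 2)) <= M(y) / (L + 2), which brings the bound L + 1 on the integral
   below 1. *)
apply: ereal_inf_lbound; exists ((L + 2) * k) => //; split; first exact: mulr_gt0.
have L2i : 0 <= (L + 2)^-1 <= 1.
  have L21 : 1 <= L + 2 by apply: ler_wpDl; [exact: ltW|rewrite ler1n].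
  by rewrite invr_ge0 (ltW L2) invf_le1.
apply: (@le_trans _ _ ((L + 2)^-1%:E * \int[mu]_(x in Omega) (M (k^-1 * eucl_norm (grad u x)))%:E)%E).
  have mM : measurable_fun Omega (fun x => M (k^-1 * eucl_norm (grad u x))).
    apply: measurable_fun_ge0_comp; first exact: N_function_measurable.
      exact: measurable_mull.
    by move=> x _; rewrite mulr_ge0 ?eucl_norm_ge0// ltW.
  rewrite -ge0_integralZl//; last 3 first.
  - exact/measurable_EFinP.
  - by move=> x _; rewrite lee_fin N_ge0// mulr_ge0 ?eucl_norm_ge0// ltW.
  - by rewrite lee_fin; case/andP: L2i.
  apply: ge0_le_integral => //.
  - by move=> x _; rewrite lee_fin N_ge0// divr_ge0// ltW// mulr_gt0.
  - apply/measurable_EFinP; apply: measurable_fun_ge0_comp; first exact: N_function_measurable.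
      under eq_fun do rewrite mulrC; apply: measurable_mull.
      exact: (measurableT_comp (@normr_measurable R setT)).
    by move=> x _; rewrite divr_ge0// ltW// mulr_gt0.
  - by apply/measurable_EFinP; exact: measurable_mull.
  move=> x _; rewrite -EFinM lee_fin ger0_norm ?eucl_norm_ge0//.
  rewrite invfM mulrCA [_ * k^-1]mulrC; apply: N_function_scale => //.
  by rewrite mulr_ge0 ?eucl_norm_ge0// ltW.
apply: (@le_trans _ _ ((L + 2)^-1%:E * (L + 1)%:E)%E).
  by apply: lee_wpmul2l => //; rewrite lee_fin; case/andP: L2i.
by rewrite -EFinM lee_fin mulrC ler_pdivrMr// mul1r lerD2l ler1n.
Qed.

(** Makes the norm of the Hessian finite. This excludes the product +oo * 0, which is 0 by
    convention and would make the right-hand side of the final inequality vanish if the norm of u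
    were 0. *)
Let hess_admissible : exists2 p : R, 0 < p &
  (\int[mu]_(x in Omega) (P (`|eucl_norm (hess u x)| / p))%:E <= 1)%E.
Proof.
have [_ cK KO] := tu.
have [[mH [C HC]] _] : bms (fun x => eucl_norm (hess u x)).
  apply: bms_eucl_norm => i j; under eq_fun do rewrite mxE.
  have tuK : test_in (supp u) u by split.
  exact: test_in_bms (test_inD i (test_inD j tuK)).
have C0 : 0 <= C by exact: le_trans (HC 0).
have H0 x : ~ supp u x -> eucl_norm (hess u x) = 0.
  move=> xK; have -> : hess u x = 0 *: hess u x; last by rewrite eucl_normZ normr0 mul0r.
  rewrite scale0r; apply/matrixP => i j; rewrite !mxE.
  by apply: (@supp_out _ _ (fun y => 'D_(evec i) (fun z => 'D_(evec j) u z) y)) => /supp_D/supp_D.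
have muK : (mu (supp u) < +oo)%E by case: mu_radon => + _; exact.
pose m := fine (mu (supp u)).
have muE : mu (supp u) = m%:E by rewrite fineK// ge0_fin_numE.
have m0 : 0 <= m by rewrite /m fine_ge0.
have PC : 0 <= P C by exact: N_ge0.
(* With |H| <= C and m the measure of the support, the integral is at most P(C) m / p; p >= 1 is
   what allows P(y / p) <= P(y) / p. *)
pose p := P C * m + 1.
have p1 : 1 <= p by rewrite lerDr mulr_ge0.
have p0 : 0 < p by exact: lt_le_trans p1.
exists p => //.
have mK : measurable (supp u) by exact: compact_measurable_row.
apply: (@le_trans _ _ (\int[mu]_(x in Omega) ((P C / p)%:E * (\1_(supp u) x)%:E))%E).
  have mH' : measurable_fun Omega (fun x => `|eucl_norm (hess u x)| / p).
    under eq_fun do rewrite mulrC; apply: measurable_mull.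
    apply: (measurableT_comp (@normr_measurable R setT)); exact: measurable_hess_norm.
  apply: ge0_le_integral => //.
  - by move=> x _; rewrite lee_fin N_ge0// divr_ge0// ltW.
  - apply/measurable_EFinP; apply: measurable_fun_ge0_comp => //; first exact: N_function_measurable.
    by move=> x _; rewrite divr_ge0// ltW.
  - apply/measurable_EFinP; apply: measurable_mull; exact: measurable_funTS.
  move=> x _; rewrite -EFinM lee_fin ger0_norm ?eucl_norm_ge0// indicE.
  have [xK|/negP xK] := boolP (x \in supp u).
    rewrite mulr1 mulrC [leRHS]mulrC.
    apply: (@le_trans _ _ (p^-1 * P (eucl_norm (hess u x)))).
      apply: N_function_scale; rewrite ?eucl_norm_ge0//.
      by rewrite invr_ge0 (ltW p0)/= invf_le1.
    rewrite ler_wpM2l ?invr_ge0 ?(ltW p0)//; apply: (N_function_le NP); first exact: eucl_norm_ge0.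
    exact: le_trans (ler_norm _) (HC x).
  by rewrite H0 ?mul0r ?mulr0 ?N_function0//; move=> /mem_set.
rewrite ge0_integralZl//; last 2 first.
- by apply/measurable_EFinP; exact: measurable_funTS.
- by rewrite lee_fin divr_ge0// ltW.
rewrite integral_indic// setIidl// muE -EFinM lee_fin.
by rewrite mulrAC ler_pdivrMr// mul1r lerDl.
Qed.

Let lux_lt N (f : 'rV[R]_n -> R) (y : \bar R) : (luxemburg_norm mu Omega N f < y)%E ->
  exists2 k : R, 0 < k /\ (\int[mu]_(x in Omega) (N (`|f x| / k))%:E <= 1)%E & (k%:E < y)%E.
Proof. by move=> /ereal_inf_lt[_ [k [k0 Nk] <-] ky]; exists k. Qed.

Let lux_ge0 N (f : 'rV[R]_n -> R) : (0 <= luxemburg_norm mu Omega N f)%E.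
Proof. by apply: le_ereal_inf_tmp => _ [k [k0 _] <-]; rewrite lee_fin ltW. Qed.

(** The infima may be 0 or fail to be attained, so [admissible] is used above the two norms, and the
    excess e tends to 0 by continuity of the square root. If the norm of u is infinite, so is the
    right-hand side. *)
Lemma luxemburg_interpolation :
  (luxemburg_norm mu Omega M (fun x => eucl_norm (grad u x)) <=
   (2 * (L + 2) * Num.sqrt B)%:E * sqrte
     (luxemburg_norm mu Omega P (fun x => eucl_norm (hess u x)) *
      luxemburg_norm mu Omega Q u) +
   (2 * (L + 2) * B)%:E * luxemburg_norm mu Omega Q u)%E.
Proof.
set L1 := 2 * (L + 2) * Num.sqrt B; set L2 := 2 * (L + 2) * B.
have Loo : (luxemburg_norm mu Omega P (fun x => eucl_norm (hess u x)) < +oo)%E.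
  have [p p0 Pp] := hess_admissible.
  by apply: le_lt_trans (ltry p); apply: ereal_inf_lbound; exists p.
have P0 := lux_ge0 P (fun x => eucl_norm (hess u x)).
have Q0 := lux_ge0 Q u.
have M0 := lux_ge0 M (fun x => eucl_norm (grad u x)).
have L10 : 0 <= L1 by rewrite /L1 mulr_ge0 ?sqrtr_ge0// mulr_ge0// addr_ge0// ltW.
have L20 : 0 < L2 by rewrite /L2 mulr_gt0// mulr_gt0// addr_gt0.
have approx (p q : R) : (luxemburg_norm mu Omega P (fun x => eucl_norm (hess u x)) < p%:E)%E ->
    (luxemburg_norm mu Omega Q u < q%:E)%E ->
    (luxemburg_norm mu Omega M (fun x => eucl_norm (grad u x)) <=
     ((L + 2) * (Num.sqrt (B * (p * q)) + B * q))%:E)%E.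
  move=> /lux_lt[p' [p'0 Pp']]; rewrite lte_fin => p'p.
  move=> /lux_lt[q' [q'0 Qq']]; rewrite lte_fin => q'q.
  apply: (le_trans (admissible p'0 q'0 Pp' Qq')); rewrite lee_fin.
  have L20' : 0 < L + 2 by rewrite addr_gt0.
  rewrite ler_pM2l// lerD//; last by rewrite ler_pM2l// ltW.
  by rewrite ler_wsqrtr// ler_pM2l// ler_pM// ltW.
move: Loo P0 Q0 M0 approx.
move: (luxemburg_norm mu Omega P _) (luxemburg_norm mu Omega Q _) (luxemburg_norm mu Omega M _).
move=> [p| |]// [q| |]// m _; rewrite ?lee_fin => p0 q0 m0 approx; last first.
  rewrite [X in (_ <= _ + X)%E]gt0_muley ?lte_fin// addey ?leey//.
  have : (0 <= L1%:E * sqrte (p%:E * +oo))%E by rewrite mule_ge0 ?lee_fin// sqrte_ge0.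
  by case: (L1%:E * _)%E.
have moo : m \is a fin_num.
  rewrite ge0_fin_numE//; apply: le_lt_trans (ltry _); apply: (approx (p + 1) (q + 1)).
    by rewrite lte_fin ltrDl.
  by rewrite lte_fin ltrDl.
rewrite -(fineK moo) in approx *; move: (fine m) approx => {m0 moo}m approx.
rewrite -EFinM/= -!EFinM -EFinD lee_fin.
have mle : m <= (L + 2) * (Num.sqrt (B * (p * q)) + B * q).
  pose F (e : R) := (L + 2) * (Num.sqrt (B * ((p + e) * (q + e))) + B * (q + e)).
  have cF : F e @[e --> 0^'+] --> F 0.
    have c0 : e @[e --> (0 : R)^'+] --> (0 : R) by apply: cvg_within_filter; exact: cvg_id.
    have cl (t : R) : t + e @[e --> (0 : R)^'+] --> t + 0 by exact: (cvgD (cvg_cst t) c0).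
    have cB : B * ((p + e) * (q + e)) @[e --> (0 : R)^'+] --> B * ((p + 0) * (q + 0)).
      exact: (cvgM (cvg_cst B) (cvgM (cl p) (cl q))).
    have cs : Num.sqrt (B * ((p + e) * (q + e))) @[e --> (0 : R)^'+] -->
      Num.sqrt (B * ((p + 0) * (q + 0))) by exact: (cvg_comp _ _ cB (@sqrt_continuous R _)).
    exact: (cvgM (cvg_cst (L + 2)) (cvgD cs (cvgM (cvg_cst B) (cl q)))).
  have -> : (L + 2) * (Num.sqrt (B * (p * q)) + B * q) = F 0 by rewrite /F !addr0.
  apply: (cvgr_to_ge cF); near=> e.
  have e0 : 0 < e by [].
  by rewrite -lee_fin; apply: approx; rewrite lte_fin ltrDl.
apply: (le_trans mle); rewrite /L1 /L2 sqrtrM; last exact: ltW.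
have : 0 <= (L + 2) * (Num.sqrt B * Num.sqrt (p * q)) by rewrite !mulr_ge0 ?sqrtr_ge0// addr_ge0// ltW.
have : 0 <= (L + 2) * (B * q) by rewrite mulr_ge0 ?mulr_ge0 ?addr_ge0//; exact: ltW.
rewrite mulrDr -!mulrA; move: (Num.sqrt B * Num.sqrt (p * q)) (B * q) => y z.
by move: ((L + 2) * y) ((L + 2) * z) => y' z'; lra.
Unshelve. all: by end_near. Qed.

End test.
End part2.

Theorem theorem3p2 (R : realType) (n : nat) (Omega : set 'rV[R]_n)
    (M P Q : R -> R) (phi : 'rV[R]_n -> R) (dphi : 'rV[R]_n -> 'rV[R]_n)
    (mu : {measure set 'rV[R]_n -> \bar R}) (K1 K2 A : R)
    (Omega_open : open Omega)
    (M_Nfun : N_function M) (M_C1 : C1_pos M) (M_Delta2 : Delta2 M)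
    (M_near0 : exists C : R, \forall x \near 0^'+, `|derive1 M x / x| <= C)
    (phi_W1oo : W1oo_loc Omega phi dphi)
    (mu_density : forall E : set 'rV[R]_n, measurable E ->
      mu E = (\int[lebesgue_row n]_(x in E `&` Omega) (expR (- phi x))%:E)%E)
    (mu_radon : radon_on Omega mu)
    (P_ge0 : forall x : R, 0 <= x -> 0 <= P x)
    (Q_ge0 : forall x : R, 0 <= x -> 0 <= Q x)
    (P_ndecr : forall x y : R, 0 <= x -> x <= y -> P x <= P y)
    (Q_ndecr : forall x y : R, 0 <= x -> x <= y -> Q x <= Q y)
    (P_meas : measurable_fun (`[0, +oo[%classic : set R) P)
    (Q_meas : measurable_fun (`[0, +oo[%classic : set R) Q)
    (P0 : P 0 = 0) (Q0 : Q 0 = 0)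
    (MPQ : forall u v w : R, 0 < u -> 0 < v -> 0 < w ->
      M u / u ^+ 2 * (v * w) <= M u + P v + Q w)
    (K1_gt0 : 0 < K1) (K2_gt0 : 0 < K2) (A_gt0 : 0 < A)
    (hP : forall u : 'rV[R]_n -> R, test_function Omega u ->
      (\int[mu]_(x in Omega) (P (eucl_norm (dphi x) * `|u x|))%:E <=
       K1%:E * \int[mu]_(x in Omega) (P (A * eucl_norm (grad u x)))%:E +
       K2%:E * \int[mu]_(x in Omega) (M `|u x|)%:E)%E) :
  exists L B : R, [/\ 0 < L, 0 < B,
    forall theta : R, 0 < theta -> theta <= 1 ->
    forall u : 'rV[R]_n -> R, test_function Omega u ->
      (\int[mu]_(x in Omega) (M (eucl_norm (grad u x)))%:E <=
       L%:E * \int[mu]_(x in Omega) (P (theta * eucl_norm (hess u x)))%:E +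
       \int[mu]_(x in Omega) (Q (B / theta * `|u x|))%:E)%E &
    N_function P -> N_function Q ->
    forall u : 'rV[R]_n -> R, test_function Omega u ->
      let L1 := 2 * (L + 2) * Num.sqrt B in
      let L2 := 2 * (L + 2) * B in
      (luxemburg_norm mu Omega M (fun x => eucl_norm (grad u x)) <=
       L1%:E * sqrte
         (luxemburg_norm mu Omega P (fun x => eucl_norm (hess u x)) *
          luxemburg_norm mu Omega Q u) +
       L2%:E * luxemburg_norm mu Omega Q u)%E].
Proof.
have [L [B [L0 B0 interpolation]]] := gradient_interpolation Omega_open M_Nfun M_C1 M_Delta2
  M_near0 phi_W1oo mu_density P_ge0 Q_ge0 P_ndecr Q_ndecr P_meas Q_meas P0 MPQ
  K1_gt0 K2_gt0 A_gt0 hP.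
exists L, B; split => // NP NQ u tu.
exact: (luxemburg_interpolation Omega_open mu_radon M_Nfun NP NQ L0 B0 interpolation tu).
Qed.
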